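(* Assume $C>0$ and that $G/K$ carries exactly two $G$-invariant Einstein metrics up to scaling, corresponding to the two roots $0<y_1<y_2$ of $C-Dy+(A+B)y^2=0$. Let the initial metric $(x_1(0),x_2(0))$ satisfy $y(0)<y_1$, where $y(t)=x_1(t)/x_2(t)$. Then there exists a positive constant $T<\infty$ such that there exists a unique type I ancient solution to the HRF with this initial metric defined on $(-\infty,T)$. As $t\to T$, the fibre $H/K$ of $H/K\to G/K\to G/H$ shrinks to a point and $G/K$ collapses in the Hausdorff-Gromov sense to $G/H$. Furthermore, as $t\to-\infty$, $y(t)\to y_1$.
   Context: Setting. Let $G/K$ be a compact, connected, effective homogeneous space with $\mathfrak g=\mathfrak k\oplus\mathfrak p$, whose isotropy representation splits into two inequivalent irreducible $\mathrm{Ad}|_K$-invariant summands $\mathfrak p=\mathfrak p_1\oplus\mathfrak p_2$. Suppose there is an intermediate Lie group $H$, $K<H<G$, with Lie algebra $\mathfrak h=\mathfrak k\oplus\mathfrak p_1$; every $G$-invariant Riemannian metric on $G/K$ is then obtained from a fixed Riemannian submersion $H/K\to G/K\to G/H$ by rescaling fibre and base. Let $Q$ be an $\mathrm{Ad}|_K$-invariant scalar product on $\mathfrak p$ with $\mathfrak p_1\perp\mathfrak p_2$ which on each $\mathfrak p_i$ is a negative multiple of the Killing form $B_{\mathfrak g}$ of $\mathfrak g$: $-B_{\mathfrak g}|_{\mathfrak p_i}=b_iQ|_{\mathfrak p_i}$. Put $d_i=\dim\mathfrak p_i$ and $[ijk]=\sum Q([e_\alpha,e_\beta]_{\mathfrak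 p},e_\gamma)^2$, the sum over $Q$-orthonormal bases of $\mathfrak p_i,\mathfrak p_j,\mathfrak p_k$; then $[112]=0$, and it is assumed that $[122]>0$. Let $$A=\tfrac{[122]}{2d_1},\quad B=\tfrac{[122]}{d_2},\quad C=b_1-\tfrac{[111]}{2d_1}-\tfrac{[122]}{d_1},\quad D=b_2-\tfrac{[222]}{2d_2}$$ (so $A,B,D>0$ and $C\ge0$). Every $G$-invariant Riemannian metric is $x_1Q|_{\mathfrak p_1}\oplus x_2Q|_{\mathfrak p_2}$ with $x_1,x_2>0$; it is Einstein if and only if $y=x_1/x_2$ is a positive root of $C-Dy+(A+B)y^2=0$. The homogeneous Ricci flow (HRF) is the Ricci flow $\partial_tg=-2\,\mathrm{Ric}(g)$ for $g(t)=x_1(t)Q|_{\mathfrak p_1}\oplus x_2(t)Q|_{\mathfrak p_2}$, equivalently the system $\dot x_1=-C-A\,x_1^2/x_2^2$, $\dot x_2=-D+B\,x_1/x_2$ together with $x_1(t),x_2(t)>0$. An ancient solution is one defined on $(-\infty,T)$ with $T<\infty$; it is of type I if $\lim_{t\to-\infty}|t|\sup_p|\mathrm{Rm}(g(t))|_{g(t)}(p)<\infty$. ''The fibre $H/K$ shrinks to a point'' means $x_1(t)\to0$ while $x_2(t)$ tends to a finite strictly positive limit. ''$G/K$ collapses in the Hausdorff-Gromov sense to $G/H$'' means that $(G/K,g(t))$ converges to $G/H$, with a $G$-invariant Riemannian metric, for the distance $d_{H\text{-}G}(X,Y)=\inf\{\epsilon: \exists S\subseteq X\times Y$ projecting onto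 both factors with $|d_X(p_1,q_1)-d_Y(p_2,q_2)|<\epsilon$ for all $(p_1,p_2),(q_1,q_2)\in S\}$.
   Formalization: The fibre H/K is assumed connected; otherwise the collapse claim fails: for K=U(2)<H=S(O(4)×O(1))<G=SO(5), G/K=CP^3 collapses to S^4, a double cover of G/H=RP^4, and not to G/H. *)

(* Defs.v *)
From HB Require Import structures.
From mathcomp Require Import all_boot all_order all_algebra.
From mathcomp Require Import all_classical all_reals all_analysis.
Set Implicit Arguments.
Unset Strict Implicit.
Unset Printing Implicit Defensive.
Import Order.TTheory GRing.Theory Num.Theory.
Import numFieldNormedType.Exports.
Local Open Scope classical_set_scope.
Local Open Scope ring_scope.

(* A compact Lie group is modelled as a closed subgroup of some O(n); by
   Peter-Weyl and averaging every compact Lie group is of this form, and every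
   closed subgroup of O(n) is a compact Lie group. *)
Definition compact_lie_group (R : realType) (n : nat) (G : set 'M[R]_n) : Prop :=
  [/\ closed G, G 1%:M,
      forall a b, G a -> G b -> G (a *m b),
      forall a, G a -> G (invmx a)
    & forall a, G a -> a *m a^T = 1%:M].

Definition C1_curve (R : realType) (n : nat) (c : R -> 'M[R]_n) : Prop :=
  forall i j, (forall s, derivable (fun u => c u i j) s 1) /\
              continuous (derive1 (fun u => c u i j)).

Definition velocity (R : realType) (n : nat) (c : R -> 'M[R]_n) (s : R) : 'M[R]_n :=
  \matrix_(i, j) derive1 (fun u => c u i j) s.

(* gg is the tangent space of G at the identity. *)
Definition lie_algebra_of (R : realType) (n : nat) (G : set 'M[R]_n)
    (gg : {vspace 'M[R]_n}) : Prop :=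
  forall X, X \in gg <->
    exists c : R -> 'M[R]_n,
      [/\ C1_curve c, forall s, G (c s), c 0 = 1%:M & velocity c 0 = X].

Definition lie (R : realType) (n : nat) (X Y : 'M[R]_n) : 'M[R]_n :=
  X *m Y - Y *m X.

Definition Ad (R : realType) (n : nat) (a X : 'M[R]_n) : 'M[R]_n :=
  a *m X *m invmx a.

(* Trace of an endomorphism f of the subspace U. *)
Definition tr_on (R : realType) (n : nat) (U : {vspace 'M[R]_n})
    (f : 'M[R]_n -> 'M[R]_n) : R :=
  \sum_(i < \dim U) coord (vbasis U) i (f (vbasis U)`_i).

Definition killing (R : realType) (n : nat) (gg : {vspace 'M[R]_n})
    (X Y : 'M[R]_n) : R :=
  tr_on gg (fun Z => lie X (lie Y Z)).

Definition Ad_stable (R : realType) (n : nat) (K : set 'M[R]_n)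
    (V : {vspace 'M[R]_n}) : Prop :=
  forall a X, K a -> X \in V -> Ad a X \in V.

Definition Ad_irreducible (R : realType) (n : nat) (K : set 'M[R]_n)
    (V : {vspace 'M[R]_n}) : Prop :=
  [/\ V <> 0%VS, Ad_stable K V
    & forall W : {vspace 'M[R]_n}, (W <= V)%VS -> Ad_stable K W ->
        W = 0%VS \/ W = V].

Definition Ad_equivalent (R : realType) (n : nat) (K : set 'M[R]_n)
    (V W : {vspace 'M[R]_n}) : Prop :=
  exists f : 'End('M[R]_n),
    [/\ (f @: V)%VS = W, (V :&: lker f)%VS = 0%VS
      & forall a X, K a -> X \in V -> f (Ad a X) = Ad a (f X)].

Definition bilinear_on (R : realType) (n : nat) (V : {vspace 'M[R]_n})
    (q : 'M[R]_n -> 'M[R]_n -> R) : Prop :=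
  forall (r : R) X Y Z, X \in V -> Y \in V -> Z \in V ->
    q (r *: X + Y) Z = r * q X Z + q Y Z /\
    q Z (r *: X + Y) = r * q Z X + q Z Y.

Definition scalar_product_on (R : realType) (n : nat) (V : {vspace 'M[R]_n})
    (q : 'M[R]_n -> 'M[R]_n -> R) : Prop :=
  [/\ bilinear_on V q,
      forall X Y, X \in V -> Y \in V -> q X Y = q Y X
    & forall X, X \in V -> X <> 0 -> 0 < q X X].

Definition Ad_invariant_on (R : realType) (n : nat) (K : set 'M[R]_n)
    (V : {vspace 'M[R]_n}) (q : 'M[R]_n -> 'M[R]_n -> R) : Prop :=
  forall a X Y, K a -> X \in V -> Y \in V -> q (Ad a X) (Ad a Y) = q X Y.

Definition orthonormal_basis (R : realType) (n : nat) (V : {vspace 'M[R]_n})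
    (q : 'M[R]_n -> 'M[R]_n -> R) (e : seq 'M[R]_n) : Prop :=
  basis_of V e /\
  forall i j, (i < size e)%N -> (j < size e)%N -> q e`_i e`_j = (i == j)%:R.

(* G/H is connected: the quotient topology is read on right H-saturated
   relatively open subsets of G. *)
Definition connected_quotient (R : realType) (n : nat) (G H : set 'M[R]_n) : Prop :=
  forall U V : set 'M[R]_n, open U -> open V ->
    (forall a h, G a -> H h -> U a -> U (a *m h)) ->
    (forall a h, G a -> H h -> V a -> V (a *m h)) ->
    G `<=` U `|` V -> G `&` U !=set0 -> G `&` V !=set0 ->
    G `&` U `&` V !=set0.

(* Only the identity of K acts trivially on G/K. *)
Definition effective (R : realType) (n : nat) (G K : set 'M[R]_n) : Prop :=
  forall k, K k -> (forall a, G a -> K (invmx a *m k *m a)) -> k = 1%:M.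

(* A G-invariant Riemannian metric on G/H, given as the pullback to gg of the
   scalar product on T_{eH}(G/H) = gg/hh. *)
Definition invariant_metric (R : realType) (n : nat) (H : set 'M[R]_n)
    (gg hh : {vspace 'M[R]_n}) (q : 'M[R]_n -> 'M[R]_n -> R) : Prop :=
  [/\ bilinear_on gg q,
      forall X Y, X \in gg -> Y \in gg -> q X Y = q Y X,
      Ad_invariant_on H gg q
    & forall X, X \in gg -> 0 <= q X X /\ (q X X = 0 <-> X \in hh)].

(* Length of the projection to G/H of a curve in G over [0, 1]. *)
Definition curve_length (R : realType) (n : nat) (q : 'M[R]_n -> 'M[R]_n -> R)
    (c : R -> 'M[R]_n) : R :=
  \int[lebesgue_measure]_(s in `[0, 1])
    Num.sqrt (q (invmx (c s) *m velocity c s) (invmx (c s) *m velocity c s)).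

(* joined G q a b l: a concatenation of C^1 curves in G, of total length l,
   leads from a to b. *)
Inductive joined (R : realType) (n : nat) (G : set 'M[R]_n)
    (q : 'M[R]_n -> 'M[R]_n -> R) (a : 'M[R]_n) : 'M[R]_n -> R -> Prop :=
| joined_refl : G a -> joined G q a a 0
| joined_step (c : R -> 'M[R]_n) (l : R) :
    C1_curve c -> (forall s, 0 <= s <= 1 -> G (c s)) ->
    joined G q a (c 0) l -> joined G q a (c 1) (l + curve_length q c).

Definition cosets (R : realType) (n : nat) (G H : set 'M[R]_n) : set (set 'M[R]_n) :=
  [set [set a *m h | h in H] | a in G].

(* Riemannian distance on G/H, points being cosets; curves in G/H are the
   projections of curves in G. *)
Definition coset_dist (R : realType) (n : nat) (G : set 'M[R]_n)
    (q : 'M[R]_n -> 'M[R]_n -> R) (x y : set 'M[R]_n) : R :=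
  inf [set l | exists a b, [/\ x a, y b & joined G q a b l]].

Definition HG_dist (R : realType) (S U : Type) (X : set S) (Y : set U)
    (dX : S -> S -> R) (dY : U -> U -> R) : \bar R :=
  ereal_inf [set eps%:E | eps in [set eps : R | exists C : set (S * U),
    [/\ C `<=` X `*` Y, fst @` C = X, snd @` C = Y
      & forall p q, C p -> C q -> `|dX p.1 q.1 - dY p.2 q.2| < eps]]].

(* Curvature at the base point of the G-invariant metric on G/K induced by the
   scalar product q on pp, for a reductive decomposition gg = kk + pp with
   projections prk, prp and a q-orthonormal basis e of pp (Nomizu's formula,
   nabla X Y = [X, Y]_p / 2 + U(X, Y); see Kobayashi-Nomizu II, Ch. X).
   The choice of e is immaterial. *)
Definition nabla (R : realType) (n : nat) (prp : 'End('M[R]_n))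
    (q : 'M[R]_n -> 'M[R]_n -> R) (e : seq 'M[R]_n) (X Y : 'M[R]_n) : 'M[R]_n :=
  2^-1 *: prp (lie X Y) +
  2^-1 *: \sum_(u <- e) (q (prp (lie u X)) Y + q X (prp (lie u Y))) *: u.

Definition Riem (R : realType) (n : nat) (prk prp : 'End('M[R]_n))
    (q : 'M[R]_n -> 'M[R]_n -> R) (e : seq 'M[R]_n) (X Y Z : 'M[R]_n) : 'M[R]_n :=
  let D := nabla prp q e in
  D X (D Y Z) - D Y (D X Z) - D (prp (lie X Y)) Z - lie (prk (lie X Y)) Z.

Definition Ricci (R : realType) (n : nat) (prk prp : 'End('M[R]_n))
    (q : 'M[R]_n -> 'M[R]_n -> R) (e : seq 'M[R]_n) (X Y : 'M[R]_n) : R :=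
  \sum_(u <- e) q (Riem prk prp q e u X Y) u.

(* By homogeneity the pointwise norm |Rm| is constant on G/K, so its supremum
   is this value at the base point. *)
Definition Riem_norm (R : realType) (n : nat) (prk prp : 'End('M[R]_n))
    (q : 'M[R]_n -> 'M[R]_n -> R) (e : seq 'M[R]_n) : R :=
  Num.sqrt (\sum_(u <- e) \sum_(v <- e) \sum_(w <- e) \sum_(z <- e)
    (q (Riem prk prp q e u v w) z) ^+ 2).

Record homog_data (R : realType) (n : nat) := HomogData {
  grpG : set 'M[R]_n;
  grpH : set 'M[R]_n;
  grpK : set 'M[R]_n;
  algg : {vspace 'M[R]_n};
  algk : {vspace 'M[R]_n};
  pp1 : {vspace 'M[R]_n};
  pp2 : {vspace 'M[R]_n};
  formQ : 'M[R]_n -> 'M[R]_n -> R;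
  onb1 : seq 'M[R]_n;
  onb2 : seq 'M[R]_n;
  bQ1 : R;
  bQ2 : R
}.

Section TwoSummands.
Variables (R : realType) (n : nat) (S : homog_data R n).

Definition pp : {vspace 'M[R]_n} := (pp1 S + pp2 S)%VS.
Definition proj_k : 'End('M[R]_n) := daddv_pi (algk S) pp.
Definition proj_p : 'End('M[R]_n) := daddv_pi pp (algk S).
Definition proj_p1 : 'End('M[R]_n) := daddv_pi (pp1 S) (algk S + pp2 S)%VS.
Definition proj_p2 : 'End('M[R]_n) := daddv_pi (pp2 S) (algk S + pp1 S)%VS.

Record two_summands : Prop := TwoSummands {
  ts_G : compact_lie_group (grpG S);
  ts_H : compact_lie_group (grpH S);
  ts_K : compact_lie_group (grpK S);
  ts_KH : grpK S `<` grpH S;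
  ts_HG : grpH S `<` grpG S;
  ts_connected : connected_quotient (grpG S) (grpK S);
  (* For a disconnected fibre H/K the total space would collapse to a finite
     cover of G/H, as for U(2) < S(O(4) x O(1)) < SO(5). *)
  ts_fibre : connected_quotient (grpH S) (grpK S);
  ts_effective : effective (grpG S) (grpK S);
  ts_algg : lie_algebra_of (grpG S) (algg S);
  ts_algk : lie_algebra_of (grpK S) (algk S);
  ts_algh : lie_algebra_of (grpH S) (algk S + pp1 S)%VS;
  ts_decomp : algg S = (algk S + pp1 S + pp2 S)%VS;
  ts_direct : directv (algk S + pp1 S + pp2 S)%VS;
  ts_irr1 : Ad_irreducible (grpK S) (pp1 S);
  ts_irr2 : Ad_irreducible (grpK S) (pp2 S);
  ts_inequivalent : ~ Ad_equivalent (grpK S) (pp1 S) (pp2 S);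
  ts_Q : scalar_product_on pp (formQ S);
  ts_Q_inv : Ad_invariant_on (grpK S) pp (formQ S);
  ts_Q_orth : forall X Y, X \in pp1 S -> Y \in pp2 S -> formQ S X Y = 0;
  ts_b1 : 0 < bQ1 S;
  ts_b2 : 0 < bQ2 S;
  ts_killing1 : forall X Y, X \in pp1 S -> Y \in pp1 S ->
    - killing (algg S) X Y = bQ1 S * formQ S X Y;
  ts_killing2 : forall X Y, X \in pp2 S -> Y \in pp2 S ->
    - killing (algg S) X Y = bQ2 S * formQ S X Y;
  ts_onb1 : orthonormal_basis (pp1 S) (formQ S) (onb1 S);
  ts_onb2 : orthonormal_basis (pp2 S) (formQ S) (onb2 S)
}.

(* [ijk], as a function of Q-orthonormal bases of p_i, p_j, p_k *)
Definition triple (ei ej ek : seq 'M[R]_n) : R :=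
  \sum_(x <- ei) \sum_(y <- ej) \sum_(z <- ek)
    (formQ S (proj_p (lie x y)) z) ^+ 2.

Definition dim1 : R := (\dim (pp1 S))%:R.
Definition dim2 : R := (\dim (pp2 S))%:R.
Definition t111 : R := triple (onb1 S) (onb1 S) (onb1 S).
Definition t122 : R := triple (onb1 S) (onb2 S) (onb2 S).
Definition t222 : R := triple (onb2 S) (onb2 S) (onb2 S).

Definition hrfA : R := t122 / (2 * dim1).
Definition hrfB : R := t122 / dim2.
Definition hrfC : R := bQ1 S - t111 / (2 * dim1) - t122 / dim1.
Definition hrfD : R := bQ2 S - t222 / (2 * dim2).

(* The metric x1 Q|p1 + x2 Q|p2, pulled back to the Lie algebra of G. *)
Definition metric (x1 x2 : R) (X Y : 'M[R]_n) : R :=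
  x1 * formQ S (proj_p1 X) (proj_p1 Y) + x2 * formQ S (proj_p2 X) (proj_p2 Y).

Definition metric_onb (x1 x2 : R) : seq 'M[R]_n :=
  [seq (Num.sqrt x1)^-1 *: u | u <- onb1 S] ++
  [seq (Num.sqrt x2)^-1 *: u | u <- onb2 S].

Definition Ric (x1 x2 : R) : 'M[R]_n -> 'M[R]_n -> R :=
  Ricci proj_k proj_p (metric x1 x2) (metric_onb x1 x2).

Definition Rm_norm (x1 x2 : R) : R :=
  Riem_norm proj_k proj_p (metric x1 x2) (metric_onb x1 x2).

Definition einstein (x1 x2 : R) : Prop :=
  exists lam : R, forall X Y, X \in pp -> Y \in pp ->
    Ric x1 x2 X Y = lam * metric x1 x2 X Y.

Definition ancient_HRF (T : R) (x1 x2 : R -> R) : Prop :=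
  forall t, t < T ->
    [/\ 0 < x1 t, 0 < x2 t
      & forall X Y, X \in pp -> Y \in pp ->
          is_derive t 1 (fun s => metric (x1 s) (x2 s) X Y)
            (- 2 * Ric (x1 t) (x2 t) X Y)].

Definition type_I (x1 x2 : R -> R) : Prop :=
  exists L : R, `|t| * Rm_norm (x1 t) (x2 t) @[t --> -oo] --> L.

Definition typeI_ancient_from (x1_0 x2_0 T : R) (x1 x2 : R -> R) : Prop :=
  [/\ ancient_HRF T x1 x2, type_I x1 x2, x1 0 = x1_0 & x2 0 = x2_0].

Definition fibre_shrinks (T : R) (x1 x2 : R -> R) : Prop :=
  x1 t @[t --> T^'-] --> 0 /\
  exists2 l : R, 0 < l & x2 t @[t --> T^'-] --> l.

Definition collapses_to_base (T : R) (x1 x2 : R -> R) : Prop :=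
  exists2 q, invariant_metric (grpH S) (algg S) (algk S + pp1 S)%VS q &
    HG_dist (cosets (grpG S) (grpK S)) (cosets (grpG S) (grpH S))
      (coset_dist (grpG S) (metric (x1 t) (x2 t))) (coset_dist (grpG S) q)
      @[t --> T^'-] --> 0%E.

End TwoSummands.

(* Main.v *)
Require Import Defs.
From HB Require Import structures.
From mathcomp Require Import all_boot all_order all_algebra.
From mathcomp Require Import all_classical all_reals all_analysis.
From mathcomp Require Import ring lra.
From mathcomp Require finmap.
Import Order.TTheory GRing.Theory Num.Theory.
Import numFieldNormedType.Exports.
Local Open Scope classical_set_scope.
Local Open Scope ring_scope.
Set Implicit Arguments.
Unset Strict Implicit.
Unset Printing Implicit Defensive.

(** On diagonal metrics with ratio y = x1/x2 the Ricci tensor is block diagonal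
    with blocks (C + A y^2)/2 and (D - B y)/2, so the flow becomes a planar
    system with C = (A + B) y1 y2 and D = (A + B)(y1 + y2).  There
    y' = -(A + B)(y1 - y)(y2 - y)/x2, and x2 is an explicit function of y below
    y1; hence t is an integral in y.  It is finite down to y = 0, where the fibre
    vanishes while x2 > 0, and diverges at y1, which gives the ancient solution.
    As t -> -oo both x_i/|t| have positive limits, so by the scaling
    |t| |Rm|(x1, x2) = |Rm|(x1/|t|, x2/|t|) the solution is of type I.

    For the collapse, compare the distance of x1 Q|p1 + x2 Q|p2 on G/K with that
    of l Q|p2 on G/H, where l = lim x2.  The fibre contributes O(sqrt x1) along
    finitely many near-optimal curves joining the points of a net, and along the
    fibre H/K.  Enough curves exist because short C^1 arcs fill a neighbourhood of
    1 in a closed subgroup, which is the closed subgroup theorem in quantitative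
    form; connectedness then chains finitely many of them. *)

(** * Traces, entrywise calculus and Lie algebras of matrix groups *)

(** The complement [pp S] is only asked to be Ad(K)-stable. Its orthogonality to k for an invariant
    form of g is not among the assumptions, so the symmetry of [ijk] in its indices is not at hand
    and the Ricci blocks cannot be read off from brackets alone. They are extracted from the
    Einstein condition. The traces of the Einstein equation at the two ratios y1 and y2 force [121]
    = 0 and [221] = [122]. Each block of twice the Ricci tensor is then a sum of two unknown
    bilinear forms with coefficients 1 and y, or 1 and y^2, and the equations at y1 and y2 form a
    linear system that determines both. That no 1/y term survives on p2 requires Q|p2 to be
    Ad(H)-invariant, while only Ad(K)-invariance is given. Schur's lemma closes this gap: p2 is
    irreducible under K, so Q|p2 is proportional to the Frobenius form on g/h, which H preserves.
    The same fact makes a multiple of Q|p2 a metric on G/H, the limit of the collapse. *)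

Section MatrixTrace.
Variables (R : realType) (n : nat).
Local Notation M := 'M[R]_n.
Implicit Types (f g : 'End(M)) (U : {vspace M}).

(** The trace over the whole matrix space, in the basis of matrix units. Traces over subspaces are
    reduced to it, since cyclicity is a mere exchange of sums here. *)
Definition Tr (f : M -> M) : R := \sum_i \sum_j f (delta_mx i j) i j.

Lemma lin_delta_sum (V : lmodType R) (f : {linear M -> V}) (X : M) :
  f X = \sum_i \sum_j X i j *: f (delta_mx i j).
Proof.
rewrite {1}(matrix_sum_delta X) linear_sum; apply: eq_bigr => i _.
by rewrite linear_sum; apply: eq_bigr => j _; rewrite linearZ.
Qed.

Lemma Tr_comp f g : Tr (f \o g) = Tr (g \o f).
Proof.
have E (f' g' : 'End(M)) : Tr (f' \o g') =
    \sum_i \sum_j \sum_k \sum_l g' (delta_mx i j) k l * f' (delta_mx k l) i j.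
  apply: eq_bigr => i _; apply: eq_bigr => j _ /=.
  rewrite lin_delta_sum summxE; apply: eq_bigr => k _.
  by rewrite summxE; apply: eq_bigr => l _; rewrite mxE.
rewrite !E.
under eq_bigr => i _ do rewrite exchange_big /=.
rewrite exchange_big /=; apply: eq_bigr => k _.
under eq_bigr => i _ do rewrite exchange_big /=.
rewrite exchange_big /=; apply: eq_bigr => l _.
apply: eq_bigr => i _; apply: eq_bigr => j _; exact: mulrC.
Qed.

Lemma Tr_rank1 (phi : {scalar M}) (v : M) : Tr (fun X => phi X *: v) = phi v.
Proof.
rewrite /Tr [in RHS](matrix_sum_delta v) linear_sum; apply: eq_bigr => i _.
rewrite linear_sum; apply: eq_bigr => j _.
by rewrite linearZ mxE mulrC.
Qed.

Lemma eq_Tr (f g : M -> M) : f =1 g -> Tr f = Tr g.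
Proof. by move=> e; apply: eq_bigr => i _; apply: eq_bigr => j _; rewrite e. Qed.

Lemma TrD (f g : M -> M) : Tr (fun X => f X + g X) = Tr f + Tr g.
Proof.
rewrite /Tr -big_split; apply: eq_bigr => i _; rewrite -big_split /=.
by apply: eq_bigr => j _; rewrite mxE.
Qed.

Lemma Tr_sum (I : Type) (r : seq I) (f : I -> M -> M) :
  Tr (fun X => \sum_(i <- r) f i X) = \sum_(i <- r) Tr (f i).
Proof.
rewrite /Tr [RHS]exchange_big; apply: eq_bigr => i _ /=.
by rewrite [RHS]exchange_big; apply: eq_bigr => j _; rewrite summxE.
Qed.

Lemma TrN (f : M -> M) : Tr (fun X => - f X) = - Tr f.
Proof.
rewrite /Tr -sumrN; apply: eq_bigr => i _; rewrite -sumrN.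
by apply: eq_bigr => j _; rewrite mxE.
Qed.

(** Expanding [pi X] in the basis of U turns f composed with pi into a sum of rank-one maps, whose
    traces are the diagonal coefficients of f on U. Any projection onto U will do, so it can be
    chosen to suit the argument. *)
Lemma tr_on_Tr U (pi : 'End(M)) f :
    (forall X, pi X \in U) -> (forall X, X \in U -> pi X = X) ->
    (forall X, X \in U -> f X \in U) ->
  tr_on U f = Tr (f \o pi).
Proof.
move=> piU pid fU.
transitivity (Tr (fun X => \sum_(i < \dim U)
    coord (vbasis U) i (pi X) *: f (vbasis U)`_i)); last first.
  apply: eq_Tr => X /=; rewrite [in RHS](coord_vbasis (piU X)) linear_sum.
  by apply: eq_bigr => i _; rewrite linearZ.
rewrite Tr_sum; apply: eq_bigr => i _.
rewrite (Tr_rank1 (coord (vbasis U) i \o pi)%FUN) /= pid //; apply: fU.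
by apply: vbasis_mem; apply: mem_nth; rewrite size_tuple.
Qed.

Lemma Tr_proj_indep U (pi pi' : 'End(M)) f :
    (forall X, pi X \in U) -> (forall X, X \in U -> pi X = X) ->
    (forall X, pi' X \in U) -> (forall X, X \in U -> pi' X = X) ->
    (forall X, X \in U -> f X \in U) ->
  Tr (f \o pi) = Tr (f \o pi').
Proof. by move=> *; rewrite -!(@tr_on_Tr U). Qed.

End MatrixTrace.

(** * The Frobenius product and orthogonal projections *)

Section Frobenius.
Variables (R : realType) (n : nat).
Local Notation M := 'M[R]_n.

Definition frob (X Y : M) : R := \tr (X *m Y^T).

Lemma frobC X Y : frob X Y = frob Y X.
Proof. by rewrite /frob -mxtrace_tr trmx_mul trmxK. Qed.

Lemma frobDl X Y Z : frob (X + Y) Z = frob X Z + frob Y Z.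
Proof. by rewrite /frob mulmxDl mxtraceD. Qed.
Lemma frobZl a X Z : frob (a *: X) Z = a * frob X Z.
Proof. by rewrite /frob -scalemxAl mxtraceZ. Qed.
Lemma frobZr a X Z : frob Z (a *: X) = a * frob Z X.
Proof. by rewrite frobC frobZl (frobC Z). Qed.
Lemma frobNl X Z : frob (- X) Z = - frob X Z.
Proof. by rewrite -scaleN1r frobZl mulN1r. Qed.
Lemma frob0l Z : frob 0 Z = 0.
Proof. by rewrite -(scale0r 0) frobZl mul0r. Qed.
Lemma frob_suml (I : Type) (r : seq I) (f : I -> M) Z :
  frob (\sum_(i <- r) f i) Z = \sum_(i <- r) frob (f i) Z.
Proof. by elim/big_rec2: _ => [|i y x _ <-]; rewrite ?frob0l // frobDl. Qed.
Lemma frob_sumr (I : Type) (r : seq I) (f : I -> M) Z :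
  frob Z (\sum_(i <- r) f i) = \sum_(i <- r) frob Z (f i).
Proof. by rewrite frobC frob_suml; apply: eq_bigr => i _; rewrite frobC. Qed.

Lemma frobE X Y : frob X Y = \sum_i \sum_j X i j * Y i j.
Proof.
rewrite /frob /mxtrace; apply: eq_bigr => i _; rewrite mxE.
by apply: eq_bigr => j _; rewrite mxE.
Qed.

Lemma frob_ge0 X : 0 <= frob X X.
Proof.
by rewrite frobE; apply: sumr_ge0 => i _; apply: sumr_ge0 => j _; rewrite -expr2 sqr_ge0.
Qed.

Lemma frob_eq0 X : frob X X = 0 -> X = 0.
Proof.
rewrite frobE => /eqP; rewrite psumr_eq0; last first.
  by move=> i _; apply: sumr_ge0 => j _; rewrite -expr2 sqr_ge0.
move=> /allP h; apply/matrixP => i j; rewrite mxE.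
have := h i (mem_index_enum _); rewrite /= psumr_eq0 => [/allP/(_ j (mem_index_enum _))/=|].
  by rewrite mulf_eq0 orbb => /eqP.
by move=> k _; rewrite -expr2 sqr_ge0.
Qed.

(** Gram-Schmidt by induction on the list: the new vector loses its components along [e], and is
    dropped if nothing remains. *)
Lemma frob_orthonormal_span (s : seq M) : exists e : seq M,
  span e = span s /\ {in e &, forall u v, frob u v = (u == v)%:R} /\ uniq e.
Proof.
elim: s => [|x s [e [es [eo eu]]]]; first by exists [::].
pose y := x - \sum_(u <- e) frob x u *: u.
have mem_sum : \sum_(u <- e) frob x u *: u \in span e.
  by rewrite big_seq; apply: memv_suml => u ue; rewrite memvZ // memv_span.
have yo : {in e, forall v, frob y v = 0}.
  move=> v ve; rewrite /y -scaleN1r frobDl frobZl frob_suml.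
  rewrite (bigD1_seq v) //= frobZl (eo v v) // eqxx mulr1 big1_seq ?addr0 ?mulN1r ?subrr //.
  by move=> u /andP[uv ue]; rewrite frobZl (eo u v) // (negbTE uv) mulr0.
have span_eq a : a != 0 -> span (a *: y :: e) = span (x :: s).
  move=> a0; rewrite !span_cons es -es.
  apply/eqP; rewrite eqEsubv; apply/andP; split.
    rewrite subv_add addvSr andbT -memvE memvZ // rpredB //.
      by apply: (subvP (addvSl _ _)); rewrite memv_line.
    exact: (subvP (addvSr _ _)).
  rewrite subv_add addvSr andbT -memvE.
  have -> : x = a^-1 *: (a *: y) + \sum_(u <- e) frob x u *: u.
    by rewrite scalerA mulVf // scale1r /y subrK.
  by apply: memv_add => //; rewrite memvZ // memv_line.
have [y0|y0] := eqVneq y 0.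
  exists e; split=> //; rewrite -(span_eq 1) ?oner_eq0 // y0 scaler0 span_cons.
  by apply/esym/addv_idPr; rewrite -memvE mem0v.
have fy : 0 < frob y y.
  rewrite lt_neqAle frob_ge0 andbT eq_sym; apply: contra_neq y0; exact: frob_eq0.
pose a := (Num.sqrt (frob y y))^-1.
have a0 : a != 0 by rewrite invr_eq0 sqrtr_eq0 -ltNge.
have aa : a * (a * frob y y) = 1.
  rewrite mulrA -expr2 exprVn sqr_sqrtr ?mulVf ?gt_eqF //; exact: ltW.
exists (a *: y :: e); split; first exact: span_eq.
have ane v : v \in e -> a *: y != v.
  move=> ve; apply/eqP => e0; have /eqP[] := oner_neq0 R.
  by rewrite -aa -frobZr e0 yo ?mulr0.
split; last by rewrite /= eu andbT; apply/negP => /ane/eqP.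
move=> u v; rewrite !inE => /orP[/eqP->|ue] /orP[/eqP->|ve].
- by rewrite frobZl frobZr aa eqxx.
- by rewrite frobZl yo // mulr0 (negbTE (ane _ ve)).
- by rewrite frobZr frobC yo // mulr0 eq_sym (negbTE (ane _ ue)).
- exact: eo.
Qed.

Definition orth_sum (e : seq M) (X : M) : M := \sum_(u <- e) frob X u *: u.

Lemma orth_sum_is_linear e : linear (orth_sum e).
Proof.
move=> a X Y; rewrite /orth_sum scaler_sumr -big_split; apply: eq_bigr => u _ /=.
by rewrite frobDl frobZl scalerDl scalerA.
Qed.

HB.instance Definition _ e :=
  GRing.isLinear.Build R M M *:%R (orth_sum e) (orth_sum_is_linear e).

(** A self-adjoint projection, which [daddv_pi] does not give. On U it is the identity because the
    difference [p X - X] lies in U and is orthogonal to a spanning family of U, hence to itself. *)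
Lemma orth_proj (U : {vspace M}) : exists pi : 'End(M),
  [/\ forall X, pi X \in U, forall X, X \in U -> pi X = X
    & forall X Y, frob (pi X) Y = frob X (pi Y)].
Proof.
have [e [es [eo eu]]] := frob_orthonormal_span (vbasis U).
set p := orth_sum e; pose pl : {linear M -> M} := p.
have UE : span e = U by rewrite es (span_basis (vbasisP U)).
have pE X : linfun pl X = p X by rewrite lfunE.
have pU X : linfun pl X \in U.
  rewrite pE -UE /p /orth_sum big_seq; apply: memv_suml => u ue.
  by rewrite memvZ // memv_span.
have adj X Y : frob (p X) Y = frob X (p Y).
  rewrite frob_suml frob_sumr; apply: eq_bigr => u _.
  by rewrite frobZl frobZr mulrC (frobC u).
exists (linfun pl); split=> //; last by move=> X Y; rewrite !pE.
move=> X XU; rewrite pE; apply/eqP; rewrite -subr_eq0; apply/eqP.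
have dU : p X - X \in U by rewrite rpredB // -pE.
have dorth u : u \in e -> frob (p X - X) u = 0.
  move=> ue; rewrite -scaleN1r frobDl frobZl frob_suml.
  rewrite (bigD1_seq u) //= frobZl (eo u u) // eqxx mulr1 big1_seq ?addr0 ?mulN1r ?subrr //.
  by move=> v /andP[uv ve]; rewrite frobZl (eo v u) // (negbTE uv) mulr0.
apply: frob_eq0; have dE := @coord_span _ _ _ (in_tuple e) (p X - X); rewrite UE in dE; move/(_ dU) in dE.
rewrite {2}dE frob_sumr big1 // => i _.
by rewrite frobZr dorth ?mulr0 // mem_nth.
Qed.

End Frobenius.

(** * Entrywise derivatives and limits of matrices *)

Section EntrywiseDerivative.
Variables (R : realType).

Definition mderiv (m n : nat) (c : R -> 'M[R]_(m, n)) (s : R) (D : 'M[R]_(m, n)) : Prop :=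
  forall i j, is_derive s 1 (fun u => c u i j) (D i j).

Lemma is_deriveM_eq (f g : R -> R) (s df dg d : R) :
  is_derive s 1 f df -> is_derive s 1 g dg -> d = df * g s + f s * dg ->
  is_derive s 1 (fun u => f u * g u) d.
Proof.
move=> hf hg ->; have := @is_deriveM R _ f g s 1 df dg hf hg.
by rewrite /GRing.scale /= addrC [df * _]mulrC.
Qed.

Lemma is_derive_big (I : Type) (r : seq I) (f : I -> R -> R) (s : R) (d : I -> R) :
  (forall i, is_derive s 1 (f i) (d i)) ->
  is_derive s 1 (fun u => \sum_(i <- r) f i u) (\sum_(i <- r) d i).
Proof.
move=> h; elim: r => [|i r IH].
  under eq_fun do rewrite big_nil; rewrite big_nil; exact: is_derive_cst.
under eq_fun do rewrite big_cons; rewrite big_cons; exact: is_deriveD.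
Qed.

Lemma mderiv_mul (m n p : nat) (a : R -> 'M[R]_(m, n)) (b : R -> 'M[R]_(n, p)) s da db :
  mderiv a s da -> mderiv b s db ->
  mderiv (fun u => a u *m b u) s (da *m b s + a s *m db).
Proof.
move=> ha hb i j; under eq_fun do rewrite mxE.
rewrite !mxE -big_split; apply: is_derive_big => k.
exact: is_deriveM_eq.
Qed.

Lemma mderiv_cst (m n : nat) (a : 'M[R]_(m, n)) s : mderiv (fun=> a) s 0.
Proof. by move=> i j; rewrite mxE; exact: is_derive_cst. Qed.

Lemma mderiv_mull (m n p : nat) (a : 'M[R]_(m, n)) (b : R -> 'M[R]_(n, p)) s db :
  mderiv b s db -> mderiv (fun u => a *m b u) s (a *m db).
Proof.
by move=> hb; have := mderiv_mul (mderiv_cst a s) hb; rewrite mul0mx add0r.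
Qed.

Lemma mderiv_mulr (m n p : nat) (a : R -> 'M[R]_(m, n)) (b : 'M[R]_(n, p)) s da :
  mderiv a s da -> mderiv (fun u => a u *m b) s (da *m b).
Proof.
by move=> ha; have := mderiv_mul ha (mderiv_cst b s); rewrite mulmx0 addr0.
Qed.

Lemma mderiv_tr (m n : nat) (a : R -> 'M[R]_(m, n)) s da :
  mderiv a s da -> mderiv (fun u => (a u)^T) s da^T.
Proof. by move=> ha i j; under eq_fun do rewrite mxE; rewrite mxE. Qed.

Lemma mderiv_unique (m n : nat) (a : R -> 'M[R]_(m, n)) s d1 d2 :
  mderiv a s d1 -> mderiv a s d2 -> d1 = d2.
Proof.
move=> h1 h2; apply/matrixP => i j.
have e1 := @derive_val _ _ _ _ _ _ _ (h1 i j).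
by rewrite -e1 (@derive_val _ _ _ _ _ _ _ (h2 i j)).
Qed.

Lemma is_derive_comp (f g : R -> R) (s df dg : R) :
  is_derive s 1 g dg -> is_derive (g s) 1 f df ->
  is_derive s 1 (fun u => f (g u)) (df * dg).
Proof.
move=> hg hf; have := @is_derive1_comp R f g s df dg hf hg.
by [].
Qed.

Lemma mderiv_comp (m n : nat) (a : R -> 'M[R]_(m, n)) (g : R -> R) (s : R) da (dg : R) :
  is_derive s 1 g dg -> mderiv a (g s) da ->
  mderiv (fun u => a (g u)) s (dg *: da).
Proof.
by move=> hg ha i j; rewrite mxE mulrC; exact: (is_derive_comp hg (ha i j)).
Qed.

Lemma mderiv_lin (m n p q : nat) (f : {linear 'M[R]_(m, n) -> 'M[R]_(p, q)}) a s da :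
  mderiv a s da -> mderiv (fun u => f (a u)) s (f da).
Proof.
move=> ha i j.
have E X : f X i j = \sum_k \sum_l X k l * f (delta_mx k l) i j.
  rewrite {1}(matrix_sum_delta X) linear_sum summxE; apply: eq_bigr => k _.
  by rewrite linear_sum summxE; apply: eq_bigr => l _; rewrite linearZ mxE.
under eq_fun do rewrite E; rewrite E.
apply: is_derive_big => k; apply: is_derive_big => l.
apply: is_deriveM_eq; first exact: ha.
by rewrite mulr0 addr0.
Qed.

End EntrywiseDerivative.

Section EntrywiseConvergence.
Variables (R : realType) (T : Type) (F : set_system T).
Context {FF : Filter F}.

Lemma cvg_sum_seq (I : Type) (r : seq I) (f : I -> T -> R) (l : I -> R) :
  (forall i, f i t @[t --> F] --> l i) ->
  \sum_(i <- r) f i t @[t --> F] --> \sum_(i <- r) l i.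
Proof.
move=> h; elim: r => [|i r IH].
  by under eq_fun do rewrite big_nil; rewrite big_nil; exact: cvg_cst.
by under eq_fun do rewrite big_cons; rewrite big_cons; exact: cvgD.
Qed.

Definition mcvg (m n : nat) (A : T -> 'M[R]_(m, n)) (L : 'M[R]_(m, n)) : Prop :=
  forall i j, A t i j @[t --> F] --> L i j.

Lemma mcvg_cst (m n : nat) (L : 'M[R]_(m, n)) : mcvg (fun=> L) L.
Proof. by move=> i j; exact: cvg_cst. Qed.

Lemma mcvg_lin (m n p q : nat) (f : {linear 'M[R]_(m, n) -> 'M[R]_(p, q)}) A L :
  mcvg A L -> mcvg (fun t => f (A t)) (f L).
Proof.
move=> hA i j.
have E X : f X i j = \sum_k \sum_l X k l * f (delta_mx k l) i j.
  rewrite {1}(matrix_sum_delta X) linear_sum summxE; apply: eq_bigr => k _.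
  by rewrite linear_sum summxE; apply: eq_bigr => l _; rewrite linearZ mxE.
rewrite E; under eq_fun do rewrite E.
apply: cvg_sum_seq => k; apply: cvg_sum_seq => l.
by apply: cvgM; [exact: hA | exact: cvg_cst].
Qed.

Lemma mcvgD (m n : nat) (A B : T -> 'M[R]_(m, n)) (L N : 'M[R]_(m, n)) :
  mcvg A L -> mcvg B N -> mcvg (fun t => A t + B t) (L + N).
Proof.
move=> hA hB i j; under eq_fun do rewrite mxE; rewrite mxE.
by apply: cvgD; [exact: hA | exact: hB].
Qed.

Lemma mcvgZ (m n : nat) (a : T -> R) (B : T -> 'M[R]_(m, n)) (l : R) (N : 'M[R]_(m, n)) :
  a t @[t --> F] --> l -> mcvg B N -> mcvg (fun t => a t *: B t) (l *: N).
Proof.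
move=> ha hB i j; under eq_fun do rewrite mxE; rewrite mxE.
by apply: cvgM; [exact: ha | exact: hB].
Qed.

Lemma mcvgN (m n : nat) (B : T -> 'M[R]_(m, n)) (N : 'M[R]_(m, n)) :
  mcvg B N -> mcvg (fun t => - B t) (- N).
Proof.
move=> hB i j; under eq_fun do rewrite mxE; rewrite mxE.
by apply: cvgN; exact: hB.
Qed.

Lemma mcvg_sum (m n : nat) (I : Type) (r : seq I) (A : I -> T -> 'M[R]_(m, n)) L :
  (forall i, mcvg (A i) (L i)) ->
  mcvg (fun t => \sum_(i <- r) A i t) (\sum_(i <- r) L i).
Proof.
move=> h i j; under eq_fun do rewrite summxE; rewrite summxE.
by apply: cvg_sum_seq => k; exact: h.
Qed.

Lemma mcvg_mul (m n p : nat) (A : T -> 'M[R]_(m, n)) (B : T -> 'M[R]_(n, p)) L N :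
  mcvg A L -> mcvg B N -> mcvg (fun t => A t *m B t) (L *m N).
Proof.
move=> hA hB i j; under eq_fun do rewrite mxE; rewrite mxE.
by apply: cvg_sum_seq => k; apply: cvgM; [exact: hA | exact: hB].
Qed.

End EntrywiseConvergence.
Arguments mcvg_cst {R T} F {FF m n} L.
Arguments mcvg_mul {R T F FF m n p A B L N}.
Arguments mcvgD {R T F FF m n A B L N}.
Arguments mcvgZ {R T F FF m n a B l N}.
Arguments mcvgN {R T F FF m n B N}.
Arguments mcvg_lin {R T F FF m n p q} f {A L}.

(** * Lie algebras of closed subgroups of O(n) *)

Section LieAlgebra.
Variables (R : realType) (n : nat).
Local Notation M := 'M[R]_n.
Implicit Types (G K : set M) (V gg kk : {vspace M}).

Lemma C1_curve_mderiv (c : R -> M) s : C1_curve c -> mderiv c s (velocity c s).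
Proof.
move=> hc i j; rewrite mxE derive1E; apply: derivableP.
by have [] := hc i j.
Qed.

Lemma velocity_unique (c : R -> M) s D : mderiv c s D -> velocity c s = D.
Proof.
by move=> h; apply/matrixP => i j; rewrite mxE derive1E (@derive_val _ _ _ _ _ _ _ (h i j)).
Qed.

Lemma C1_curveP (c dc : R -> M) : (forall s, mderiv c s (dc s)) ->
  (forall s : R, mcvg (nbhs s) dc (dc s)) -> C1_curve c.
Proof.
move=> hd hc i j; split=> [s|]; first by case: (hd s i j).
have -> : derive1 (fun u => c u i j) = fun s => dc s i j.
  by apply/funext => s; rewrite derive1E (@derive_val _ _ _ _ _ _ _ (hd s i j)).
by move=> s; exact: hc.
Qed.

Lemma velocity_continuous (c : R -> M) : C1_curve c ->
  forall i j, continuous (fun s => velocity c s i j).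
Proof.
move=> hc i j; have [_] := hc i j.
suff -> : (fun s => velocity c s i j) = derive1 (fun u => c u i j) by [].
by apply/funext => s; rewrite mxE.
Qed.

Lemma C1_curve_continuous (c : R -> M) : C1_curve c ->
  forall i j, continuous (fun s => c s i j).
Proof.
move=> hc i j s; have [h _] := hc i j.
by apply: differentiable_continuous; apply/derivable1_diffP; exact: h.
Qed.

Lemma group_invmx G a : compact_lie_group G -> G a -> invmx a = a^T.
Proof.
case=> _ _ _ _ orth Ga; have e := orth _ Ga; have [u _] := mulmx1_unit e.
by rewrite -[RHS]mul1mx -(mulVmx u) -mulmxA e mulmx1.
Qed.

Lemma group_trK G a : compact_lie_group G -> G a -> a^T *m a = 1%:M.
Proof. by case=> _ _ _ _ orth Ga; apply: mulmx1C; exact: orth. Qed.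

Lemma group_trV G a : compact_lie_group G -> G a -> G a^T.
Proof. by move=> hG Ga; rewrite -(group_invmx hG Ga); case: hG => _ _ _ h _; exact: h. Qed.

Lemma AdE G a X : compact_lie_group G -> G a -> Ad a X = a *m X *m a^T.
Proof. by move=> hG Ga; rewrite /Ad (group_invmx hG Ga). Qed.

Lemma lie_algebra_skew G gg X : compact_lie_group G -> lie_algebra_of G gg ->
  X \in gg -> X^T = - X.
Proof.
move=> hG hg /hg[c [hc Gc c0 cX]].
have h1 := mderiv_mul (C1_curve_mderiv 0 hc) (mderiv_tr (C1_curve_mderiv 0 hc)).
have h2 : mderiv (fun u => c u *m (c u)^T) 0 0.
  have -> : (fun u => c u *m (c u)^T) = fun=> 1%:M.
    by apply/funext => u; case: hG => _ _ _ _; apply; exact: Gc.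
  exact: mderiv_cst.
have := mderiv_unique h1 h2; rewrite cX c0 trmx1 mulmx1 mul1mx => /eqP.
by rewrite addrC addr_eq0 => /eqP.
Qed.

Lemma lie_algebra_Ad G gg a X : compact_lie_group G -> lie_algebra_of G gg ->
  G a -> X \in gg -> Ad a X \in gg.
Proof.
move=> hG hg Ga /hg[c [hc Gc c0 cX]]; rewrite (AdE _ hG Ga); apply/hg.
pose c' s := a *m c s *m a^T.
have h' s : mderiv c' s (a *m velocity c s *m a^T).
  by apply: mderiv_mulr; apply: mderiv_mull; exact: C1_curve_mderiv.
exists c'; split.
- apply: (C1_curveP h') => s.
  have hv : mcvg (nbhs s) (velocity c) (velocity c s).
    by move=> k l; exact: velocity_continuous.
  exact: (mcvg_mul (mcvg_mul (mcvg_cst (nbhs s) a) hv) (mcvg_cst (nbhs s) a^T)).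
- move=> s; have [_ _ mulG _ _] := hG; apply: mulG; last exact: group_trV hG Ga.
  by case: hG => _ _ mulG _ _; apply: mulG.
- by rewrite /c' c0 mulmx1; case: hG => _ _ _ _; apply.
- by rewrite (velocity_unique (h' 0)) cX.
Qed.

(** The bracket is the derivative at 0 of Ad(c(s)) Y along a curve c in K with velocity X. The
    projection onto V fixes this curve, so by linearity it fixes the derivative too. *)
Lemma Ad_stable_lie K kk V X Y : compact_lie_group K -> lie_algebra_of K kk ->
  Ad_stable K V -> X \in kk -> Y \in V -> lie X Y \in V.
Proof.
move=> hK hk hV Xk YV.
have Xs := lie_algebra_skew hK hk Xk.
have [c [hc Kc c0 cX]] := (hk X).1 Xk.
have hd : mderiv (fun s => c s *m Y *m (c s)^T) 0 (lie X Y).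
  have := mderiv_mul (mderiv_mulr Y (C1_curve_mderiv 0 hc))
     (mderiv_tr (C1_curve_mderiv 0 hc)).
  by rewrite cX c0 Xs trmx1 mulmx1 mul1mx mulmxN.
have inV s : c s *m Y *m (c s)^T \in V.
  by rewrite -(AdE _ hK (Kc s)); exact: hV.
have hf := mderiv_lin (projv V) hd.
have E : (fun s => projv V (c s *m Y *m (c s)^T)) = fun s => c s *m Y *m (c s)^T.
  by apply/funext => s; rewrite projv_id.
by rewrite E in hf; rewrite (mderiv_unique hd hf); exact: memv_proj.
Qed.

Lemma lie_closed G gg X Y : compact_lie_group G -> lie_algebra_of G gg ->
  X \in gg -> Y \in gg -> lie X Y \in gg.
Proof.
move=> hG hg; apply: (Ad_stable_lie hG hg) => a Z Ga Zg.
exact: (lie_algebra_Ad hG hg).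
Qed.

Lemma lie_antisym (X Y : M) : lie X Y = - lie Y X.
Proof. by rewrite /lie opprB. Qed.

Lemma lie_is_linear (X : M) : linear (lie X).
Proof.
move=> a Y Z; rewrite /lie mulmxDr mulmxDl -scalemxAr -scalemxAl.
by rewrite scalerBr opprD addrACA.
Qed.
HB.instance Definition _ X := GRing.isLinear.Build R M M *:%R (lie X) (lie_is_linear X).

Lemma lieDr (X Y Z : M) : lie Z (X + Y) = lie Z X + lie Z Y.
Proof. exact: linearD. Qed.
Lemma lieZr a (X Z : M) : lie Z (a *: X) = a *: lie Z X.
Proof. exact: linearZ. Qed.
Lemma lieNr (X Z : M) : lie Z (- X) = - lie Z X.
Proof. exact: linearN. Qed.
Lemma lie_sumr (I : Type) (r : seq I) (f : I -> M) Z :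
  lie Z (\sum_(i <- r) f i) = \sum_(i <- r) lie Z (f i).
Proof. exact: linear_sum. Qed.
Lemma lieDl (X Y Z : M) : lie (X + Y) Z = lie X Z + lie Y Z.
Proof. by rewrite /lie mulmxDl mulmxDr opprD addrACA. Qed.
Lemma lieZl a (X Z : M) : lie (a *: X) Z = a *: lie X Z.
Proof. by rewrite /lie scalerBr scalemxAl scalemxAr. Qed.
Lemma lie0l (X : M) : lie 0 X = 0.
Proof. by rewrite /lie mul0mx mulmx0 subrr. Qed.
Lemma lie_suml (I : Type) (r : seq I) (f : I -> M) Z :
  lie (\sum_(i <- r) f i) Z = \sum_(i <- r) lie (f i) Z.
Proof. by elim/big_rec2: _ => [|i y x _ <-]; rewrite ?lie0l // lieDl. Qed.

Lemma lie_jacobi (X Y Z : M) : lie X (lie Y Z) + lie Y (lie Z X) + lie Z (lie X Y) = 0.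
Proof.
rewrite /lie !mulmxBr !mulmxBl !mulmxA.
rewrite !opprB !addrA.
apply/matrixP => i j; rewrite !mxE; ring.
Qed.

Lemma frob_lie_skew (Z X Y : M) : Z^T = - Z -> frob (lie Z X) Y = - frob X (lie Z Y).
Proof.
move=> hZ; rewrite /frob /lie.
have -> : (Z *m Y - Y *m Z)^T = Z *m Y^T - Y^T *m Z.
  by rewrite raddfB /= !trmx_mul hZ mulmxN mulNmx opprK addrC.
have trB (A B : M) : \tr (A - B) = \tr A - \tr B by exact: raddfB.
rewrite mulmxBl mulmxBr !trB opprB -!mulmxA.
by rewrite (mxtrace_mulC Z) -!mulmxA.
Qed.

Lemma frob_Ad G a X Y : compact_lie_group G -> G a -> frob (Ad a X) (Ad a Y) = frob X Y.
Proof.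
move=> hG Ga; rewrite !(AdE _ hG Ga) /frob !trmx_mul trmxK !mulmxA.
rewrite -[X in _ *m _ *m X *m _]mulmx1.
rewrite mxtrace_mulC !mulmxA (group_trK hG Ga) mul1mx.
rewrite -[_ *m a^T *m a]mulmxA (group_trK hG Ga) !mulmx1.
by [].
Qed.

(** Unimodularity: ad Z is skew for the Frobenius product. Since the trace over [gg] is the same for
    every projection, [pi] is replaced by the orthogonal one, and cyclicity then shows the trace to
    be its own negative. *)
Lemma Tr_lie_proj gg (pi : 'End(M)) Z :
  (forall X, pi X \in gg) -> (forall X, X \in gg -> pi X = X) ->
  Z^T = - Z -> (forall X, X \in gg -> lie Z X \in gg) ->
  Tr (lie Z \o pi) = 0.
Proof.
move=> pi1 pi2 hZ hg.
have [po [po1 po2 po3]] := orth_proj gg.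
pose f := linfun (lie Z).
have fE X : f X = lie Z X by rewrite lfunE.
have fg X : X \in gg -> f X \in gg by rewrite fE; exact: hg.
have -> : Tr (lie Z \o pi) = Tr (f \o pi) by apply: eq_Tr => X /=; rewrite fE.
rewrite (Tr_proj_indep pi1 pi2 po1 po2 fg).
have TrE (h : M -> M) : Tr h = \sum_i \sum_j frob (h (delta_mx i j)) (delta_mx i j).
  apply: eq_bigr => i _; apply: eq_bigr => j _; rewrite frobE.
  rewrite (bigD1 i) //= (bigD1 j) //= mxE !eqxx mulr1 !big1 ?addr0 //.
    by move=> k ki; rewrite big1 // => l _; rewrite mxE (negbTE ki) mulr0.
  by move=> k ki; rewrite mxE (negbTE ki) andbF mulr0.
have E : Tr (f \o po) = - Tr (po \o f).
  rewrite -TrN !TrE; apply: eq_bigr => i _; apply: eq_bigr => j _ /=.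
  by rewrite !fE frob_lie_skew // frobNl po3 (frobC (po _)).
apply/eqP; rewrite -[_ == 0]orFb; have := E; rewrite Tr_comp => /eqP.
by rewrite -addr_eq0 -mulr2n mulrn_eq0.
Qed.

End LieAlgebra.

(** * The norm of matrices and compactness *)

Section MatrixNorm.
Variables (R : realType).

Lemma mx_norm_leP (m n : nat) (X : 'M[R]_(m, n)) (r : R) : 0 <= r ->
  `|X| <= r <-> forall i j, `|X i j| <= r.
Proof.
move=> r0; rewrite [`|X|]/Num.norm /= mx_normrE; split=> [/bigmax_leP[_ h] i j|h].
  exact: (h (i, j)).
by apply/bigmax_leP; split=> // -[i j] _ /=.
Qed.

Lemma mx_entry_le (m n : nat) (X : 'M[R]_(m, n)) i j : `|X i j| <= `|X|.
Proof. by apply: (mx_norm_leP X (normr_ge0 X)).1. Qed.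

(** The norm is the largest absolute entry, which is not submultiplicative: this is the source of
    the factors n in all later estimates. *)
Lemma mulmx_norm_le (m n p : nat) (A : 'M[R]_(m, n)) (B : 'M[R]_(n, p)) :
  `|A *m B| <= n%:R * `|A| * `|B|.
Proof.
apply/mx_norm_leP => [|i j]; first by rewrite !mulr_ge0.
rewrite mxE; apply: (le_trans (ler_norm_sum _ _ _)).
apply: (@le_trans _ _ (\sum_(k < n) `|A| * `|B|)).
  by apply: ler_sum => k _; rewrite normrM ler_pM // mx_entry_le.
by rewrite sumr_const card_ord -mulrA mulr_natl.
Qed.

Lemma mxtr_norm (m n : nat) (X : 'M[R]_(m, n)) : `|X^T| = `|X|.
Proof.
apply/le_anti/andP; split; apply/mx_norm_leP => // i j; last first.
  by rewrite -[X]trmxK mxE trmxK mx_entry_le.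
by rewrite mxE mx_entry_le.
Qed.

Lemma mcvgP (T : Type) (F : set_system T) {FF : Filter F} (m n : nat)
    (A : T -> 'M[R]_(m, n)) (L : 'M[R]_(m, n)) :
  mcvg F A L <-> A t @[t --> F] --> L.
Proof.
split=> [h|h i j].
  apply/cvgrPdist_le => e e0.
  have : \forall t \near F, forall i, forall j, `|L i j - A t i j| <= e.
    by apply: filter_forall => i; apply: filter_forall => j;
       move/cvgrPdist_le: (h i j); apply.
  apply: filterS => t ht; apply/mx_norm_leP; first exact: ltW.
  by move=> i j; rewrite !mxE.
apply/cvgrPdist_le => e e0; move/cvgrPdist_le: h => /(_ e e0).
apply: filterS => t; apply: le_trans.
by have := mx_entry_le (L - A t) i j; rewrite !mxE.
Qed.

Lemma cvg_mx_entry (m n : nat) (X : 'M[R]_(m, n)) : mcvg (nbhs X) id X.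
Proof. by apply/mcvgP; exact: cvg_id. Qed.

Arguments cvg_mx_entry {m n} X.

Lemma mx_bounded_closed_compact (m n : nat) (A : set 'M[R]_(m, n)) (r : R) :
  (forall X, A X -> `|X| <= r) -> closed A -> compact A.
Proof.
move=> Ar Ac.
have vc : continuous (@vec_mx R m n).
  suff vc (v : 'rV[R]_(m * n)) : mcvg (nbhs v) (@vec_mx R m n) (vec_mx v).
    by move=> v; exact: (mcvgP _ _).1 (vc v).
  move=> i j.
  have := cvg_mx_entry v 0 (mxvec_index i j).
  rewrite -[in X in _ -> X]mxvecE vec_mxK => h.
  suff -> : (fun t : 'rV[R]_(m * n) => vec_mx t i j) = fun t => t 0 (mxvec_index i j) by [].
  by apply/funext => t; rewrite -mxvecE vec_mxK.
have -> : A = @vec_mx R m n @` (@vec_mx R m n @^-1` A).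
  apply/seteqP; split=> [X AX|_ [v Av <-]//].
  by exists (mxvec X); rewrite /= ?mxvecK.
apply: continuous_compact; first exact: continuous_subspaceT.
apply: bounded_closed_compact; last exact: (closed_comp (fun x _ => vc x)).
exists r; split; first exact: num_real.
move=> x rx v /= Av; apply: (le_trans _ (ltW rx)).
have := Ar _ Av; rewrite -{2}[v]vec_mxK => /[dup] hr.
move/(mx_norm_leP _ (le_trans (normr_ge0 _) hr)) => h.
apply/mx_norm_leP; first exact: (le_trans (normr_ge0 _) hr).
by move=> i k; rewrite ord1; case/mxvec_indexP: k => i' j'; rewrite mxvecE.
Unshelve. all: by end_near. Qed.

End MatrixNorm.
Arguments cvg_mx_entry {R m n} X.

(** * Symmetric forms *)

Section SymmetricForms.
Variables (R : realType) (n : nat).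
Local Notation M := 'M[R]_n.

(** Bilinearity is required on all matrices, not on a subspace: composing Q with the projections
    onto p1 and p2 gives such total forms, so computations need no membership conditions. *)
Definition symform (b : M -> M -> R) : Prop :=
  (forall a X Y Z, b (a *: X + Y) Z = a * b X Z + b Y Z) /\
  (forall X Y, b X Y = b Y X).

Variables (b : M -> M -> R).
Hypothesis hb : symform b.

Lemma symformC X Y : b X Y = b Y X. Proof. exact: hb.2. Qed.
Lemma symformDl X Y Z : b (X + Y) Z = b X Z + b Y Z.
Proof. by rewrite -{1}[X]scale1r hb.1 mul1r. Qed.
Lemma symform0l Z : b 0 Z = 0.
Proof. by have := hb.1 (-1) 0 0 Z; rewrite scaler0 addr0 mulN1r addNr. Qed.
Lemma symformZl a X Z : b (a *: X) Z = a * b X Z.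
Proof. by rewrite -[a *: X]addr0 hb.1 symform0l addr0. Qed.
Lemma symformNl X Z : b (- X) Z = - b X Z.
Proof. by rewrite -scaleN1r symformZl mulN1r. Qed.
Lemma symformDr X Y Z : b Z (X + Y) = b Z X + b Z Y.
Proof. by rewrite symformC symformDl !(symformC Z). Qed.
Lemma symform0r Z : b Z 0 = 0.
Proof. by rewrite symformC symform0l. Qed.
Lemma symformZr a X Z : b Z (a *: X) = a * b Z X.
Proof. by rewrite symformC symformZl (symformC Z). Qed.
Lemma symform_suml (I : Type) (r : seq I) (f : I -> M) Z :
  b (\sum_(i <- r) f i) Z = \sum_(i <- r) b (f i) Z.
Proof. by elim/big_rec2: _ => [|i y x _ <-]; rewrite ?symform0l // symformDl. Qed.
Lemma symform_sumr (I : Type) (r : seq I) (f : I -> M) Z :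
  b Z (\sum_(i <- r) f i) = \sum_(i <- r) b Z (f i).
Proof. by rewrite symformC symform_suml; apply: eq_bigr => i _; rewrite symformC. Qed.

Lemma symformE X Y : b X Y =
  \sum_i \sum_j \sum_k \sum_l X i j * Y k l * b (delta_mx i j) (delta_mx k l).
Proof.
rewrite {1}(matrix_sum_delta X) symform_suml; apply: eq_bigr => i _.
rewrite symform_suml; apply: eq_bigr => j _.
rewrite {1}(matrix_sum_delta Y) symform_sumr; apply: eq_bigr => k _.
rewrite symform_sumr; apply: eq_bigr => l _.
by rewrite symformZl symformZr mulrA.
Qed.

Lemma symform_cvg (T : Type) (F : set_system T) {FF : Filter F} (A B : T -> M) L N :
  mcvg F A L -> mcvg F B N -> b (A t) (B t) @[t --> F] --> b L N.
Proof.
move=> hA hB; rewrite symformE; under eq_fun do rewrite symformE.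
do 4! apply: cvg_sum_seq => ?.
by apply: cvgM; [apply: cvgM; [exact: hA | exact: hB] | exact: cvg_cst].
Qed.

Lemma symform_diag_cvg (X : M) : b t t @[t --> X] --> b X X.
Proof. have h := cvg_mx_entry X; exact: (symform_cvg h h). Qed.

Lemma symform_is_derive (A B : R -> M) s dA dB : mderiv A s dA -> mderiv B s dB ->
  is_derive s 1 (fun t => b (A t) (B t)) (b dA (B s) + b (A s) dB).
Proof.
move=> hA hB; under eq_fun do rewrite symformE.
rewrite !symformE -big_split; apply: is_derive_big => i.
rewrite -big_split; apply: is_derive_big => j.
rewrite -big_split; apply: is_derive_big => k.
rewrite -big_split; apply: is_derive_big => l /=.
apply: is_deriveM_eq; first by apply: is_deriveM_eq; [exact: hA|exact: hB|reflexivity].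
by rewrite mulr0 addr0 mulrDl.
Qed.

Lemma symform_bound : exists2 c : R, 0 <= c & forall X, b X X <= c * `|X| ^+ 2.
Proof.
pose c := \sum_(i < n) \sum_(j < n) \sum_(k < n) \sum_(l < n)
   `|b (delta_mx i j) (delta_mx k l)|.
exists c; first by do 4! apply: sumr_ge0 => ? _.
move=> X; rewrite symformE /c; do 4! (rewrite mulr_suml; apply: ler_sum => ? _).
apply: (le_trans (ler_norm _)); rewrite !normrM mulrC ler_wpM2l //.
by rewrite expr2 ler_pM // mx_entry_le.
Qed.

(** If b(X, X) = 0, then b(tX + Y, tX + Y) is affine in t with slope 2 b(X, Y). Unless the slope
    vanishes, the chosen t gives the value -1. *)
Lemma symform_semidef_ker (V : {vspace M}) X : (forall Y, Y \in V -> 0 <= b Y Y) ->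
  X \in V -> b X X = 0 -> forall Y, Y \in V -> b X Y = 0.
Proof.
move=> pos XV X0 Y YV; apply/eqP; apply: contraT => xy.
pose t := - (b Y Y + 1) / (2 * b X Y).
have := pos (t *: X + Y) (memvD (memvZ _ XV) YV).
rewrite symformDl !symformDr !symformZl !symformZr X0 (symformC Y X) !mulr0 add0r.
have -> : t * b X Y + (t * b X Y + b Y Y) = -1 by rewrite /t; field.
by rewrite ler0N1.
Qed.

End SymmetricForms.
Arguments symform_diag_cvg {R n b} hb X.
Arguments symform_cvg {R n b} hb {T F FF A B L N}.

(** * Schur's lemma for invariant forms *)

Section Schur.
Variables (R : realType) (n : nat).
Local Notation M := 'M[R]_n.

Lemma frob_symform : symform (@frob R n).
Proof.
by split=> [a X Y Z|X Y]; [rewrite frobDl frobZl | exact: frobC].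
Qed.

Lemma unit_sphere_compact (V : {vspace M}) :
  compact [set X : M | X \in V /\ frob X X = 1].
Proof.
apply: (@mx_bounded_closed_compact _ _ _ _ 1) => [X [_ X1]|].
  apply/mx_norm_leP => // i j; rewrite -[leRHS]sqrtr1 -X1 -sqrtr_sqr ler_sqrt ?frob_ge0 //.
  rewrite frobE (bigD1 i) //= (bigD1 j) //= -expr2 -addrA lerDl.
  rewrite addr_ge0 //; apply: sumr_ge0 => k _; first by rewrite -expr2 sqr_ge0.
  by apply: sumr_ge0 => l _; rewrite -expr2 sqr_ge0.
have proj_cvg (X : M) : projv V t - t @[t --> X] --> projv V X - X.
  have h := cvg_mx_entry X.
  have h1 : mcvg (nbhs X) (fun t => projv V t - t) (projv V X - X).
    by apply: mcvgD; [exact: (mcvg_lin (projv V) h) | exact: (mcvgN h)].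
  exact: (mcvgP _ _).1 h1.
have -> : [set X : M | X \in V /\ frob X X = 1] =
    (fun X : M => projv V X - X) @^-1` [set 0] `&` (fun X : M => frob X X) @^-1` [set 1].
  apply/seteqP; split=> X /= [h1 h2]; split=> //; first by rewrite projv_id // subrr.
  by move/eqP: h1; rewrite subr_eq0 => /eqP <-; exact: memv_proj.
apply: closedI; apply: closed_comp => [X _|].
- exact: proj_cvg.
- apply: accessible_closed_set1; apply: hausdorff_accessible; exact: norm_hausdorff.
- exact: (symform_diag_cvg frob_symform X).
- apply: accessible_closed_set1; apply: hausdorff_accessible; exact: norm_hausdorff.
Qed.

(* The minimum c of b/f on the unit sphere makes b - c f semidefinite with a
   nonzero kernel, which is an invariant subspace. *)
Lemma schur_forms (K : set M) (V : {vspace M}) (b f : M -> M -> R) :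
  Ad_irreducible K V -> symform b -> symform f ->
  (forall X, X \in V -> X <> 0 -> 0 < f X X) ->
  Ad_invariant_on K V b -> Ad_invariant_on K V f ->
  (forall a, K a -> K (invmx a) /\ a \in unitmx) ->
  exists c, forall X Y, X \in V -> Y \in V -> b X Y = c * f X Y.
Proof.
move=> [V0 Vst Virr] hb hf fpos binv finv Kinv.
pose A := [set X : M | X \in V /\ frob X X = 1].
have A0 : A !=set0.
  have /eqP nz : V <> 0%VS by [].
  have pV := memv_pick V; have p0 : vpick V != 0 by rewrite vpick0.
  have fp : 0 < frob (vpick V) (vpick V).
    rewrite lt_neqAle frob_ge0 andbT eq_sym; apply: contra_neq p0; exact: frob_eq0.
  exists ((Num.sqrt (frob (vpick V) (vpick V)))^-1 *: vpick V); split; first by rewrite memvZ.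
  by rewrite frobZl frobZr mulrA -expr2 exprVn sqr_sqrtr ?mulVf ?gt_eqF // ltW.
have An0 X : A X -> X <> 0.
  by move=> [_ X1] X0; move: X1; rewrite X0 frob0l => /esym/eqP; rewrite oner_eq0.
pose r X := b X X / f X X.
have rc : {within A, continuous r}.
  apply/subspace_continuousP => X AX; apply: cvg_within_filter.
  have fX : f X X != 0 by rewrite gt_eqF // fpos ?(proj1 AX) //; exact: An0.
  have h1 := symform_diag_cvg hb X; have h2 := symform_diag_cvg hf X.
  have h3 := cvgM h1 (cvgV fX h2).
  exact: h3.
have [Xm AXm rmin] := compact_EVT_min A0 (@unit_sphere_compact V) rc.
rewrite inE in AXm; have [XmV Xm1] := AXm.
pose c := r Xm; pose g X Y := b X Y - c * f X Y.
have hg : symform g.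
  split=> [a X Y Z|X Y]; rewrite /g; last by rewrite (symformC hb) (symformC hf).
  by rewrite hb.1 hf.1; ring.
have gpos Y : Y \in V -> 0 <= g Y Y.
  move=> YV; have [->|Y0] := eqVneq Y 0; first by rewrite (symform0l hg).
  have fp : 0 < frob Y Y.
    rewrite lt_neqAle frob_ge0 andbT eq_sym; apply: contra_neq Y0; exact: frob_eq0.
  have ffp : 0 < f Y Y by apply: fpos => //; exact/eqP.
  pose a := (Num.sqrt (frob Y Y))^-1.
  have a0 : a != 0 by rewrite invr_eq0 sqrtr_eq0 -ltNge.
  have AY : A (a *: Y).
    split; first by rewrite memvZ.
    by rewrite frobZl frobZr mulrA -expr2 exprVn sqr_sqrtr ?mulVf ?gt_eqF // ltW.
  have := rmin (a *: Y) (mem_set AY).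
  rewrite {2}/r (symformZl hb) (symformZr hb) (symformZl hf) (symformZr hf) -/c.
  have -> : a * (a * b Y Y) / (a * (a * f Y Y)) = b Y Y / f Y Y.
    by field; rewrite a0 gt_eqF.
  by rewrite ler_pdivlMr // subr_ge0.
have gXm : g Xm Xm = 0.
  rewrite /g /c /r divfK ?subrr // gt_eqF // fpos //; exact: An0.
(* The radical of g on V has to be a vector space before irreducibility applies. It is encoded as a
   kernel: as the basis is free, L X = 0 says that g(X, v) = 0 for every basis vector v. *)
pose L (X : M) : M := \sum_(v <- vbasis V) g X v *: v.
have Lin : linear L.
  move=> a X Y; rewrite /L scaler_sumr -big_split; apply: eq_bigr => v _ /=.
  by rewrite hg.1 scalerDl scalerA.
pose W := (V :&: lker (linfun (HB.pack L (GRing.isLinear.Build R M M *:%R L Lin) : {linear M -> M})))%VS.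
have inW X : X \in W <-> X \in V /\ forall Y, Y \in V -> g X Y = 0.
  rewrite memv_cap memv_ker lfunE /=; split=> [/andP[XV /eqP LX]|[XV h]].
    split=> // Y YV.
    have [_ fr] := andP (vbasisP V).
    have gi (i : 'I_(\dim V)) : g X (vbasis V)`_i = 0.
      have := LX; rewrite /L (big_nth 0) size_tuple big_mkord.
      by move/(freeP (X := vbasis V) fr); apply.
    rewrite (coord_vbasis YV) (symform_sumr hg) big1 // => i _.
    by rewrite (symformZr hg) gi mulr0.
  rewrite XV /=; apply/eqP; rewrite /L big_seq big1 // => v vV.
  by rewrite h ?scale0r // vbasis_mem.
have Wst : Ad_stable K W.
  move=> a X Ka /inW[XV hX]; apply/inW; split; first exact: Vst.
  move=> Y YV; have [Kai au] := Kinv a Ka.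
  have -> : Y = Ad a (Ad (invmx a) Y).
    by rewrite /Ad invmxK !mulmxA mulmxV // mul1mx -mulmxA mulmxV // mulmx1.
  have YV' := Vst _ _ Kai YV.
  by rewrite /g binv // finv // -[LHS]/(g X (Ad (invmx a) Y)) hX.
have [W0|WV] := Virr W (capvSl _ _) Wst.
  have : Xm \in W by apply/inW; split=> //; exact: (symform_semidef_ker hg gpos).
  by rewrite W0 memv0 => /eqP /(An0 _ AXm).
exists c => X Y; rewrite -{1}WV => /inW[_ hX] YV.
by apply/eqP; rewrite -subr_eq0; apply/eqP; exact: hX.
Qed.

End Schur.

(** * Ricci curvature of unimodular reductive spaces *)

Section RicciFormula.
Variables (R : realType) (n : nat).
Local Notation M := 'M[R]_n.
Variables (gg kk pp : {vspace M}) (prk prp : 'End(M)).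
Variables (q : M -> M -> R) (e : seq M).
Hypothesis prk_mem : forall X, prk X \in kk.
Hypothesis prp_mem : forall X, prp X \in pp.
Hypothesis prk_id : forall X, X \in kk -> prk X = X.
Hypothesis prp_id : forall X, X \in pp -> prp X = X.
Hypothesis prk_pp : forall X, X \in pp -> prk X = 0.
Hypothesis pr_sum : forall X, X \in gg -> prk X + prp X = X.
Hypothesis kk_gg : (kk <= gg)%VS.
Hypothesis pp_gg : (pp <= gg)%VS.
Hypothesis lie_gg : forall X Y, X \in gg -> Y \in gg -> lie X Y \in gg.
Hypothesis lie_kp : forall X Y, X \in kk -> Y \in pp -> lie X Y \in pp.
Hypothesis skew_gg : forall X, X \in gg -> X^T = - X.
Hypothesis q_lin : forall a X Y Z, q (a *: X + Y) Z = a * q X Z + q Y Z.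
Hypothesis q_sym : forall X Y, q X Y = q Y X.
Hypothesis e_mem : {in e, forall u, u \in pp}.
Hypothesis e_exp : forall X, X \in pp -> X = \sum_(u <- e) q X u *: u.
Hypothesis q_skew : forall Z X Y, Z \in kk -> X \in pp -> Y \in pp ->
  q (lie Z X) Y = - q X (lie Z Y).

Local Lemma inpg X : X \in pp -> X \in gg. Proof. exact: (subvP pp_gg). Qed.
Local Lemma inkg X : X \in kk -> X \in gg. Proof. exact: (subvP kk_gg). Qed.

Local Lemma qDl X Y Z : q (X + Y) Z = q X Z + q Y Z.
Proof. by rewrite -{1}[X]scale1r q_lin mul1r. Qed.
Local Lemma q0l Z : q 0 Z = 0.
Proof. by have := q_lin (-1) 0 0 Z; rewrite scaler0 addr0 mulN1r addNr. Qed.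
Local Lemma qZl a X Z : q (a *: X) Z = a * q X Z.
Proof. by rewrite -[a *: X]addr0 q_lin q0l addr0. Qed.
Local Lemma qNl X Z : q (- X) Z = - q X Z.
Proof. by rewrite -scaleN1r qZl mulN1r. Qed.
Local Lemma q_suml (I : Type) (r : seq I) (f : I -> M) Z :
  q (\sum_(i <- r) f i) Z = \sum_(i <- r) q (f i) Z.
Proof. by elim/big_rec2: _ => [|i y x _ <-]; rewrite ?q0l // qDl. Qed.
Local Lemma qP X Y : X \in pp -> q X Y = \sum_(u <- e) q X u * q u Y.
Proof.
by move=> Xp; rewrite {1}(e_exp Xp) q_suml; apply: eq_bigr => u _; rewrite qZl.
Qed.

Local Notation cc u v w := (q (prp (lie u v)) w).
Local Notation nab := (nabla prp q e).

Local Lemma cc_anti u v w : cc u v w = - cc v u w.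
Proof. by rewrite lie_antisym linearN qNl. Qed.

Local Lemma nab_mem X Y : nab X Y \in pp.
Proof.
rewrite /nabla; apply: memvD; apply: memvZ; first exact: prp_mem.
by rewrite big_seq; apply: memv_suml => u ue; rewrite memvZ // e_mem.
Qed.

Local Lemma q_nab X Y Z : Z \in pp ->
  q (nab X Y) Z = 2^-1 * (cc X Y Z + cc Z X Y + cc Z Y X).
Proof.
move=> Zp; rewrite /nabla qDl !qZl q_suml -mulrDr -addrA; congr (_ * (_ + _)).
rewrite [in RHS](e_exp Zp) !lie_suml !linear_sum !q_suml -big_split.
apply: eq_bigr => u _ /=.
by rewrite !lieZl !linearZ /= !qZl (q_sym X) (q_sym u) -mulrDr mulrC.
Qed.

Local Lemma nab_metric X Y Z : Y \in pp -> Z \in pp -> q (nab X Y) Z = - q Y (nab X Z).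
Proof.
move=> Yp Zp; rewrite [in RHS]q_sym !q_nab // -mulrN.
congr (_ * _); rewrite (cc_anti X Y) (cc_anti Z Y) (cc_anti X Z); ring.
Qed.


Local Lemma nab_lin a X X' Y : nab (a *: X + X') Y = a *: nab X Y + nab X' Y.
Proof.
rewrite /nabla lieDl lieZl linearD linearZ /=.
have -> : \sum_(u <- e) (q (prp (lie u (a *: X + X'))) Y + q (a *: X + X') (prp (lie u Y))) *: u
  = a *: (\sum_(u <- e) (q (prp (lie u X)) Y + q X (prp (lie u Y))) *: u)
    + \sum_(u <- e) (q (prp (lie u X')) Y + q X' (prp (lie u Y))) *: u.
  rewrite scaler_sumr -big_split; apply: eq_bigr => u _ /=.
  rewrite scalerA -scalerDl; congr (_ *: _).
  by rewrite lieDr lieZr linearD linearZ /= !qDl !qZl; ring.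
by rewrite !scalerDr !scalerA (mulrC a) addrACA.
Qed.

Local Lemma nab_suml (r : seq M) (f : M -> R) Y :
  nab (\sum_(u <- r) f u *: u) Y = \sum_(u <- r) f u *: nab u Y.
Proof.
elim: r => [|u r IH]; last by rewrite !big_cons nab_lin IH.
rewrite !big_nil; have := nab_lin 1 0 0 Y.
by rewrite scaler0 addr0 scale1r => /eqP; rewrite eq_sym -subr_eq0 addrK => /eqP.
Qed.

Lemma Tr_prp (f : {linear M -> M}) :
  Tr (f \o prp) = \sum_(u <- e) q (prp (f u)) u.
Proof.
transitivity (Tr (fun X => \sum_(u <- e) q (prp X) u *: f u)).
  apply: eq_Tr => X /=; rewrite {1}(e_exp (prp_mem X)) linear_sum.
  by apply: eq_bigr => u _; rewrite linearZ.
rewrite Tr_sum; apply: eq_bigr => u _.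
have lin : linear_for *%R (fun X => q (prp X) u).
  by move=> a X Y; rewrite linearD linearZ /= qDl qZl.
pose m := GRing.isLinear.Build R M R *%R (fun X => q (prp X) u) lin.
pose phi : {scalar M} := HB.pack (fun X => q (prp X) u) m.
exact: (Tr_rank1 phi).
Qed.

Local Lemma Tr0 : Tr (fun=> 0 : M) = 0.
Proof. by rewrite /Tr big1 // => i _; rewrite big1 // => j _; rewrite mxE. Qed.

(** The trace of ad Z over all of g vanishes, and kk contributes nothing to it, because ad Z maps kk
    into pp. What remains is the trace over pp. *)
Local Lemma ad_unimod Z : Z \in pp -> \sum_(u <- e) cc Z u u = 0.
Proof.
move=> Zp.
have prg X : (prk + prp)%VF X \in gg.
  by rewrite add_lfunE; apply: memvD; [apply: inkg | apply: inpg].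
have pid X : X \in gg -> (prk + prp)%VF X = X.
  by move=> Xg; rewrite add_lfunE pr_sum.
have h := Tr_lie_proj prg pid (skew_gg (inpg Zp)) (fun X => lie_gg (inpg Zp)).
have hp := Tr_prp (lie Z).
have hs : Tr (lie Z \o (prk + prp)%VF) = Tr (lie Z \o prk) + Tr (lie Z \o prp).
  by rewrite -TrD; apply: eq_Tr => X /=; rewrite add_lfunE lieDr.
pose A := linfun (lie Z).
have E : Tr (lie Z \o prk) = Tr ((A \o prk)%VF \o prk).
  by apply: eq_Tr => X /=; rewrite comp_lfunE /= lfunE /= (prk_id (prk_mem X)).
have hk : Tr (lie Z \o prk) = 0.
  rewrite E Tr_comp -Tr0; apply: eq_Tr => X /=.
  by rewrite comp_lfunE /= lfunE /= prk_pp // lie_antisym memvN lie_kp.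
by rewrite -hp -[LHS]add0r -hk -hs h.
Qed.

(** The part of the trace of ad a ad b over pp that passes through kk in between. *)
Let kap a b := \sum_(u <- e) q (lie a (prk (lie b u))) u.

Local Lemma q_prp_lie_lie a b u : a \in pp -> b \in pp -> u \in pp ->
  q (prp (lie a (lie b u))) u =
  \sum_(v <- e) cc b u v * cc a v u + q (lie a (prk (lie b u))) u.
Proof.
move=> ap bp up; have bu : lie b u \in gg by rewrite lie_gg // inpg.
rewrite -{1}(pr_sum bu) lieDr linearD /= qDl addrC.
have -> : prp (lie a (prk (lie b u))) = lie a (prk (lie b u)).
  by rewrite prp_id // lie_antisym memvN lie_kp.
congr (_ + _); rewrite {1}(e_exp (prp_mem (lie b u))) lie_sumr linear_sum q_suml.
by apply: eq_bigr => v _; rewrite lieZr linearZ /= qZl.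
Qed.

(** The trace of ad a ad b over pp splits according to the intermediate component of [b, u]. The
    trace over kk only involves ad b from kk to pp followed by ad a, and cyclicity moves it to pp,
    where it is [kap b a]. *)
Local Lemma killing_split a b : a \in pp -> b \in pp ->
  killing gg a b = \sum_(u <- e) \sum_(v <- e) cc b u v * cc a v u + kap a b + kap b a.
Proof.
move=> ap bp.
have prg X : (prk + prp)%VF X \in gg.
  by rewrite add_lfunE; apply: memvD; [apply: inkg | apply: inpg].
have pid X : X \in gg -> (prk + prp)%VF X = X.
  by move=> Xg; rewrite add_lfunE pr_sum.
pose A := linfun (lie a); pose B := linfun (lie b).
have AE X : A X = lie a X by rewrite lfunE.
have BE X : B X = lie b X by rewrite lfunE.
have -> : killing gg a b = tr_on gg (A \o B)%VF.
  by apply: eq_bigr => i _; rewrite comp_lfunE AE BE.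
rewrite (tr_on_Tr prg pid); last first.
  by move=> X Xg; rewrite comp_lfunE AE BE !lie_gg // inpg.
rewrite (_ : Tr _ = Tr ((A \o B)%VF \o prp) + Tr ((A \o B)%VF \o prk)); last first.
  by rewrite -TrD; apply: eq_Tr => X /=; rewrite add_lfunE linearD addrC.
congr (_ + _).
  rewrite Tr_prp /kap -big_split big_seq [RHS]big_seq; apply: eq_bigr => u ue /=.
  rewrite comp_lfunE AE BE.
  by rewrite q_prp_lie_lie // e_mem.
rewrite (_ : Tr _ = Tr ((A \o prp)%VF \o (B \o prk)%VF)); last first.
  apply: eq_Tr => X /=; rewrite !comp_lfunE.
  have -> // : prp (B (prk X)) = B (prk X).
  by apply: prp_id; rewrite BE lie_antisym memvN lie_kp.
rewrite Tr_comp (_ : Tr _ = Tr ((B \o (prk \o A))%VF \o prp)); last first.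
  by apply: eq_Tr => X /=; rewrite !comp_lfunE.
rewrite Tr_prp /kap !big_seq; apply: eq_bigr => u ue.
have BPA X : (B \o (prk \o A))%VF X = lie b (prk (lie a X)).
  by rewrite !comp_lfunE AE BE.
by rewrite [X in q (prp X)]BPA prp_id // lie_antisym memvN lie_kp.
Qed.


(** The Jacobi identity for a, b, u is traced over pp. The term with [a, b] drops out: its
    kk-component acts skewly and its pp-component is traceless by [ad_unimod]. The double sums of
    structure constants are symmetric in a and b, so the remaining terms must be as well. *)
Local Lemma kap_sym a b : a \in pp -> b \in pp -> kap a b = kap b a.
Proof.
move=> ap bp.
have E x y : x \in pp -> y \in pp -> \sum_(u <- e) q (prp (lie x (lie y u))) u =
    \sum_(u <- e) \sum_(v <- e) cc y u v * cc x v u + kap x y.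
  move=> xp yp; rewrite /kap -big_split big_seq [RHS]big_seq; apply: eq_bigr => u ue /=.
  by rewrite q_prp_lie_lie // e_mem.
have S0 : \sum_(u <- e) q (prp (lie u (lie a b))) u = 0.
  transitivity (- (\sum_(u <- e) cc (prp (lie a b)) u u)); last first.
    by rewrite ad_unimod ?oppr0.
  rewrite -sumrN big_seq [RHS]big_seq; apply: eq_bigr => u ue.
  have ab : lie a b \in gg by rewrite lie_gg // inpg.
  rewrite lie_antisym linearN qNl; congr (- _).
  rewrite -{1}(pr_sum ab) lieDl linearD /= qDl.
  have up := e_mem ue.
  rewrite (prp_id (lie_kp (prk_mem _) up)).
  have := q_skew (prk_mem (lie a b)) up up; rewrite (q_sym u) => /eqP.
  by rewrite -addr_eq0 -mulr2n mulrn_eq0 /= => /eqP ->; rewrite add0r.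
have : \sum_(u <- e) q (prp (lie a (lie b u) + lie b (lie u a) + lie u (lie a b))) u = 0.
  by rewrite big1 // => u _; rewrite lie_jacobi linear0 q0l.
have pE u : q (prp (lie a (lie b u) + lie b (lie u a) + lie u (lie a b))) u =
    q (prp (lie a (lie b u))) u - q (prp (lie b (lie a u))) u
    + q (prp (lie u (lie a b))) u.
  have -> : lie b (lie u a) = - lie b (lie a u) by rewrite (lie_antisym u a) linearN.
  by rewrite (linearD prp) (linearB prp) !qDl qNl.
under eq_bigr => u _ do rewrite pE.
rewrite !big_split /= S0 addr0 sumrN !E //.
rewrite exchange_big /= => /eqP; rewrite subr_eq0 => /eqP.
rewrite (eq_bigr (fun j => \sum_(v <- e) cc a j v * cc b v j)) => [/addrI //|v _].
by apply: eq_bigr => u _; rewrite mulrC.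
Qed.

Local Lemma antisym_sum0 (F : M -> M -> R) :
  (forall u v, u \in e -> v \in e -> F u v = - F v u) ->
  \sum_(u <- e) \sum_(v <- e) F u v = 0.
Proof.
move=> h; apply/eqP; suff : \sum_(u <- e) \sum_(v <- e) F u v =
    - \sum_(u <- e) \sum_(v <- e) F u v.
  by move/eqP; rewrite -addr_eq0 -mulr2n mulrn_eq0.
rewrite {1}exchange_big /= -sumrN big_seq [RHS]big_seq; apply: eq_bigr => u ue.
rewrite -sumrN big_seq [RHS]big_seq; apply: eq_bigr => v ve; exact: h.
Qed.

Local Lemma dsum_split (I : Type) (r : seq I) (F F1 F2 F3 : I -> I -> R) (h k : R) :
  \sum_(u <- r) \sum_(v <- r) (F u v + h * F1 u v + h * F2 u v - k * F3 u v) =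
  \sum_(u <- r) \sum_(v <- r) F u v + h * (\sum_(u <- r) \sum_(v <- r) F1 u v)
  + h * (\sum_(u <- r) \sum_(v <- r) F2 u v)
  - k * (\sum_(u <- r) \sum_(v <- r) F3 u v).
Proof.
rewrite !mulr_sumr -sumrN -!big_split; apply: eq_bigr => u _ /=.
by rewrite !mulr_sumr -sumrN -!big_split.
Qed.

(** The trace of the term nabla_u nabla_X Y vanishes by unimodularity. The isotropy term is
    [kap Y X], which symmetry and the splitting of the Killing form express through that form. All
    else is a polynomial in structure constants. *)
Theorem Ricci_unimodular X Y : X \in pp -> Y \in pp ->
  Ricci prk prp q e X Y = - 2^-1 * killing gg X Y
    - 2^-1 * (\sum_(u <- e) \sum_(v <- e) cc X u v * cc Y u v)
    + 4^-1 * (\sum_(u <- e) \sum_(v <- e) cc u v X * cc u v Y).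
Proof.
move=> Xp Yp.
have T1 : \sum_(u <- e) q (nab u (nab X Y)) u = 0.
  transitivity (- (\sum_(u <- e) cc (nab X Y) u u)); last first.
    by rewrite (ad_unimod (nab_mem X Y)) oppr0.
  rewrite -sumrN big_seq [RHS]big_seq; apply: eq_bigr => u ue.
  have h0 := cc_anti u u (nab X Y).
  rewrite q_nab ?e_mem // (cc_anti (nab X Y)); lra.
have T2 u : u \in e -> q (nab X (nab u Y)) u =
    - \sum_(v <- e) q (nab u Y) v * q (nab X u) v.
  move=> ue; rewrite (nab_metric X (nab_mem u Y) (e_mem ue)) (qP _ (nab_mem u Y)).
  by congr (- _); apply: eq_bigr => v _; rewrite (q_sym v).
have T3 u : u \in e -> q (nab (prp (lie u X)) Y) u =
    \sum_(v <- e) cc u X v * q (nab v Y) u.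
  move=> ue; rewrite {1}(e_exp (prp_mem (lie u X))) nab_suml q_suml.
  by apply: eq_bigr => v _; rewrite qZl.
have T4 : \sum_(u <- e) q (lie (prk (lie u X)) Y) u = kap Y X.
  rewrite /kap; apply: eq_bigr => u _.
  have -> : prk (lie u X) = - prk (lie X u) by rewrite lie_antisym linearN.
  by rewrite lie_antisym lieNr opprK.
have kE : kap Y X = 2^-1 * (killing gg X Y
    - \sum_(u <- e) \sum_(v <- e) cc Y u v * cc X v u).
  by rewrite killing_split // (kap_sym Xp Yp); lra.
have -> : Ricci prk prp q e X Y =
    \sum_(u <- e) \sum_(v <- e)
      (q (nab u Y) v * q (nab X u) v - cc u X v * q (nab v Y) u) - kap Y X.
  transitivity (\sum_(u <- e) (q (nab u (nab X Y)) u + (\sum_(v <- e)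
      (q (nab u Y) v * q (nab X u) v - cc u X v * q (nab v Y) u)
      - q (lie (prk (lie u X)) Y) u))); last first.
    by rewrite big_split /= T1 add0r big_split /= sumrN T4.
  rewrite /Ricci big_seq [RHS]big_seq; apply: eq_bigr => u ue /=.
  have q4 x y z w : q (x - y - z - w) u = q x u - q y u - q z u - q w u.
    by rewrite !qDl !qNl.
  rewrite [q _ u](q4 (nab u (nab X Y)) (nab X (nab u Y))
    (nab (prp (lie u X)) Y) (lie (prk (lie u X)) Y)).
  rewrite (T2 u ue) (T3 u ue) opprK big_split /= sumrN.
  by rewrite !addrA.
rewrite kE; apply/eqP; rewrite -subr_eq0; apply/eqP.
(* The two sides do not agree summand by summand: their difference is a double sum whose term is
   antisymmetric in u and v. *)
transitivity (\sum_(u <- e) \sum_(v <- e)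
  (q (nab u Y) v * q (nab X u) v - cc u X v * q (nab v Y) u
   + 2^-1 * (cc Y u v * cc X v u) + 2^-1 * (cc X u v * cc Y u v)
   - 4^-1 * (cc u v X * cc u v Y))).
  rewrite dsum_split; set S0 := \sum_(u <- e) _; set S1 := \sum_(u <- e) _.
  set S2 := \sum_(u <- e) _; set S3 := \sum_(u <- e) _; set K := killing _ _ _.
  by move: S0 S1 S2 S3 K => S0 S1 S2 S3 K; ring.
apply: antisym_sum0 => u v ue ve.
have up := e_mem ue; have vp := e_mem ve.
rewrite !q_nab // (cc_anti u Y) (cc_anti v Y) (cc_anti u X) (cc_anti v X).
by rewrite (cc_anti v u Y) (cc_anti v u X); field.
Qed.

End RicciFormula.

Section LinearAlgebraFacts.
Variables (R : realType) (n : nat).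
Local Notation M := 'M[R]_n.

Lemma daddv_pi_ker (U V : {vspace M}) v :
  (U :&: V)%VS = 0%VS -> v \in V -> daddv_pi U V v = 0.
Proof.
move=> UV vV; have vs : v \in (U + V)%VS by apply: (subvP (addvSr U V)).
have := daddv_pi_add UV vs; rewrite (@daddv_pi_id _ _ V U) 1?capvC // => /eqP.
by rewrite -subr_eq0 addrK => /eqP.
Qed.

Lemma onb_expand (V : {vspace M}) (q : M -> M -> R) (e : seq M) :
  bilinear_on V q -> orthonormal_basis V q e ->
  forall X, X \in V -> X = \sum_(u <- e) q X u *: u.
Proof.
move=> hq [be on] X XV.
have em i : (i < size e)%N -> e`_i \in V.
  by move=> ie; apply: (basis_mem be); exact: mem_nth.
have q0 Z : Z \in V -> q 0 Z = 0.
  move=> ZV; have [h _] := hq (-1) 0 0 Z (mem0v V) (mem0v V) ZV.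
  by move: h; rewrite scaler0 addr0 mulN1r addNr.
have E := coord_basis (X := in_tuple e) be XV.
rewrite (big_nth 0) big_mkord {1}E; apply: eq_bigr => i _; congr (_ *: _).
have qs (r : seq 'I_(size e)) (c : 'I_(size e) -> R) Z : Z \in V ->
    q (\sum_(j <- r) c j *: e`_j) Z = \sum_(j <- r) c j * q e`_j Z.
  move=> ZV; elim: r => [|j r IH]; first by rewrite !big_nil q0.
  rewrite !big_cons -IH; apply: (proj1 (hq _ _ _ _ _ _ ZV)); first exact: em.
  by apply: memv_suml => k _; rewrite memvZ // em.
rewrite {2}E qs ?em // (bigD1 i) //= on // eqxx mulr1 big1 ?addr0 // => j ji.
by rewrite on // (negbTE (_ : (j : nat) != i)) ?mulr0.
Qed.

(** Infinitesimal form of invariance: b(Ad(c) X, Ad(c) Y) is constant along a curve c in K with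
    velocity Z, and its derivative at 0 is zero. *)
Lemma invariant_skew (K : set M) (kk : {vspace M}) (b : M -> M -> R) X Y Z :
  compact_lie_group K -> lie_algebra_of K kk -> symform b ->
  (forall a, K a -> b (Ad a X) (Ad a Y) = b X Y) -> Z \in kk ->
  b (lie Z X) Y = - b X (lie Z Y).
Proof.
move=> hK hk hb inv Zk; have Zs := lie_algebra_skew hK hk Zk.
have [c [hc Kc c0 cZ]] := (hk Z).1 Zk.
have hd W : mderiv (fun s => c s *m W *m (c s)^T) 0 (lie Z W).
  have := mderiv_mul (mderiv_mulr W (C1_curve_mderiv 0 hc))
     (mderiv_tr (C1_curve_mderiv 0 hc)).
  by rewrite cZ c0 Zs trmx1 mulmx1 mul1mx mulmxN.
have := symform_is_derive hb (hd X) (hd Y).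
have -> : (fun t => b (c t *m X *m (c t)^T) (c t *m Y *m (c t)^T)) = fun=> b X Y.
  by apply/funext => t; rewrite -!(AdE _ hK (Kc t)) inv.
rewrite c0 trmx1 !mulmx1 !mul1mx => h.
have := @derive_val _ _ _ _ _ _ _ h.
have := @derive_val _ _ _ _ _ _ _ (is_derive_cst (b X Y) (0 : R) (1 : R)).
by move=> -> /esym/eqP; rewrite addr_eq0 => /eqP.
Qed.

End LinearAlgebraFacts.

(** * Two isotropy summands *)

Section TwoSummandsFacts.
Variables (R : realType) (n : nat) (S : homog_data R n).
Hypothesis hS : two_summands S.
Local Notation M := 'M[R]_n.
Local Notation g := (algg S).
Local Notation k := (algk S).
Local Notation p1 := (pp1 S).
Local Notation p2 := (pp2 S).
Local Notation Q := (formQ S).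
Local Notation hh := (algk S + pp1 S)%VS.

Lemma disj_hp2 : (hh :&: p2)%VS = 0%VS.
Proof.
by have := ts_direct hS; rewrite directv_addE /= => /and3P[_ _ /eqP].
Qed.

Lemma disj_kp1 : (k :&: p1)%VS = 0%VS.
Proof.
have := ts_direct hS; rewrite directv_addE /= => /and3P[h _ _].
by apply/directv_addP.
Qed.

Lemma decomp_unique A B C : A \in k -> B \in p1 -> C \in p2 ->
  A + B + C = 0 -> [/\ A = 0, B = 0 & C = 0].
Proof.
move=> Ak B1 C2 /eqP; rewrite addr_eq0 => /eqP E.
have C0 : C = 0.
  apply/eqP; rewrite -memv0 -disj_hp2 memv_cap C2 andbT.
  by rewrite -memvN -E memv_add.
move/eqP: E; rewrite C0 oppr0 addr_eq0 => /eqP E.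
have B0 : B = 0.
  by apply/eqP; rewrite -memv0 -disj_kp1 memv_cap B1 andbT -memvN -E.
by rewrite E B0 oppr0.
Qed.

Lemma disj_kpp : (k :&: pp S)%VS = 0%VS.
Proof.
apply/eqP; rewrite -subv0; apply/subvP => X /memv_capP[Xk /memv_addP[B B1 [C C2 E]]].
have [] := @decomp_unique (- X) B C; rewrite ?memvN // ?E ?addrA ?addNr ?add0r //.
  by rewrite -addrA addNr.
by move=> /eqP; rewrite oppr_eq0 memv0.
Qed.

Lemma disj_p1 : (p1 :&: (k + p2))%VS = 0%VS.
Proof.
apply/eqP; rewrite -subv0; apply/subvP => X /memv_capP[X1 /memv_addP[A Ak [C C2 E]]].
have [] := @decomp_unique A (- X) C; rewrite ?memvN //.
  by rewrite E addrAC subrr.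
by move=> _ /eqP; rewrite oppr_eq0 memv0.
Qed.

Lemma disj_p2 : (p2 :&: (k + p1))%VS = 0%VS.
Proof. by rewrite capvC disj_hp2. Qed.

Lemma p1_pp X : X \in p1 -> X \in pp S.
Proof. exact: (subvP (addvSl _ _)). Qed.
Lemma p2_pp X : X \in p2 -> X \in pp S.
Proof. exact: (subvP (addvSr _ _)). Qed.
Lemma gE : g = (k + pp S)%VS.
Proof. by rewrite (ts_decomp hS) addvA. Qed.
Lemma pp_g X : X \in pp S -> X \in g.
Proof. by rewrite gE; exact: (subvP (addvSr _ _)). Qed.
Lemma k_hh X : X \in k -> X \in hh.
Proof. exact: (subvP (addvSl _ _)). Qed.
Lemma p1_hh X : X \in p1 -> X \in hh.
Proof. exact: (subvP (addvSr _ _)). Qed.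

Lemma proj_kE X : X \in k -> proj_k S X = X.
Proof. exact: daddv_pi_id disj_kpp. Qed.
Lemma proj_k_pp X : X \in pp S -> proj_k S X = 0.
Proof. exact: daddv_pi_ker disj_kpp. Qed.
Lemma proj_pE X : X \in pp S -> proj_p S X = X.
Proof. by apply: daddv_pi_id; rewrite capvC disj_kpp. Qed.
Lemma proj_kp_sum X : X \in g -> proj_k S X + proj_p S X = X.
Proof. by rewrite gE; exact: daddv_pi_add disj_kpp. Qed.
Lemma proj_p1E X : X \in p1 -> proj_p1 S X = X.
Proof. exact: daddv_pi_id disj_p1. Qed.
Lemma proj_p2E X : X \in p2 -> proj_p2 S X = X.
Proof. exact: daddv_pi_id disj_p2. Qed.
Lemma proj_p1_k X : X \in k -> proj_p1 S X = 0.
Proof. by move=> Xk; apply: (daddv_pi_ker disj_p1); exact: (subvP (addvSl _ _)). Qed.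
Lemma proj_p1_p2 X : X \in p2 -> proj_p1 S X = 0.
Proof. by move=> Xk; apply: (daddv_pi_ker disj_p1); exact: (subvP (addvSr _ _)). Qed.
Lemma proj_p2_hh X : X \in hh -> proj_p2 S X = 0.
Proof. exact: (daddv_pi_ker disj_p2). Qed.
Lemma proj_p2_p1 X : X \in p1 -> proj_p2 S X = 0.
Proof. by move=> X1; apply: proj_p2_hh; exact: p1_hh. Qed.
Lemma proj_p1_mem X : proj_p1 S X \in p1. Proof. exact: memv_pi. Qed.
Lemma proj_p2_mem X : proj_p2 S X \in p2. Proof. exact: memv_pi. Qed.
Lemma proj_p_mem X : proj_p S X \in pp S. Proof. exact: memv_pi. Qed.
Lemma proj_k_mem X : proj_k S X \in k. Proof. exact: memv_pi. Qed.

Lemma proj_pp_split X : X \in pp S -> X = proj_p1 S X + proj_p2 S X.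
Proof.
move=> /memv_addP[B B1 [C C2 ->]].
rewrite !linearD /= proj_p1E // proj_p1_p2 // addr0.
by rewrite (proj_p2_p1 B1) add0r proj_p2E.
Qed.

Lemma proj_p1_p X : X \in g -> proj_p1 S (proj_p S X) = proj_p1 S X.
Proof.
move=> /proj_kp_sum {2}<-; rewrite linearD /= (proj_p1_k (proj_k_mem X)).
by rewrite add0r.
Qed.
Lemma proj_p2_p X : X \in g -> proj_p2 S (proj_p S X) = proj_p2 S X.
Proof.
move=> /proj_kp_sum {2}<-; rewrite linearD /= (proj_p2_hh (k_hh (proj_k_mem X))).
by rewrite add0r.
Qed.
Lemma proj_hh_sub X : X \in g -> X - proj_p2 S X \in hh.
Proof.
move=> Xg; rewrite -{1}(proj_kp_sum Xg) (proj_pp_split (proj_p_mem X)).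
rewrite proj_p2_p // addrA addrK; apply: memv_add; [exact: proj_k_mem | exact: proj_p1_mem].
Qed.

Definition Q1 (X Y : M) : R := Q (proj_p1 S X) (proj_p1 S Y).
Definition Q2 (X Y : M) : R := Q (proj_p2 S X) (proj_p2 S Y).

Lemma Q1_symform : symform Q1.
Proof.
have [hb hs _] := ts_Q hS; split=> [a X Y Z|X Y]; last first.
  by apply: hs; apply: p1_pp; exact: proj_p1_mem.
rewrite /Q1 linearD linearZ /=.
by apply: (proj1 (hb _ _ _ _ _ _ _)); apply: p1_pp; exact: proj_p1_mem.
Qed.

Lemma Q2_symform : symform Q2.
Proof.
have [hb hs _] := ts_Q hS; split=> [a X Y Z|X Y]; last first.
  by apply: hs; apply: p2_pp; exact: proj_p2_mem.
rewrite /Q2 linearD linearZ /=.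
by apply: (proj1 (hb _ _ _ _ _ _ _)); apply: p2_pp; exact: proj_p2_mem.
Qed.

Lemma metricE x1 x2 X Y : metric S x1 x2 X Y = x1 * Q1 X Y + x2 * Q2 X Y.
Proof. by []. Qed.

Lemma metric_symform x1 x2 : symform (metric S x1 x2).
Proof.
split=> [a X Y Z|X Y]; rewrite !metricE.
  by rewrite Q1_symform.1 Q2_symform.1; ring.
by rewrite (symformC Q1_symform) (symformC Q2_symform).
Qed.

Lemma Q_split X Y : X \in pp S -> Y \in pp S -> Q X Y = Q1 X Y + Q2 X Y.
Proof.
move=> Xp Yp; have [hb hs _] := ts_Q hS.
have h1 Z := p1_pp (proj_p1_mem Z); have h2 Z := p2_pp (proj_p2_mem Z).
rewrite {1}(proj_pp_split Xp) {1}(proj_pp_split Yp) -[proj_p1 S X]scale1r.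
rewrite (proj1 (hb _ _ _ _ _ _ _)) ?memvD // mul1r -[proj_p1 S Y]scale1r.
rewrite (proj2 (hb _ _ _ _ _ _ _)) // (proj2 (hb _ _ _ _ _ _ _)) // !mul1r.
rewrite (ts_Q_orth hS (proj_p1_mem X) (proj_p2_mem Y)).
rewrite (hs _ _ (h2 X) (h1 Y)) (ts_Q_orth hS (proj_p1_mem Y) (proj_p2_mem X)).
by rewrite addr0 add0r.
Qed.

Lemma Q1_ge0 X : 0 <= Q1 X X.
Proof.
have [_ _ pos] := ts_Q hS; rewrite /Q1; have [->|/eqP X0] := eqVneq (proj_p1 S X) 0.
  by have := symform0l Q1_symform 0; rewrite /Q1 linear0 => ->.
by apply: ltW; apply: pos => //; apply: p1_pp; exact: proj_p1_mem.
Qed.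

Lemma Q2_ge0 X : 0 <= Q2 X X.
Proof.
have [_ _ pos] := ts_Q hS; rewrite /Q2; have [->|/eqP X0] := eqVneq (proj_p2 S X) 0.
  by have := symform0l Q2_symform 0; rewrite /Q2 linear0 => ->.
by apply: ltW; apply: pos => //; apply: p2_pp; exact: proj_p2_mem.
Qed.


Lemma Ad_linD a (X Y : M) : Ad a (X + Y) = Ad a X + Ad a Y.
Proof. by rewrite /Ad mulmxDr mulmxDl. Qed.
Lemma Ad_linB a (X Y : M) : Ad a (X - Y) = Ad a X - Ad a Y.
Proof. by rewrite /Ad mulmxBr mulmxBl. Qed.

Lemma Ad_hh a X : grpH S a -> X \in hh -> Ad a X \in hh.
Proof. exact: (lie_algebra_Ad (ts_H hS) (ts_algh hS)). Qed.
Lemma Ad_g a X : grpG S a -> X \in g -> Ad a X \in g.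
Proof. exact: (lie_algebra_Ad (ts_G hS) (ts_algg hS)). Qed.

Lemma grpK_sub_H a : grpK S a -> grpH S a.
Proof. by move: a; have [/(_ _)] := ts_KH hS. Qed.
Lemma grpH_sub_G a : grpH S a -> grpG S a.
Proof. by move: a; have [/(_ _)] := ts_HG hS. Qed.

(** The Frobenius form of the components orthogonal to h. Conjugation by H preserves both h and the
    Frobenius product, hence commutes with the orthogonal projection. This is a reference
    Ad(H)-invariant form on g/h. *)
Lemma frob_quotient_form : exists f : M -> M -> R,
  [/\ symform f, forall a X Y, grpH S a -> f (Ad a X) (Ad a Y) = f X Y,
      forall X, 0 <= f X X, forall X, f X X = 0 -> X \in hh
    & forall X Y, X \in hh -> f X Y = 0].
Proof.
have [po [po1 po2 po3]] := orth_proj hh.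
have sf : symform (fun X Y => frob (X - po X) (Y - po Y)).
  split=> [a X Y Z|X Y]; last exact: frobC.
  rewrite linearD linearZ /= opprD addrACA -scalerBr.
  by rewrite (frobDl (a *: (X - po X))) frobZl.
have po_unique A B : A \in hh -> (forall Z, Z \in hh -> frob B Z = 0) -> po (A + B) = A.
  move=> Ah Bh; rewrite linearD /= po2 // -[RHS]addr0; congr (_ + _).
  by apply: frob_eq0; rewrite po3 Bh.
exists (fun X Y => frob (X - po X) (Y - po Y)); split=> // [a X Y Ha|X|X /frob_eq0|X Y Xh].
- have hH := ts_H hS.
  have E Z : Ad a Z - po (Ad a Z) = Ad a (Z - po Z).
    have -> : po (Ad a Z) = Ad a (po Z); last by rewrite Ad_linB.
    rewrite -{1}[Z](subrKC (po Z)) Ad_linD po_unique //; first exact: Ad_hh.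
    move=> W Wh; have Hi : grpH S a^T by exact: group_trV hH Ha.
    have -> : W = Ad a (Ad a^T W).
      rewrite (AdE _ hH Ha) (AdE _ hH Hi) trmxK !mulmxA.
      have [_ _ _ _ orth] := hH.
      by rewrite orth // mul1mx -mulmxA orth // mulmx1.
    rewrite (frob_Ad _ _ hH Ha) -{1}(po2 _ (Ad_hh Hi Wh)) -po3 linearB /= [po (po Z)]po2 //.
    by rewrite subrr frob0l.
  by rewrite !E (frob_Ad _ _ hH Ha).
- exact: frob_ge0.
- by move/eqP; rewrite subr_eq0 => /eqP ->.
- by rewrite po2 // subrr frob0l.
Qed.

(** Only invariance under K is assumed of Q. On p2 both Q and the form on g/h are K-invariant, so
    Schur's lemma makes them proportional. Both vanish as soon as one argument is in h, so the
    proportionality extends to g and carries over the H-invariance. *)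
Lemma Q2_Ad_invariant a X Y : grpH S a -> X \in g -> Y \in g ->
  Q2 (Ad a X) (Ad a Y) = Q2 X Y.
Proof.
move=> Ha Xg Yg; have [f [sf finv fge f0 fh]] := frob_quotient_form.
have hK := ts_K hS.
have [c hc] : exists c, forall X Y, X \in p2 -> Y \in p2 -> Q2 X Y = c * f X Y.
  apply: (schur_forms (ts_irr2 hS) Q2_symform sf).
  - move=> Z Z2 Z0; rewrite lt_neqAle fge andbT eq_sym; apply/eqP => /f0 Zh; apply: Z0.
    by apply/eqP; rewrite -memv0 -disj_hp2 memv_cap Zh.
  - move=> b U V Kb U2 V2; have [_ st _] := ts_irr2 hS.
    rewrite /Q2 (proj_p2E (st b U Kb U2)) (proj_p2E (st b V Kb V2)) !proj_p2E //.
    by apply: (ts_Q_inv hS) => //; exact: p2_pp.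
  - by move=> b U V Kb U2 V2; apply: finv; exact: grpK_sub_H.
  - move=> b Kb; split; first by case: hK => _ _ _ h _; exact: h.
    by case: hK => _ _ _ _ orth; have [] := mulmx1_unit (orth _ Kb).
have E U V : U \in g -> V \in g -> Q2 U V = c * f U V.
  move=> Ug Vg.
  have fe A B : A \in g -> f A B = f (proj_p2 S A) B.
    move=> Ag; apply/eqP; rewrite -subr_eq0 -(symformNl sf) -(symformDl sf).
    by rewrite fh // proj_hh_sub.
  have -> : Q2 U V = Q2 (proj_p2 S U) (proj_p2 S V).
    by rewrite /Q2 !(proj_p2E (proj_p2_mem _)).
  rewrite hc ?proj_p2_mem // -fe // (symformC sf) -fe // (symformC sf) //.
by rewrite !E ?finv //; apply: Ad_g => //; exact: grpH_sub_G.
Qed.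

Lemma Q2_hh_skew Z X Y : Z \in hh -> X \in g -> Y \in g ->
  Q2 (lie Z X) Y = - Q2 X (lie Z Y).
Proof.
move=> Zh Xg Yg; apply: (invariant_skew (ts_H hS) (ts_algh hS) Q2_symform) => // a Ha.
exact: Q2_Ad_invariant.
Qed.

Lemma lie_k_p1 X Y : X \in k -> Y \in p1 -> lie X Y \in p1.
Proof. by have [_ st _] := ts_irr1 hS; exact: (Ad_stable_lie (ts_K hS) (ts_algk hS) st). Qed.
Lemma lie_k_p2 X Y : X \in k -> Y \in p2 -> lie X Y \in p2.
Proof. by have [_ st _] := ts_irr2 hS; exact: (Ad_stable_lie (ts_K hS) (ts_algk hS) st). Qed.
Lemma lie_g X Y : X \in g -> Y \in g -> lie X Y \in g.
Proof. exact: (lie_closed (ts_G hS) (ts_algg hS)). Qed.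
Lemma lie_hh X Y : X \in hh -> Y \in hh -> lie X Y \in hh.
Proof. exact: (lie_closed (ts_H hS) (ts_algh hS)). Qed.
Lemma lie_k_pp X Y : X \in k -> Y \in pp S -> lie X Y \in pp S.
Proof.
move=> Xk Yp; rewrite (proj_pp_split Yp) lieDr; apply: memvD.
  by apply: p1_pp; apply: lie_k_p1 => //; exact: proj_p1_mem.
by apply: p2_pp; apply: lie_k_p2 => //; exact: proj_p2_mem.
Qed.

Lemma Ad_k_p1 a X : grpK S a -> X \in p1 -> Ad a X \in p1.
Proof. by have [_ st _] := ts_irr1 hS => Ka; exact: st. Qed.
Lemma Ad_k_p2 a X : grpK S a -> X \in p2 -> Ad a X \in p2.
Proof. by have [_ st _] := ts_irr2 hS => Ka; exact: st. Qed.

Lemma Ad_k_proj a X : grpK S a -> X \in g ->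
  proj_p1 S (Ad a X) = Ad a (proj_p1 S X) /\ proj_p2 S (Ad a X) = Ad a (proj_p2 S X).
Proof.
move=> Ka Xg.
have Kk : Ad a (proj_k S X) \in k.
  by apply: (lie_algebra_Ad (ts_K hS) (ts_algk hS)) => //; exact: proj_k_mem.
have K1 := Ad_k_p1 Ka (proj_p1_mem X); have K2 := Ad_k_p2 Ka (proj_p2_mem X).
have E : X = proj_k S X + (proj_p1 S X + proj_p2 S X).
  by rewrite -{1}(proj_kp_sum Xg) {1}(proj_pp_split (proj_p_mem X)) proj_p1_p // proj_p2_p.
rewrite {1 3}E !Ad_linD !linearD /=; split.
  by rewrite (proj_p1_k Kk) (proj_p1E K1) (proj_p1_p2 K2) add0r addr0.
by rewrite (proj_p2_hh (k_hh Kk)) (proj_p2_p1 K1) (proj_p2E K2) !add0r.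
Qed.

Lemma Q1_Ad_invariant a X Y : grpK S a -> X \in g -> Y \in g ->
  Q1 (Ad a X) (Ad a Y) = Q1 X Y.
Proof.
move=> Ka Xg Yg; have [eX _] := Ad_k_proj Ka Xg; have [eY _] := Ad_k_proj Ka Yg.
rewrite /Q1 eX eY; apply: (ts_Q_inv hS) => //; apply: p1_pp; exact: proj_p1_mem.
Qed.

Lemma metric_Ad_invariant x1 x2 a X Y : grpK S a -> X \in g -> Y \in g ->
  metric S x1 x2 (Ad a X) (Ad a Y) = metric S x1 x2 X Y.
Proof.
move=> Ka Xg Yg; rewrite !metricE Q1_Ad_invariant // Q2_Ad_invariant //.
exact: grpK_sub_H.
Qed.

Lemma metric_k_skew x1 x2 Z X Y : Z \in k -> X \in g -> Y \in g ->
  metric S x1 x2 (lie Z X) Y = - metric S x1 x2 X (lie Z Y).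
Proof.
move=> Zk Xg Yg.
apply: (invariant_skew (ts_K hS) (ts_algk hS) (metric_symform x1 x2)) => // a Ka.
exact: metric_Ad_invariant.
Qed.

Local Notation e1 := (onb1 S).
Local Notation e2 := (onb2 S).

Lemma onb1_mem u : u \in e1 -> u \in p1.
Proof. by have [be _] := ts_onb1 hS; exact: (basis_mem be). Qed.
Lemma onb2_mem u : u \in e2 -> u \in p2.
Proof. by have [be _] := ts_onb2 hS; exact: (basis_mem be). Qed.

Lemma onb1_expand X : proj_p1 S X = \sum_(u <- e1) Q1 X u *: u.
Proof.
have [hb _ _] := ts_Q hS.
have hb1 : bilinear_on p1 Q by move=> r U V W U1 V1 W1; apply: hb; exact: p1_pp.
rewrite {1}(onb_expand hb1 (ts_onb1 hS) (proj_p1_mem X)) big_seq [RHS]big_seq.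
by apply: eq_bigr => u ue; rewrite /Q1 (proj_p1E (onb1_mem ue)).
Qed.
Lemma onb2_expand X : proj_p2 S X = \sum_(u <- e2) Q2 X u *: u.
Proof.
have [hb _ _] := ts_Q hS.
have hb2 : bilinear_on p2 Q by move=> r U V W U1 V1 W1; apply: hb; exact: p2_pp.
rewrite {1}(onb_expand hb2 (ts_onb2 hS) (proj_p2_mem X)) big_seq [RHS]big_seq.
by apply: eq_bigr => u ue; rewrite /Q2 (proj_p2E (onb2_mem ue)).
Qed.

Lemma onb1_trace : \sum_(u <- e1) Q1 u u = dim1 S.
Proof.
have [be on] := ts_onb1 hS; have sz : \dim p1 = size e1 := size_basis (X := in_tuple e1) be.
rewrite (big_nth 0) big_mkord (eq_bigr (fun=> 1)); last first.
  move=> i _; rewrite /Q1 !(proj_p1E (onb1_mem (mem_nth _ _))) //.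
  by rewrite on // eqxx.
by rewrite sumr_const card_ord /dim1 sz.
Qed.
Lemma onb2_trace : \sum_(u <- e2) Q2 u u = dim2 S.
Proof.
have [be on] := ts_onb2 hS; have sz : \dim p2 = size e2 := size_basis (X := in_tuple e2) be.
rewrite (big_nth 0) big_mkord (eq_bigr (fun=> 1)); last first.
  move=> i _; rewrite /Q2 !(proj_p2E (onb2_mem (mem_nth _ _))) //.
  by rewrite on // eqxx.
by rewrite sumr_const card_ord /dim2 sz.
Qed.

Lemma dim1_gt0 : 0 < dim1 S.
Proof.
have [nz _ _] := ts_irr1 hS; rewrite /dim1 ltr0n lt0n dimv_eq0; exact/eqP.
Qed.
Lemma dim2_gt0 : 0 < dim2 S.
Proof.
have [nz _ _] := ts_irr2 hS; rewrite /dim2 ltr0n lt0n dimv_eq0; exact/eqP.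
Qed.

Lemma metric_onb_mem x1 x2 : {in metric_onb S x1 x2, forall u, u \in pp S}.
Proof.
move=> u; rewrite mem_cat => /orP[] /mapP[v ve ->]; apply: memvZ.
  by apply: p1_pp; exact: onb1_mem.
by apply: p2_pp; exact: onb2_mem.
Qed.

Lemma metric1 x1 x2 X v : v \in p1 -> metric S x1 x2 X v = x1 * Q1 X v.
Proof.
move=> v1; rewrite metricE [Q2 X v](_ : _ = 0) ?mulr0 ?addr0 //.
by have := symform0r Q2_symform X; rewrite /Q2 linear0 (proj_p2_p1 v1).
Qed.
Lemma metric2 x1 x2 X v : v \in p2 -> metric S x1 x2 X v = x2 * Q2 X v.
Proof.
move=> v1; rewrite metricE [Q1 X v](_ : _ = 0) ?mulr0 ?add0r //.
by have := symform0r Q1_symform X; rewrite /Q1 linear0 (proj_p1_p2 v1).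
Qed.

Lemma metric_onb_expand x1 x2 X : 0 < x1 -> 0 < x2 -> X \in pp S ->
  X = \sum_(u <- metric_onb S x1 x2) metric S x1 x2 X u *: u.
Proof.
move=> x10 x20 Xp; rewrite {1}(proj_pp_split Xp) big_cat !big_map /=.
have sq (x : R) : 0 < x -> (Num.sqrt x)^-1 * (x * (Num.sqrt x)^-1) = 1.
  move=> x0; rewrite mulrCA -expr2 exprVn sqr_sqrtr ?divff ?gt_eqF //; exact: ltW.
congr (_ + _).
  rewrite onb1_expand big_seq [RHS]big_seq; apply: eq_bigr => u /onb1_mem u1.
  rewrite metric1 ?memvZ // (symformZr Q1_symform) scalerA; congr (_ *: _).
  by rewrite -{1}[Q1 X u]mul1r -(sq _ x10); ring.
rewrite onb2_expand big_seq [RHS]big_seq; apply: eq_bigr => u /onb2_mem u1.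
rewrite metric2 ?memvZ // (symformZr Q2_symform) scalerA; congr (_ *: _).
by rewrite -{1}[Q2 X u]mul1r -(sq _ x20); ring.
Qed.

Lemma Ric_unimodular x1 x2 X Y : 0 < x1 -> 0 < x2 -> X \in pp S -> Y \in pp S ->
  let q := metric S x1 x2 in let e := metric_onb S x1 x2 in
  Ric S x1 x2 X Y = - 2^-1 * killing g X Y
    - 2^-1 * (\sum_(u <- e) \sum_(v <- e)
        q (proj_p S (lie X u)) v * q (proj_p S (lie Y u)) v)
    + 4^-1 * (\sum_(u <- e) \sum_(v <- e)
        q (proj_p S (lie u v)) X * q (proj_p S (lie u v)) Y).
Proof.
move=> x10 x20 Xp Yp q e.
apply: (@Ricci_unimodular _ _ g k (pp S)) => //.
- exact: proj_k_mem.
- exact: proj_p_mem.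
- exact: proj_kE.
- exact: proj_pE.
- exact: proj_k_pp.
- exact: proj_kp_sum.
- by rewrite gE addvSl.
- by rewrite gE addvSr.
- exact: lie_g.
- exact: lie_k_pp.
- by move=> Z; exact: (lie_algebra_skew (ts_G hS) (ts_algg hS)).
- exact: (metric_symform x1 x2).1.
- exact: (metric_symform x1 x2).2.
- exact: metric_onb_mem.
- by move=> Z; exact: metric_onb_expand.
- by move=> Z U V Zk Up Vp; apply: metric_k_skew => //; exact: pp_g.
Qed.

End TwoSummandsFacts.

(** * The Ricci tensor of diagonal metrics *)

Section DiagonalRicci.
Variables (R : realType) (n : nat) (S : homog_data R n).
Hypothesis hS : two_summands S.
Local Notation M := 'M[R]_n.
Local Notation g := (algg S).
Local Notation k := (algk S).
Local Notation p1 := (pp1 S).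
Local Notation p2 := (pp2 S).
Local Notation hh := (algk S + pp1 S)%VS.
Local Notation e1 := (onb1 S).
Local Notation e2 := (onb2 S).
Local Notation Qg := (metric S 1 1).

Local Lemma sfQ : symform Qg. Proof. exact: metric_symform. Qed.

Lemma Qg_p1 X v : v \in p1 -> Qg X v = Q1 S X v.
Proof. by move=> v1; rewrite metric1 // mul1r. Qed.
Lemma Qg_p2 X v : v \in p2 -> Qg X v = Q2 S X v.
Proof. by move=> v1; rewrite metric2 // mul1r. Qed.

Lemma metric_Qg1 x1 x2 X v : v \in p1 -> metric S x1 x2 X v = x1 * Qg X v.
Proof. by move=> v1; rewrite metric1 // Qg_p1. Qed.
Lemma metric_Qg2 x1 x2 X v : v \in p2 -> metric S x1 x2 X v = x2 * Qg X v.
Proof. by move=> v1; rewrite metric2 // Qg_p2. Qed.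

Lemma metric_proj_p x1 x2 W X : W \in g ->
  metric S x1 x2 (proj_p S W) X = metric S x1 x2 W X.
Proof. by move=> Wg; rewrite /metric proj_p1_p // proj_p2_p. Qed.

Lemma formQ_proj_p W v : W \in g -> v \in pp S -> formQ S (proj_p S W) v = Qg W v.
Proof.
move=> Wg vp; rewrite (Q_split hS) // ?proj_p_mem //.
by rewrite -(metric_proj_p 1 1 v Wg) metricE !mul1r.
Qed.

(** [adsum] and [brsum] are the two quadratic bracket sums of the Ricci formula, taken in the fixed
    metric Q so that x1 and x2 appear only as scalar factors. No projection to pp is needed, since
    [Qg] ignores k-components. *)
Definition adsum (e e' : seq M) (X Y : M) : R :=
  \sum_(u <- e) \sum_(v <- e') Qg (lie X u) v * Qg (lie Y u) v.
Definition brsum (e e' : seq M) (X Y : M) : R :=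
  \sum_(u <- e) \sum_(v <- e') Qg (lie u v) X * Qg (lie u v) Y.

Let e1p u : u \in e1 -> u \in pp S. Proof. by move=> /(onb1_mem hS) /p1_pp. Qed.
Let e2p u : u \in e2 -> u \in pp S. Proof. by move=> /(onb2_mem hS) /p2_pp. Qed.
Let liepp X Y : X \in pp S -> Y \in pp S -> lie X Y \in g.
Proof. by move=> Xp Yp; apply: (lie_g hS); exact: (pp_g hS). Qed.

Local Lemma ad_block x1 x2 (a b c : R) (e e' : seq M) X Y :
  {in e, forall u, u \in pp S} -> X \in pp S -> Y \in pp S ->
  (forall W v, v \in e' -> metric S x1 x2 W v = c * Qg W v) ->
  \sum_(u <- [seq a *: u | u <- e]) \sum_(v <- [seq b *: v | v <- e'])
    metric S x1 x2 (proj_p S (lie X u)) v * metric S x1 x2 (proj_p S (lie Y u)) v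
  = (a * b * c) ^+ 2 * adsum e e' X Y.
Proof.
move=> ep Xp Yp hc; rewrite /adsum big_map mulr_sumr big_seq [RHS]big_seq.
apply: eq_bigr => u ue; rewrite big_map mulr_sumr big_seq [RHS]big_seq.
apply: eq_bigr => v ve.
have sm := metric_symform hS x1 x2.
have up := memvZ a (ep u ue).
rewrite (metric_proj_p _ _ _ (liepp Xp up)) (metric_proj_p _ _ _ (liepp Yp up)).
by rewrite !lieZr !(symformZl sm) !(symformZr sm) !hc //; ring.
Qed.

Local Lemma br_block x1 x2 (a b c c' : R) (e e' : seq M) X Y :
  {in e, forall u, u \in pp S} -> {in e', forall u, u \in pp S} ->
  (forall W, metric S x1 x2 W X = c * Qg W X) ->
  (forall W, metric S x1 x2 W Y = c' * Qg W Y) ->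
  \sum_(u <- [seq a *: u | u <- e]) \sum_(v <- [seq b *: v | v <- e'])
    metric S x1 x2 (proj_p S (lie u v)) X * metric S x1 x2 (proj_p S (lie u v)) Y
  = (a * b) ^+ 2 * c * c' * brsum e e' X Y.
Proof.
move=> ep ep' hX hY; rewrite /brsum big_map mulr_sumr big_seq [RHS]big_seq.
apply: eq_bigr => u ue; rewrite big_map mulr_sumr big_seq [RHS]big_seq.
apply: eq_bigr => v ve.
have W := liepp (memvZ a (ep u ue)) (memvZ b (ep' v ve)).
rewrite (metric_proj_p _ _ X W) (metric_proj_p _ _ Y W) hX hY.
by rewrite !lieZr !lieZl !(symformZl sfQ); ring.
Qed.

Lemma brsumC e e' X Y : brsum e e' X Y = brsum e' e X Y.
Proof.
rewrite /brsum exchange_big; apply: eq_bigr => u _; apply: eq_bigr => v _ /=.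
by rewrite (lie_antisym v u) !(symformNl sfQ) mulrNN.
Qed.

(** The orthonormal frame is Q-orthonormal up to the factors x_i^(-1/2). A block of [adsum] over
    e_i, e_j thus acquires x_j / x_i and a block of [brsum] acquires c c' / (x_i x_j), where c and
    c' are the weights of X and Y. *)
Lemma Ric_sums x1 x2 c c' X Y : 0 < x1 -> 0 < x2 -> X \in pp S -> Y \in pp S ->
  (forall W, metric S x1 x2 W X = c * Qg W X) ->
  (forall W, metric S x1 x2 W Y = c' * Qg W Y) ->
  2 * Ric S x1 x2 X Y = - killing g X Y
    - (adsum e1 e1 X Y + x2 / x1 * adsum e1 e2 X Y
       + x1 / x2 * adsum e2 e1 X Y + adsum e2 e2 X Y)
    + 2^-1 * c * c' * (brsum e1 e1 X Y / x1 ^+ 2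
       + 2 * brsum e1 e2 X Y / (x1 * x2) + brsum e2 e2 X Y / x2 ^+ 2).
Proof.
move=> x10 x20 Xp Yp hX hY.
have sq (x : R) : 0 < x -> (Num.sqrt x)^-1 ^+ 2 = x^-1.
  by move=> x0; rewrite exprVn sqr_sqrtr // ltW.
have m1 W v : v \in e1 -> metric S x1 x2 W v = x1 * Qg W v.
  by move=> /(onb1_mem hS); exact: metric_Qg1.
have m2 W v : v \in e2 -> metric S x1 x2 W v = x2 * Qg W v.
  by move=> /(onb2_mem hS); exact: metric_Qg2.
rewrite (Ric_unimodular hS x10 x20 Xp Yp) /metric_onb.
rewrite !big_cat /=.
under [\sum_(i <- map _ e1) _]eq_bigr => u _ do rewrite big_cat.
under [\sum_(i <- map _ e2) _]eq_bigr => u _ do rewrite big_cat.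
rewrite !big_split /=.
under [X in _ + 4^-1 * (X + _)]eq_bigr => u _ do rewrite big_cat.
under [X in _ + 4^-1 * (_ + X)]eq_bigr => u _ do rewrite big_cat.
rewrite !big_split /=.
rewrite !(ad_block _ _ e1p Xp Yp m1) !(ad_block _ _ e1p Xp Yp m2).
rewrite !(ad_block _ _ e2p Xp Yp m1) !(ad_block _ _ e2p Xp Yp m2).
rewrite !(br_block _ _ e1p e1p hX hY) !(br_block _ _ e1p e2p hX hY).
rewrite !(br_block _ _ e2p e1p hX hY) !(br_block _ _ e2p e2p hX hY).
rewrite (brsumC e2 e1) !exprMn !sq //.
by field; rewrite !gt_eqF.
Qed.

Let Qg0 W v : W \in hh -> v \in p2 -> Qg W v = 0.
Proof.
move=> Wh v2; rewrite Qg_p2 // /Q2 (proj_p2_hh hS Wh).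
by have := symform0l (Q2_symform hS) v; rewrite /Q2 linear0.
Qed.

Lemma adsum12_p1 X Y : X \in p1 -> adsum e1 e2 X Y = 0.
Proof.
move=> X1; rewrite /adsum big_seq big1 // => u ue; rewrite big_seq big1 // => v ve.
rewrite Qg0 ?mul0r //; last exact: (onb2_mem hS).
by apply: (lie_hh hS); apply: p1_hh => //; exact: (onb1_mem hS).
Qed.

Lemma brsum11_p2 X Y : Y \in p2 -> brsum e1 e1 X Y = 0.
Proof.
move=> Y2; rewrite /brsum big_seq big1 // => u ue; rewrite big_seq big1 // => v ve.
rewrite [X in _ * X]Qg0 ?mulr0 //.
by apply: (lie_hh hS); apply: p1_hh => //; exact: (onb1_mem hS).
Qed.

(** For u in p1, ad u is skew for Q on p2, by Ad(H)-invariance. In [Ric_p2] this identity cancels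
    the terms in x2 / x1, so that block stays bounded as the fibre shrinks. *)
Lemma adsum12_brsum X Y : X \in p2 -> Y \in p2 -> adsum e1 e2 X Y = brsum e1 e2 X Y.
Proof.
move=> X2 Y2; rewrite /adsum /brsum big_seq [RHS]big_seq; apply: eq_bigr => u ue.
rewrite big_seq [RHS]big_seq; apply: eq_bigr => v ve.
have u1 := onb1_mem hS ue; have v2 := onb2_mem hS ve.
have E Z : Z \in p2 -> Qg (lie Z u) v = Qg (lie u v) Z.
  move=> Z2; rewrite lie_antisym (symformNl sfQ) !Qg_p2 //.
  rewrite (Q2_hh_skew hS (p1_hh u1)) ?opprK; last 2 first.
  - by apply: (pp_g hS); exact: p2_pp.
  - by apply: (pp_g hS); exact: p2_pp.
  exact: (symformC (Q2_symform hS)).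
by rewrite !E.
Qed.

Local Notation s121 := (\sum_(x <- e1) \sum_(u <- e2) \sum_(v <- e1) Qg (lie x u) v ^+ 2).
Local Notation s221 := (\sum_(u <- e2) \sum_(v <- e2) \sum_(x <- e1) Qg (lie u v) x ^+ 2).

Lemma tripleE e e' e'' : {in e, forall u, u \in pp S} -> {in e', forall u, u \in pp S} ->
  {in e'', forall u, u \in pp S} ->
  triple S e e' e'' = \sum_(x <- e) \sum_(y <- e') \sum_(z <- e'') Qg (lie x y) z ^+ 2.
Proof.
move=> h h' h''; rewrite /triple big_seq [RHS]big_seq; apply: eq_bigr => x xe.
rewrite big_seq [RHS]big_seq; apply: eq_bigr => y ye.
rewrite big_seq [RHS]big_seq; apply: eq_bigr => z ze.
by rewrite (formQ_proj_p (liepp (h x xe) (h' y ye)) (h'' z ze)).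
Qed.

Lemma adsum_trace e e' e'' : \sum_(x <- e) adsum e' e'' x x =
  \sum_(x <- e) \sum_(y <- e') \sum_(z <- e'') Qg (lie x y) z ^+ 2.
Proof. by do 3! apply: eq_bigr => ? _; rewrite -expr2. Qed.

Lemma brsum_trace e e' e'' : \sum_(x <- e) brsum e' e'' x x =
  \sum_(y <- e') \sum_(z <- e'') \sum_(x <- e) Qg (lie y z) x ^+ 2.
Proof.
rewrite /brsum exchange_big; apply: eq_bigr => y _ /=.
rewrite exchange_big; apply: eq_bigr => z _ /=.
by apply: eq_bigr => x _; rewrite -expr2.
Qed.

Lemma killing_trace1 : \sum_(x <- e1) - killing g x x = bQ1 S * dim1 S.
Proof.
rewrite -(onb1_trace hS) mulr_sumr big_seq [RHS]big_seq; apply: eq_bigr => x /(onb1_mem hS) x1.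
by rewrite (ts_killing1 hS) // /Q1 (proj_p1E hS).
Qed.
Lemma killing_trace2 : \sum_(x <- e2) - killing g x x = bQ2 S * dim2 S.
Proof.
rewrite -(onb2_trace hS) mulr_sumr big_seq [RHS]big_seq; apply: eq_bigr => x /(onb2_mem hS) x1.
by rewrite (ts_killing2 hS) // /Q2 (proj_p2E hS).
Qed.

Lemma Ric_p1 x1 x2 X Y : 0 < x1 -> 0 < x2 -> X \in p1 -> Y \in p1 ->
  2 * Ric S x1 x2 X Y = - killing g X Y - adsum e1 e1 X Y - adsum e2 e2 X Y
    + 2^-1 * brsum e1 e1 X Y + x1 / x2 * (brsum e1 e2 X Y - adsum e2 e1 X Y)
    + (x1 / x2) ^+ 2 * (2^-1 * brsum e2 e2 X Y).
Proof.
move=> x10 x20 X1 Y1.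
rewrite (@Ric_sums x1 x2 x1 x1) ?p1_pp // => [|W|W]; try exact: metric_Qg1.
by rewrite adsum12_p1 //; field; rewrite !gt_eqF.
Qed.

Lemma Ric_p2 x1 x2 X Y : 0 < x1 -> 0 < x2 -> X \in p2 -> Y \in p2 ->
  2 * Ric S x1 x2 X Y = - killing g X Y - adsum e1 e1 X Y - adsum e2 e2 X Y
    + 2^-1 * brsum e2 e2 X Y - x1 / x2 * adsum e2 e1 X Y.
Proof.
move=> x10 x20 X1 Y1.
rewrite (@Ric_sums x1 x2 x2 x2) ?p2_pp // => [|W|W]; try exact: metric_Qg2.
by rewrite brsum11_p2 // adsum12_brsum //; field; rewrite !gt_eqF.
Qed.

Lemma Ric_p12 x1 x2 X Y : 0 < x1 -> 0 < x2 -> X \in p1 -> Y \in p2 ->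
  2 * Ric S x1 x2 X Y = - killing g X Y - adsum e1 e1 X Y - adsum e2 e2 X Y
    + brsum e1 e2 X Y + x1 / x2 * (2^-1 * brsum e2 e2 X Y - adsum e2 e1 X Y).
Proof.
move=> x10 x20 X1 Y1.
rewrite (@Ric_sums x1 x2 x1 x2 _ _ x10 x20 (p1_pp X1) (p2_pp Y1)) => [|W|W]; last 2 first.
- exact: metric_Qg1.
- exact: metric_Qg2.
by rewrite brsum11_p2 // adsum12_p1 //; field; rewrite !gt_eqF.
Qed.

Lemma Ric_p21 x1 x2 X Y : 0 < x1 -> 0 < x2 -> X \in p2 -> Y \in p1 ->
  2 * Ric S x1 x2 X Y = - killing g X Y - adsum e1 e1 X Y - adsum e2 e2 X Y
    + brsum e1 e2 X Y + x1 / x2 * (2^-1 * brsum e2 e2 X Y - adsum e2 e1 X Y).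
Proof.
move=> x10 x20 X1 Y1.
have bC e e' : brsum e e' X Y = brsum e e' Y X.
  by rewrite /brsum; do 2! apply: eq_bigr => ? _; rewrite mulrC.
have aC e e' : adsum e e' X Y = adsum e e' Y X.
  by rewrite /adsum; do 2! apply: eq_bigr => ? _; rewrite mulrC.
rewrite (@Ric_sums x1 x2 x2 x1 _ _ x10 x20 (p2_pp X1) (p1_pp Y1)) => [|W|W]; last 2 first.
- exact: metric_Qg2.
- exact: metric_Qg1.
by rewrite (aC e1 e2) adsum12_p1 // (bC e1 e1) brsum11_p2 //; field; rewrite !gt_eqF.
Qed.

(** The coefficient of x1 / x2 in [Ric_p1] disappears under the trace: both of its sums have trace
    [121]. *)
Lemma Ric_trace1 x1 x2 : 0 < x1 -> 0 < x2 ->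
  2 * (\sum_(x <- e1) Ric S x1 x2 x x) =
  dim1 S * hrfC S + (x1 / x2) ^+ 2 * (2^-1 * s221).
Proof.
move=> x10 x20; have d1 := dim1_gt0 hS.
rewrite mulr_sumr big_seq (eq_bigr _ (fun x xe => Ric_p1 x10 x20 (onb1_mem hS xe) (onb1_mem hS xe))).
rewrite -big_seq !big_split /= !sumrN -!mulr_sumr big_split /= !sumrN.
rewrite -[- \sum_(i <- e1) killing _ _ _]sumrN killing_trace1 !adsum_trace !brsum_trace.
rewrite /hrfC /t111 /t122 !tripleE; try exact: e1p; try exact: e2p.
by field; rewrite !gt_eqF.
Qed.

Lemma Ric_trace2 x1 x2 : 0 < x1 -> 0 < x2 ->
  2 * (\sum_(x <- e2) Ric S x1 x2 x x) =
  dim2 S * hrfD S - s121 - x1 / x2 * s221.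
Proof.
move=> x10 x20; have d2 := dim2_gt0 hS.
rewrite mulr_sumr big_seq (eq_bigr _ (fun x xe => Ric_p2 x10 x20 (onb2_mem hS xe) (onb2_mem hS xe))).
rewrite -big_seq !big_split /= !sumrN -!mulr_sumr.
rewrite -[- \sum_(i <- e2) killing _ _ _]sumrN killing_trace2 !adsum_trace !brsum_trace.
rewrite /hrfD /t222 !tripleE; try exact: e2p.
have -> : \sum_(x <- e2) \sum_(y <- e1) \sum_(z <- e1) Qg (lie x y) z ^+ 2 = s121.
  rewrite exchange_big; do 3! apply: eq_bigr => ? _ /=.
  by rewrite lie_antisym (symformNl sfQ) sqrrN.
by field; rewrite !gt_eqF.
Qed.


(** * The Ricci tensor determined by two Einstein ratios *)

Section EinsteinPoints.
Variables (y1 y2 : R).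
Hypothesis hy1 : 0 < y1.
Hypothesis hy12 : y1 < y2.
Hypothesis hroots : forall y : R,
  hrfC S - hrfD S * y + (hrfA S + hrfB S) * y ^+ 2 = 0 <-> y = y1 \/ y = y2.
Hypothesis heinstein : forall x1 x2 : R, 0 < x1 -> 0 < x2 ->
  (einstein S x1 x2 <-> x1 / x2 = y1 \/ x1 / x2 = y2).

(** The Einstein constant of the metric with x1 = y, x2 = 1 is computed twice, by tracing over p1
    and over p2. Here [lam] is twice the constant in [einstein], as it belongs to twice the Ricci
    tensor. *)
Local Lemma einstein_traces y : y = y1 \/ y = y2 -> exists lam : R,
  [/\ forall X Y, X \in pp S -> Y \in pp S -> 2 * Ric S y 1 X Y = lam * metric S y 1 X Y,
      lam * y = hrfC S + y ^+ 2 * (s221 / (2 * dim1 S))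
    & lam = hrfD S - s121 / dim2 S - y * (s221 / dim2 S)].
Proof.
move=> yE; have y0 : 0 < y by case: yE => ->; [|exact: lt_trans hy12].
have [lam hlam] : einstein S y 1 by apply/heinstein; rewrite ?ltr01 // divr1.
have d1 := dim1_gt0 hS; have d2 := dim2_gt0 hS.
have t1 := Ric_trace1 y0 ltr01; have t2 := Ric_trace2 y0 ltr01.
have tr1 : \sum_(x <- e1) Ric S y 1 x x = lam * y * dim1 S.
  rewrite -(onb1_trace hS) mulr_sumr big_seq [RHS]big_seq; apply: eq_bigr => x xe.
  have x1 := onb1_mem hS xe.
  by rewrite hlam ?p1_pp // metric1 // mulrA.
have tr2 : \sum_(x <- e2) Ric S y 1 x x = lam * dim2 S.
  rewrite -(onb2_trace hS) mulr_sumr big_seq [RHS]big_seq; apply: eq_bigr => x xe.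
  have x2 := onb2_mem hS xe.
  by rewrite hlam ?p2_pp // metric2 // mul1r.
rewrite tr1 divr1 in t1; rewrite tr2 divr1 in t2.
exists (2 * lam); split.
- by move=> X Y Xp Yp; rewrite hlam // mulrA.
- apply: (mulIf (x := dim1 S)); first by rewrite gt_eqF.
  rewrite (_ : 2 * lam * y * dim1 S = 2 * (lam * y * dim1 S)); last by ring.
  by rewrite t1; field; rewrite gt_eqF.
- apply: (mulIf (x := dim2 S)); first by rewrite gt_eqF.
  rewrite (_ : 2 * lam * dim2 S = 2 * (lam * dim2 S)); last by ring.
  by rewrite t2; field; rewrite gt_eqF.
Qed.

(* The traces of the Einstein equation are a quadratic in y whose coefficients
   involve [121] and [221]; having the roots y1 and y2, it is the given one. *)
Local Lemma s_values : s121 = 0 /\ s221 = t122 S.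
Proof.
have d1 := dim1_gt0 hS; have d2 := dim2_gt0 hS.
have [l1 [_ a1 b1]] := einstein_traces (or_introl (erefl y1)).
have [l2 [_ a2 b2]] := einstein_traces (or_intror (erefl y2)).
have r1 := (hroots y1).2 (or_introl (erefl y1)).
have r2 := (hroots y2).2 (or_intror (erefl y2)).
have y20 : 0 < y2 := lt_trans hy1 hy12.
move: a1 b1 a2 b2; set a := s121; set b := s221 => a1 b1 a2 b2.
(* Subtracting the given quadratic from the trace equation leaves y times an affine function of y
   with constant term [121] / d2 and slope a positive multiple of [221] - [122]. Two distinct zeros
   make both coefficients vanish. *)
have E (y : R) : 0 < y -> (hrfD S - a / dim2 S - y * (b / dim2 S)) * y =
    hrfC S + y ^+ 2 * (b / (2 * dim1 S)) ->
    hrfC S - hrfD S * y + (hrfA S + hrfB S) * y ^+ 2 = 0 ->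
    y * ((b - t122 S) * (1 / dim2 S + 1 / (2 * dim1 S))) + a / dim2 S = 0.
  move=> y0 h r; apply: (mulfI (x := y)); first by rewrite gt_eqF.
  have {}r : hrfC S = hrfD S * y - (hrfA S + hrfB S) * y ^+ 2 by lra.
  rewrite r in h; rewrite mulr0 -[RHS](subrr ((hrfD S - a / dim2 S - y * (b / dim2 S)) * y)) {1}h.
  by rewrite /hrfA /hrfB; field; rewrite !gt_eqF.
rewrite b1 in a1; rewrite b2 in a2.
have h1 := E _ hy1 a1 r1; have h2 := E _ y20 a2 r2.
set w := (b - t122 S) * _ in h1 h2.
have w0 : w = 0.
  have : (y2 - y1) * w = 0 by rewrite mulrBl; lra.
  by move/eqP; rewrite mulf_eq0 subr_eq0 gt_eqF //= => /eqP.
move: h1; rewrite w0 mulr0 add0r => /eqP; rewrite mulf_eq0 invr_eq0 (gt_eqF d2) orbF => /eqP s0.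
split=> //; move: w0 => /eqP; rewrite mulf_eq0 subr_eq0.
rewrite [X in _ || X]gt_eqF ?orbF => [/eqP //|].
by rewrite addr_gt0 // divr_gt0 // mulr_gt0.
Qed.

Local Lemma bracket121_0 X U V : X \in p1 -> U \in p2 -> V \in p1 -> Qg (lie X U) V = 0.
Proof.
have [s0 _] := s_values => X1 U2 V1.
have z x u v : x \in e1 -> u \in e2 -> v \in e1 -> Qg (lie x u) v = 0.
  move=> xe ue ve; have := s0 => /eqP.
  rewrite psumr_eq0 => [/allP/(_ x xe)/=|i _]; last first.
    by do 2! apply: sumr_ge0 => ? _; rewrite sqr_ge0.
  rewrite psumr_eq0 => [/allP/(_ u ue)/=|i _]; last first.
    by apply: sumr_ge0 => ? _; rewrite sqr_ge0.
  rewrite psumr_eq0 => [/allP/(_ v ve)/=|i _]; last by rewrite sqr_ge0.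
  by rewrite sqrf_eq0 => /eqP.
rewrite -(proj_p1E hS X1) -(proj_p2E hS U2) -(proj_p1E hS V1).
rewrite !(onb1_expand hS) (onb2_expand hS) lie_suml (symform_suml sfQ) big_seq big1 // => x xe.
rewrite lieZl (symformZl sfQ) lie_sumr (symform_suml sfQ) big_seq big1 ?mulr0 // => u ue.
rewrite lieZr (symformZl sfQ) (symform_sumr sfQ) big_seq big1 ?mulr0 // => v ve.
by rewrite (symformZr sfQ) z ?mulr0.
Qed.

Local Lemma adsum21_p1 X Y : X \in p1 -> adsum e2 e1 X Y = 0.
Proof.
move=> X1; rewrite /adsum big_seq big1 // => u ue; rewrite big_seq big1 // => v ve.
by rewrite (bracket121_0 X1 (onb2_mem hS ue) (onb1_mem hS ve)) mul0r.
Qed.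

Local Lemma brsum12_p1 X Y : X \in p1 -> brsum e1 e2 X Y = 0.
Proof.
move=> X1; rewrite /brsum big_seq big1 // => u ue; rewrite big_seq big1 // => v ve.
by rewrite (bracket121_0 (onb1_mem hS ue) (onb2_mem hS ve) X1) mul0r.
Qed.

(** With [121] = 0, twice the Ricci tensor on p1 is [al + y^2 ga] with [al] and [ga] independent of
    the metric. It equals (C + A y^2) Q1 at y1 and at y2, and since y1^2 differs from y2^2 this
    gives [al] = C Q1 and [ga] = A Q1. *)
Local Lemma Ric11 x1 x2 X Y : 0 < x1 -> 0 < x2 -> X \in p1 -> Y \in p1 ->
  2 * Ric S x1 x2 X Y = (hrfC S + hrfA S * (x1 / x2) ^+ 2) * Q1 S X Y.
Proof.
move=> x10 x20 X1 Y1; have y20 : 0 < y2 := lt_trans hy1 hy12.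
have [_ s2] := s_values; have d1 := dim1_gt0 hS.
have [l1 [h1 a1 _]] := einstein_traces (or_introl (erefl y1)).
have [l2 [h2 a2 _]] := einstein_traces (or_intror (erefl y2)).
have := h1 _ _ (p1_pp X1) (p1_pp Y1); have := h2 _ _ (p1_pp X1) (p1_pp Y1).
rewrite !metric1 // !mulrA a1 a2 !Ric_p1 // brsum12_p1 // adsum21_p1 //.
rewrite subrr !mulr0 !addr0 !divr1 s2 (_ : t122 S / _ = hrfA S) //.
set al := - killing g X Y - _ - _ + _; set ga := 2^-1 * _; set q := Q1 S X Y.
move=> e2' e1'.
have gE' : ga = hrfA S * q.
  have yy : y2 ^+ 2 - y1 ^+ 2 != 0.
    by rewrite subr_sqr mulf_neq0 ?gt_eqF ?subr_gt0 ?addr_gt0.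
  apply: (mulfI yy); lra.
by rewrite gE'; move: e1'; rewrite gE'; lra.
Qed.

Local Lemma Ric22 x1 x2 X Y : 0 < x1 -> 0 < x2 -> X \in p2 -> Y \in p2 ->
  2 * Ric S x1 x2 X Y = (hrfD S - hrfB S * (x1 / x2)) * Q2 S X Y.
Proof.
move=> x10 x20 X1 Y1; have y20 : 0 < y2 := lt_trans hy1 hy12.
have [s1 s2] := s_values.
have [l1 [h1 _ a1]] := einstein_traces (or_introl (erefl y1)).
have [l2 [h2 _ a2]] := einstein_traces (or_intror (erefl y2)).
have := h1 _ _ (p2_pp X1) (p2_pp Y1); have := h2 _ _ (p2_pp X1) (p2_pp Y1).
rewrite !metric2 // !mul1r a1 a2 !Ric_p2 // !divr1 s1 s2 (_ : t122 S / _ = hrfB S) // mul0r subr0.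
set al := - killing g X Y - _ - _ + _; set ga := adsum e2 e1 _ _; set q := Q2 S X Y.
move=> e2' e1'.
have gE' : ga = hrfB S * q.
  have yy : y2 - y1 != 0 by rewrite gt_eqF ?subr_gt0.
  apply: (mulfI yy); lra.
by rewrite gE'; move: e1'; rewrite gE'; lra.
Qed.

(** The mixed part is affine in y, and the Einstein equation makes it vanish at y1 and y2, because
    the metric itself has no mixed part. *)
Local Lemma Ric12 x1 x2 X Y : 0 < x1 -> 0 < x2 ->
  (X \in p1 /\ Y \in p2) \/ (X \in p2 /\ Y \in p1) -> Ric S x1 x2 X Y = 0.
Proof.
move=> x10 x20 XY; have y20 : 0 < y2 := lt_trans hy1 hy12.
have Xp : X \in pp S by case: XY => -[? ?]; [exact: p1_pp | exact: p2_pp].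
have Yp : Y \in pp S by case: XY => -[? ?]; [exact: p2_pp | exact: p1_pp].
have RE z1 z2 : 0 < z1 -> 0 < z2 -> 2 * Ric S z1 z2 X Y =
    - killing g X Y - adsum e1 e1 X Y - adsum e2 e2 X Y
    + brsum e1 e2 X Y + z1 / z2 * (2^-1 * brsum e2 e2 X Y - adsum e2 e1 X Y).
  by case: XY => -[? ?] ? ?; [exact: Ric_p12 | exact: Ric_p21].
have m0 z : metric S z 1 X Y = 0.
  case: XY => -[hX hY]; first by rewrite metric_Qg2 // Qg0 ?mulr0 // p1_hh.
  by rewrite (symformC (metric_symform hS z 1)) metric_Qg2 // Qg0 ?mulr0 // p1_hh.
have [l1 [h1 _ _]] := einstein_traces (or_introl (erefl y1)).
have [l2 [h2 _ _]] := einstein_traces (or_intror (erefl y2)).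
have := h1 _ _ Xp Yp; have := h2 _ _ Xp Yp; rewrite !m0 !RE // !divr1 !mulr0.
have := RE _ _ x10 x20.
set al := - killing g X Y - _ - _ + _; set ga := 2^-1 * _ - _.
move=> e0 e2' e1'.
have gE' : ga = 0.
  have yy : y2 - y1 != 0 by rewrite gt_eqF ?subr_gt0.
  apply: (mulfI yy); lra.
by move: e0 e1'; rewrite gE'; lra.
Qed.

Local Lemma killing_linl a X X' Y : killing g (a *: X + X') Y = a * killing g X Y + killing g X' Y.
Proof.
rewrite /killing /tr_on mulr_sumr -big_split; apply: eq_bigr => i _ /=.
by rewrite lieDl lieZl linearD linearZ.
Qed.

Local Lemma killing_linr a X X' Y : killing g Y (a *: X + X') = a * killing g Y X + killing g Y X'.
Proof.
rewrite /killing /tr_on mulr_sumr -big_split; apply: eq_bigr => i _ /=.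
by rewrite lieDl lieZl lieDr lieZr linearD linearZ.
Qed.

Theorem Ric_diag x1 x2 X Y : 0 < x1 -> 0 < x2 -> X \in pp S -> Y \in pp S ->
  2 * Ric S x1 x2 X Y = (hrfC S + hrfA S * (x1 / x2) ^+ 2) * Q1 S X Y
    + (hrfD S - hrfB S * (x1 / x2)) * Q2 S X Y.
Proof.
move=> x10 x20 Xp Yp.
have linl Z Z' W : Z \in pp S -> Z' \in pp S -> W \in pp S ->
    Ric S x1 x2 (Z + Z') W = Ric S x1 x2 Z W + Ric S x1 x2 Z' W.
  move=> Zp Zp' Wp; have sm := metric_symform hS x1 x2.
  rewrite !(Ric_unimodular hS x10 x20) ?memvD // -{1}[Z]scale1r killing_linl mul1r.
  under eq_bigr => u _ do (under eq_bigr => v _ do rewrite lieDl linearD /= (symformDl sm) mulrDl).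
  under [in X in _ + _ * X = _]eq_bigr => u _ do
    (under eq_bigr => v _ do rewrite (symformDr sm) mulrDl).
  under eq_bigr => u _ do rewrite big_split.
  under [in X in _ + _ * X = _]eq_bigr => u _ do rewrite big_split.
  by rewrite !big_split /=; ring.
have linr Z Z' W : Z \in pp S -> Z' \in pp S -> W \in pp S ->
    Ric S x1 x2 W (Z + Z') = Ric S x1 x2 W Z + Ric S x1 x2 W Z'.
  move=> Zp Zp' Wp; have sm := metric_symform hS x1 x2.
  rewrite !(Ric_unimodular hS x10 x20) ?memvD // -{1}[Z]scale1r killing_linr mul1r.
  have el u v : metric S x1 x2 (proj_p S (lie (Z + Z') u)) v =
      metric S x1 x2 (proj_p S (lie Z u)) v + metric S x1 x2 (proj_p S (lie Z' u)) v.
    by rewrite lieDl (linearD (proj_p S)) (symformDl sm).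
  have md (a b c : R) : a * (b + c) = a * b + a * c by rewrite mulrDr.
  under eq_bigr => u _ do (under eq_bigr => v _ do rewrite el md).
  under [in X in _ + _ * X = _]eq_bigr => u _ do
    (under eq_bigr => v _ do rewrite (symformDr sm) md).
  under eq_bigr => u _ do rewrite big_split.
  under [in X in _ + _ * X = _]eq_bigr => u _ do rewrite big_split.
  by rewrite !big_split /=; ring.
have X1 := proj_p1_mem S X; have X2 := proj_p2_mem S X.
have Y1 := proj_p1_mem S Y; have Y2 := proj_p2_mem S Y.
have X1p := p1_pp X1; have X2p := p2_pp X2; have Y1p := p1_pp Y1; have Y2p := p2_pp Y2.
rewrite {1}(proj_pp_split hS Xp) {1}(proj_pp_split hS Yp) linl ?memvD // !linr //.
rewrite (@Ric12 x1 x2 (proj_p1 S X) (proj_p2 S Y)) //; last by left.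
rewrite (@Ric12 x1 x2 (proj_p2 S X) (proj_p1 S Y)) //; last by right.
have h1 := Ric11 x10 x20 X1 Y1; have h2 := Ric22 x10 x20 X2 Y2.
have q1 : Q1 S (proj_p1 S X) (proj_p1 S Y) = Q1 S X Y.
  by rewrite /Q1 (proj_p1E hS X1) (proj_p1E hS Y1).
have q2 : Q2 S (proj_p2 S X) (proj_p2 S Y) = Q2 S X Y.
  by rewrite /Q2 (proj_p2E hS X2) (proj_p2E hS Y2).
rewrite q1 in h1; rewrite q2 in h2.
move: h1 h2.
move: (Ric _ _ _ (proj_p1 S X) _) (Ric _ _ _ (proj_p2 S X) _) => r1 r2.
move: (_ * Q1 S X Y) (_ * Q2 S X Y) => t1 t2 h1 h2.
by rewrite addr0 add0r mulrDr h1 h2.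
Qed.

End EinsteinPoints.

End DiagonalRicci.

(** * The planar flow *)

Section Calculus.
Variable R : realType.
Implicit Types (f F g : R -> R) (a b x : R).

Lemma is_derive_continuous f x d : is_derive x 1 f d -> {for x, continuous f}.
Proof.
by case=> h _; apply: differentiable_continuous; apply/derivable1_diffP.
Qed.

Lemma MVT_is_derive f df a b : a < b ->
  (forall x, a <= x <= b -> is_derive x 1 f (df x)) ->
  exists2 c, a < c < b & f b - f a = df c * (b - a).
Proof.
move=> ab hd; have [| |] := @MVT R f df a b ab.
- by move=> x /[!in_itv]/= /andP[h1 h2]; apply: hd; rewrite !ltW.
- apply: continuous_in_subspaceT => x /[!inE]/= /[!in_itv]/= h.
  by apply: is_derive_continuous; exact: hd.
by move=> c /[!in_itv]/= cab E; exists c.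
Qed.

Lemma antiderivative f a b : a < b -> (forall x, x < b -> {for x, continuous f}) ->
  exists F, forall x, a < x < b -> is_derive x 1 F (f x).
Proof.
move=> ab fc; exists (fun y => (\int[lebesgue_measure]_(t in [set` `[a, y]]) f t)%R).
move=> x /andP[ax xb]; have [u1 u2] := midf_lt xb.
have int : lebesgue_measure.-integrable `[a, (x + b) / 2] (EFin \o f).
  apply: continuous_compact_integrable; first exact: segment_compact.
  apply: continuous_in_subspaceT => z /[!inE]/= /[!in_itv]/= /andP[_ zu].
  by apply: fc; exact: le_lt_trans u2.
have [h1 h2] := continuous_FTC1_closed u1 int ax (fc x xb).
by rewrite derive1E in h2; rewrite -h2; exact: derivableP.
Qed.

Lemma is_derive_add f g x df dg : is_derive x 1 f df -> is_derive x 1 g dg ->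
  is_derive x 1 (fun u => f u + g u) (df + dg).
Proof. by move=> hf hg; exact: is_deriveD. Qed.
Lemma is_derive_sub f g x df dg : is_derive x 1 f df -> is_derive x 1 g dg ->
  is_derive x 1 (fun u => f u - g u) (df - dg).
Proof. by move=> hf hg; exact: is_deriveB. Qed.
Lemma is_derive_const (c : R) x : is_derive x 1 (fun=> c) 0.
Proof. exact: is_derive_cst. Qed.
Lemma is_derive_ident x : is_derive x 1 (fun z : R => z) 1.
Proof. exact: is_derive_id. Qed.
Lemma is_derive_scale k f x df : is_derive x 1 f df ->
  is_derive x 1 (fun u => k * f u) (k * df).
Proof.
by move=> hf; apply: (is_deriveM_eq (is_derive_const k x) hf); rewrite mul0r add0r.
Qed.
Lemma is_derive_csub c x : is_derive x 1 (fun z : R => c - z) (-1).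
Proof.
by have := is_derive_sub (is_derive_const c x) (is_derive_ident x); rewrite sub0r.
Qed.
Lemma is_derive_addc c x : is_derive x 1 (fun z : R => z + c) 1.
Proof.
by have := is_derive_add (is_derive_ident x) (is_derive_const c x); rewrite addr0.
Qed.
Lemma bounded_on_segment f a b : a <= b ->
  (forall t, a <= t <= b -> {for t, continuous f}) ->
  exists2 m, 0 < m & forall t, a <= t <= b -> `|f t| <= m.
Proof.
move=> ab fc; have fc' : {within `[a, b], continuous (fun t => `|f t|)}.
  apply: continuous_in_subspaceT => t /[!inE]/= /[!in_itv]/= tab.
  by apply: cvg_norm; exact: fc.
have [c cab cm] := EVT_max ab fc'; exists (`|f c| + 1); first by rewrite ltr_wpDl.
by move=> t tab; rewrite (le_trans (cm t _)) ?lerDl // in_itv.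
Qed.

(** E(u) exp(K u) is nondecreasing and E(u) exp(-K u) nonincreasing. The former bounds E by its
    value at 0 for negative times, the latter for positive times. *)
Lemma gronwall_zero (E dE : R -> R) (a b K : R) : a <= 0 <= b -> 
  (forall t, a <= t <= b -> is_derive t 1 E (dE t)) ->
  (forall t, a <= t <= b -> `|dE t| <= K * E t) ->
  (forall t, 0 <= E t) -> E 0 = 0 -> forall t, a <= t <= b -> E t = 0.
Proof.
move=> /andP[a0 b0] hd hb E0 E00 t /andP[ta tb].
have hexp (k s : R) : is_derive s 1 (fun u => expR (k * u)) (k * expR (k * s)).
  have := is_derive_comp (is_derive_scale k (is_derive_ident s)) (is_derive_expR _).
  by rewrite mulr1 mulrC.
have hEe (k s : R) : a <= s <= b -> is_derive s 1 (fun u => E u * expR (k * u))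
    ((dE s + k * E s) * expR (k * s)).
  by move=> sab; apply: (is_deriveM_eq (hd _ sab) (hexp k s)); ring.
apply/eqP; rewrite eq_le E0 andbT.
have [t0|t0|-> //] := ltgtP t 0; last by rewrite E00.
- have [|c /andP[tc c0] h] := MVT_is_derive t0 (f := fun u => E u * expR (K * u))
    (df := fun s => (dE s + K * E s) * expR (K * s)).
    move=> s /andP[ts s0]; apply: hEe; rewrite (le_trans ta ts); exact: le_trans b0.
  have cab : a <= c <= b by rewrite (le_trans ta (ltW tc)) (le_trans (ltW c0) b0).
  have := hb c cab; rewrite ler_norml => /andP[h1 _].
  have : 0 <= E 0 * expR (K * 0) - E t * expR (K * t).
    by rewrite h !mulr_ge0 ?expR_ge0 ?subr_ge0 ?(ltW t0) // -lerBlDr sub0r.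
  rewrite E00 mul0r sub0r oppr_ge0 => h2; rewrite leNgt; apply/negP => Et.
  by move: h2; rewrite leNgt mulr_gt0 // expR_gt0.
- have [|c /andP[tc c0] h] := MVT_is_derive t0 (f := fun u => E u * expR ((- K) * u))
    (df := fun s => (dE s + (- K) * E s) * expR ((- K) * s)).
    move=> s /andP[ts s0]; apply: hEe; rewrite (le_trans a0 ts); exact: le_trans tb.
  have cab : a <= c <= b by rewrite (le_trans a0 (ltW tc)) (le_trans (ltW c0) tb).
  have := hb c cab; rewrite ler_norml => /andP[_ h1].
  have : E t * expR (- K * t) - E 0 * expR (- K * 0) <= 0.
    rewrite h mulr_le0_ge0 ?subr_ge0 ?(ltW t0) // mulr_le0_ge0 ?expR_ge0 //.
    by rewrite mulNr subr_le0.
  rewrite E00 mul0r subr0 => h2; rewrite leNgt; apply/negP => Et.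
  by move: h2; rewrite leNgt mulr_gt0 // expR_gt0.
Qed.

(** A rule of l'Hopital type at -oo: from a fixed t0 on, the mean value theorem gives slopes close
    to L, and the error at t0 is negligible against t. Applied to x2, it yields its linear
    growth. *)
Lemma slope_limit f h (T L : R) : (forall t, t < T -> is_derive t 1 f (h t)) ->
  h t @[t --> -oo] --> L -> f t / t @[t --> -oo] --> L.
Proof.
move=> hd hL; apply/cvgrPdist_le => e e0.
have e2 : 0 < e / 2 by rewrite divr_gt0.
move/cvgrPdist_le: hL => /(_ _ e2) [N [Nr hN]].
pose t0 := Num.min (N - 1) (Num.min (T - 1) (-1)).
have t0N : t0 < N by rewrite /t0 gt_min ltrBlDr ltrDl ltr01.
have t0T : t0 < T by rewrite /t0 !gt_min [T - 1 < T]ltrBlDr ltrDl ltr01 orbT.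
have t00 : t0 < 0 by rewrite /t0 !gt_min ltrN10 !orbT.
pose K := `|f t0 - L * t0|.
near=> t.
have tt0 : t < t0 by near: t; apply: nbhs_ninfty_lt; exact: num_real.
have t_lt0 : t < 0 := lt_trans tt0 t00.
have tK : K <= (e / 2) * (- t).
  rewrite -ler_pdivrMl // lerNr; near: t; apply: nbhs_ninfty_le; exact: num_real.
have [|c /andP[tc ct0] hc] := MVT_is_derive tt0 (f := f) (df := h).
  by move=> s /andP[_ s0]; apply: hd; exact: le_lt_trans t0T.
have hcL : `|L - h c| <= e / 2 by apply: hN; exact: lt_trans t0N.
have -> : L - f t / t = (L * t - f t) / t by field; rewrite lt_eqF.
rewrite normrM normfV [`|t|]ltr0_norm // ler_pdivrMr ?oppr_gt0 //.
have -> : L * t - f t = (L * t0 - f t0) + (h c - L) * (t0 - t) by rewrite mulrBl -hc; ring.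
apply: (le_trans (ler_normD _ _)); rewrite normrM [`|t0 - t|]gtr0_norm ?subr_gt0 //.
rewrite distrC [`|h c - L|]distrC.
have h1 : `|L - h c| * (t0 - t) <= e / 2 * (- t).
  by rewrite ler_pM ?subr_ge0 ?(ltW tt0) // gerDr ltW.
have -> : e * - t = e / 2 * (- t) + e / 2 * (- t) by field.
exact: lerD.
Unshelve. all: by end_near. Qed.

End Calculus.

(** * Solution of the planar system by quadrature *)

Section ScalarODE.
Variable R : realType.
Variables (A B C D y1 y2 : R).
Hypothesis A0 : 0 < A.
Hypothesis B0 : 0 < B.
Hypothesis hy1 : 0 < y1.
Hypothesis hy12 : y1 < y2.
Hypothesis CE : C = (A + B) * y1 * y2.
Hypothesis DE : D = (A + B) * (y1 + y2).

Let p y := (A + B) * (y1 - y) * (y2 - y).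
Local Lemma pE y : p y = C - D * y + (A + B) * y ^+ 2.
Proof. by rewrite /p CE DE; ring. Qed.

Local Lemma y20 : 0 < y2. Proof. exact: lt_trans hy12. Qed.
Local Lemma AB0 : 0 < A + B. Proof. exact: addr_gt0. Qed.

Local Lemma p_gt0 y : y < y1 -> 0 < p y.
Proof.
by move=> yy; rewrite /p mulr_gt0 ?mulr_gt0 ?AB0 // subr_gt0 //; exact: lt_trans hy12.
Qed.

Local Lemma DB y : 0 < y -> y <= y1 -> 0 < D - B * y.
Proof.
move=> y0 yy; have -> : D - B * y = A * (y1 + y2) + B * y2 + B * (y1 - y) by rewrite DE; ring.
by rewrite ltr_pwDl ?mulr_ge0 ?subr_ge0 ?(ltW B0) // addr_gt0 // mulr_gt0 // ?y20 // addr_gt0 // y20.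
Qed.

(* phi solves phi'/phi = (D - B y)/p y, the equation of x2 as a function of y
   (partial fractions). *)
Let al := (D - B * y1) / ((A + B) * (y2 - y1)).
Let be := - (D - B * y2) / ((A + B) * (y2 - y1)).
Let phi y := expR (- al * ln (y1 - y) - be * ln (y2 - y)).

Local Lemma phi_gt0 y : 0 < phi y. Proof. exact: expR_gt0. Qed.

Local Lemma phi_derive y : y < y1 -> is_derive y 1 phi (phi y * ((D - B * y) / p y)).
Proof.
move=> yy; have yy2 := lt_trans yy hy12.
have hl b : y < b -> is_derive y 1 (fun z => ln (b - z)) (- (b - y)^-1).
  move=> yb; have l1 : is_derive (b - y) 1 (@ln R) (b - y)^-1.
    by apply: is_derive1_ln; rewrite subr_gt0.
  by have := is_derive_comp (is_derive_csub b y) l1; rewrite mulrN1.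
have h3 := is_derive_sub (is_derive_scale (- al) (hl _ yy)) (is_derive_scale be (hl _ yy2)).
have h4 := is_derive_comp h3 (is_derive_expR _).
rewrite (_ : phi y * _ = expR (- al * ln (y1 - y) - be * ln (y2 - y)) *
   (- al * - (y1 - y)^-1 - be * - (y2 - y)^-1)) //; congr (_ * _).
rewrite /al /be /p DE; field.
by rewrite !subr_eq0 !gt_eqF // AB0.
Qed.


Lemma HRF_existence (x10 x20 : R) : 0 < x10 -> 0 < x20 -> x10 / x20 < y1 ->
  exists2 T : R, 0 < T & exists x1 x2 : R -> R,
  [/\ forall t, t < T -> [/\ 0 < x1 t, 0 < x2 t,
         is_derive t 1 x1 (- (C + A * (x1 t / x2 t) ^+ 2))
       & is_derive t 1 x2 (- (D - B * (x1 t / x2 t)))],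
      x1 0 = x10 /\ x2 0 = x20,
      x1 t @[t --> T^'-] --> 0,
      exists2 l : R, 0 < l & x2 t @[t --> T^'-] --> l
    & x1 t / x2 t @[t --> -oo] --> y1].
Proof.
move=> x10p x20p yy1.
pose y0 := x10 / x20; have y0p : 0 < y0 by rewrite divr_gt0.
(* The constant is fixed by x2 = [x20] at y = [y0]. Along the flow x2 = kk phi(y), so f below is x2
   / p and the ratio obeys dy/dt = -1 / f(y). *)
pose kk := x20 / phi y0.
have kkp : 0 < kk by rewrite divr_gt0 // phi_gt0.
pose f (y : R) := kk * phi y / p y.
have f_gt0 (y : R) : y < y1 -> 0 < f y by move=> yy; apply: divr_gt0; [exact: mulr_gt0 kkp (phi_gt0 y) | exact: p_gt0].
have phic (y : R) : y < y1 -> {for y, continuous phi}.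
  by move=> yy; exact: is_derive_continuous (phi_derive yy).
have fc (y : R) : y < y1 -> {for y, continuous f}.
  move=> yy; apply: cvgM; first by apply: cvgM; [exact: cvg_cst | exact: phic].
  apply: cvgV; first by rewrite gt_eqF ?p_gt0.
  apply: cvgM; first apply: cvgM; try exact: cvg_cst.
    by apply: cvgB; [exact: cvg_cst | exact: cvg_id].
  by apply: cvgB; [exact: cvg_cst | exact: cvg_id].
(* The primitive starts at -1 so that 0, where the fibre vanishes, is interior to its domain and F
   is differentiable there. It is then normalised by F(0) = 0. *)
have m1y1 : -1 < y1 by rewrite (lt_trans _ hy1) // ltrN10.
have [F0 F0d] := antiderivative m1y1 fc.
pose F (y : R) := F0 y - F0 0.
have Fd (y : R) : -1 < y -> y < y1 -> is_derive y 1 F (f y).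
  move=> ym yy; have := is_derive_sub (F0d y _) (is_derive_const (F0 0) y).
  by rewrite subr0; apply; rewrite ym.
have F00 : F 0 = 0 by rewrite /F subrr.
have Finc (a b : R) : -1 < a -> a < b -> b < y1 -> F a < F b.
  move=> am ab by1; have [|c /andP[ac cb] h] := MVT_is_derive ab (f := F) (df := f).
    by move=> x /andP[ax xb]; apply: Fd; [exact: lt_le_trans ax|exact: le_lt_trans by1].
  by rewrite -subr_gt0 h mulr_gt0 ?subr_gt0 // f_gt0 // (lt_trans cb).
have phimono (s : R) : 0 <= s -> s < y1 -> phi 0 <= phi s.
  rewrite le_eqVlt => /orP[/eqP <- //|s0 sy].
  have [|c /andP[c0 cs] h] := MVT_is_derive s0 (f := phi)
     (df := fun y => phi y * ((D - B * y) / p y)).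
    by move=> x /andP[x0 xs]; apply: phi_derive; exact: le_lt_trans sy.
  have cy := lt_trans cs sy.
  rewrite -subr_ge0 h !mulr_ge0 ?subr_ge0 ?(ltW s0) ?(ltW (phi_gt0 _)) //.
    by rewrite -subr_ge0; apply: ltW; apply: DB => //; exact: ltW.
  by rewrite invr_ge0 ltW // p_gt0.
(* On [0, y1) one has phi(s) >= phi(0) and y2 - s <= y2, hence f(s) >= kap / (y1 - s) and F(y) >=
   kap ln(y1 / (y1 - y)). The y chosen next is where this bound equals M. So F is unbounded, which
   is what makes the solution ancient. *)
pose kap := kk * phi 0 / ((A + B) * y2).
have kapp : 0 < kap by apply: divr_gt0; [exact: mulr_gt0 kkp (phi_gt0 0) | exact: mulr_gt0 AB0 y20].
have Funb (M : R) : 0 < M -> exists y, [/\ 0 < y, y < y1 & M <= F y].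
  move=> M0; pose y := y1 * (1 - expR (- (M / kap))).
  have e1 : expR (- (M / kap)) < 1 by rewrite expR_lt1 oppr_lt0 divr_gt0.
  have yp : 0 < y by rewrite mulr_gt0 // subr_gt0.
  have yy : y < y1 by rewrite -[ltRHS]mulr1 ltr_pM2l // gtrBl expR_gt0.
  exists y; split=> //.
  have [|c /andP[c0 cs] h] := MVT_is_derive yp (f := fun y => F y + kap * ln (y1 - y))
     (df := fun s => f s + kap * (- (y1 - s)^-1)).
    move=> x /andP[x0 xs]; have xy := le_lt_trans xs yy.
    have l1 : is_derive (y1 - x) 1 (@ln R) (y1 - x)^-1 by apply: is_derive1_ln; rewrite subr_gt0.
    have l2 := is_derive_comp (is_derive_csub y1 x) l1.
    have := is_derive_add (Fd x _ xy) (is_derive_scale kap l2).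
    by rewrite mulrN1; apply; rewrite (lt_le_trans (ltrN10 R)).
  have cy := lt_trans cs yy.
  have fk : kap / (y1 - c) <= f c.
    rewrite /kap /f /p.
    have -> : kk * phi 0 / ((A + B) * y2) / (y1 - c) = kk * phi 0 / ((A + B) * (y1 - c) * y2).
      by field; rewrite subr_eq0 !gt_eqF ?AB0 ?y20.
    have pos : 0 < (A + B) * (y1 - c) by rewrite mulr_gt0 ?AB0 // subr_gt0.
    have pos2 : 0 < y2 - c by rewrite subr_gt0 (lt_trans cy).
    apply: ler_pM.
    - by rewrite mulr_ge0 // ltW // phi_gt0.
    - by rewrite invr_ge0 mulr_ge0 // ltW // y20.
    - by rewrite ler_pM2l // phimono // ltW.
    - have pos1 := mulr_gt0 pos pos2; have pos3 := mulr_gt0 pos y20.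
      by rewrite lef_pV2 // ler_pM2l // gerBl ltW.
  have : 0 <= F y + kap * ln (y1 - y) - (F 0 + kap * ln (y1 - 0)).
    by rewrite h mulr_ge0 ?subr_ge0 ?(ltW yp) // mulrN subr_ge0.
  rewrite F00 subr0 add0r.
  have -> : y1 - y = y1 * expR (- (M / kap)) by rewrite /y; ring.
  rewrite lnM ?posrE ?expR_gt0 // expRK mulrDr mulrN [kap * (M / _)]mulrC divfK ?gt_eqF //.
  lra.
(* The inverse of F on (0, y1). The default 0 is irrelevant: g is only evaluated at T - t with t <
   T. *)
pose g (tau : R) := xget 0 [set y | [/\ 0 < y, y < y1 & F y = tau]].
have gP (tau : R) : 0 < tau -> [/\ 0 < g tau, g tau < y1 & F (g tau) = tau].
  move=> tau0; have [y [yp yy My]] := Funb _ tau0.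
  have Fc : {within `[0, y], continuous F}.
    apply: continuous_in_subspaceT => x /[!inE]/= /[!in_itv]/= /andP[x0 xy].
    apply: is_derive_continuous; apply: Fd; first by rewrite (lt_le_trans (ltrN10 R)).
    exact: le_lt_trans yy.
  have [|c /[!in_itv]/= /andP[c0 cy] Fcc] := IVT (v := tau) (ltW yp) Fc.
    by rewrite F00 ge_min le_max (ltW tau0) My orbT.
  have : [set y | [/\ 0 < y, y < y1 & F y = tau]] c.
    split=> //; last exact: le_lt_trans yy.
    rewrite lt_neqAle c0 andbT; apply: contraTneq tau0 => c0'.
    by rewrite -Fcc -c0' F00 ltxx.
  by move=> hc; exact: (xgetI 0 hc).
have Finj (a b : R) : 0 < a -> a < y1 -> 0 < b -> b < y1 -> F a = F b -> a = b.
  move=> a0 ay b0 bly; have [ab|ba|//] := ltgtP a b => E.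
    by have := @Finc a b (lt_trans (ltrN10 R) a0) ab bly; rewrite E ltxx.
  by have := @Finc b a (lt_trans (ltrN10 R) b0) ba ay; rewrite E ltxx.
have Fpos (y : R) : 0 < y -> y < y1 -> 0 < F y.
  by move=> yp yy; rewrite -F00; apply: Finc => //; exact: ltrN10.
have gK (y : R) : 0 < y -> y < y1 -> g (F y) = y.
  move=> yp yy; have [h1 h2 h3] := gP _ (Fpos _ yp yy).
  exact: Finj.
have gd (tau : R) : 0 < tau -> is_derive tau 1 g (f (g tau))^-1.
  move=> tau0; have [h1 h2 h3] := gP _ tau0.
  rewrite -{1}h3; apply: is_derive_inverse.
  - near=> z; apply: gK; near: z; [exact: lt_nbhsr | exact: lt_nbhsl].
  - near=> z; apply: is_derive_continuous; apply: Fd.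
      by apply: (@lt_trans _ _ 0); [exact: ltrN10 | near: z; exact: lt_nbhsr].
    by near: z; exact: lt_nbhsl.
  - by apply: Fd => //; rewrite (lt_trans (ltrN10 R)).
  - by rewrite gt_eqF // f_gt0.
(* F(y) is the time left until y reaches 0, that is, T - t = F(y(t)). This choice of T puts the
   ratio at [y0] when t = 0. *)
pose T := F y0.
pose yt (t : R) := g (T - t).
pose x2 (t : R) := kk * phi (yt t).
have ytP (t : R) : t < T -> [/\ 0 < yt t, yt t < y1 & F (yt t) = T - t].
  by move=> tT; apply: gP; rewrite subr_gt0.
have ytd (t : R) : t < T -> is_derive t 1 yt (- (f (yt t))^-1).
  move=> tT; have := is_derive_comp (is_derive_csub T t) (gd (T - t) _).
  by rewrite mulrN1; apply; rewrite subr_gt0.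
have x2d (t : R) : t < T -> is_derive t 1 x2 (- (D - B * yt t)).
  move=> tT; have [h1 h2 _] := ytP t tT.
  have := is_derive_scale kk (is_derive_comp (ytd t tT) (phi_derive h2)).
  congr is_derive; rewrite /f; field.
  by rewrite !gt_eqF ?phi_gt0 ?p_gt0.
have x2p (t : R) : 0 < x2 t by rewrite mulr_gt0 // phi_gt0.
exists T; first exact: Fpos.
exists (fun t => yt t * x2 t), x2.
have yE (t : R) : yt t * x2 t / x2 t = yt t by rewrite mulfK // gt_eqF.
have ytT : yt t @[t --> T^'-] --> 0.
  apply/cvgrPdist_lt => e e0.
  pose e' := Num.min e (y1 / 2).
  have e'0 : 0 < e' by rewrite /e' lt_min e0 divr_gt0.
  have e'1 : e' < y1 by rewrite /e' gt_min ltr_pdivrMr // ltr_pMr // ltr1n orbT.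
  have Fe := Fpos _ e'0 e'1.
  near=> t.
  have tT : t < T by near: t; exact: nbhs_left_lt.
  have [h1 h2 h3] := ytP t tT.
  rewrite sub0r normrN gtr0_norm //; apply: (@lt_le_trans _ _ e'); last by rewrite /e' ge_min lexx.
  rewrite ltNge; apply/negP => ey.
  have : T - F e' < t by near: t; apply: nbhs_left_gt; rewrite gtrBl.
  apply/negP; rewrite -leNgt lerBrDr addrC -lerBrDr -h3.
  move: ey; rewrite le_eqVlt => /orP[/eqP -> //|ey]; apply: ltW; apply: Finc => //.
  exact: lt_trans (ltrN10 R) e'0.
have x2T : x2 t @[t --> T^'-] --> kk * phi 0.
  apply: cvgM; first exact: cvg_cst.
  have h : {for 0, continuous phi} := phic 0 hy1.
  exact: (cvg_comp _ _ ytT h).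
split.
- move=> t tT; have [h1 h2 _] := ytP t tT; rewrite yE; split.
  + exact: mulr_gt0 h1 (x2p t).
  + exact: x2p.
  + apply: (is_deriveM_eq (ytd t tT) (x2d t tT)).
    have kp := phi_gt0 (yt t); have pp0 := p_gt0 h2.
    rewrite /f /x2 -[C + _](addrK (D * yt t)) -[X in X - _]addrA [_ + D * yt t]addrC addrA.
    have -> : C + D * yt t + A * yt t ^+ 2 - D * yt t = p (yt t) + D * yt t - B * yt t ^+ 2.
      by rewrite pE; ring.
    move: (phi _) (p _) kp pp0 => ph pv kp pp0.
    by field; rewrite !gt_eqF.
  + exact: x2d.
- rewrite /yt subr0 /x2 /yt subr0 gK // /kk divfK ?gt_eqF ?phi_gt0 //.
  by rewrite /y0 divfK // gt_eqF.
- by rewrite -(mul0r (kk * phi 0)); exact: cvgM.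
- by exists (kk * phi 0) => //; rewrite mulr_gt0 // phi_gt0.
under eq_fun do rewrite yE.
apply/cvgrPdist_lt => e e0.
pose e' := Num.max (y1 - e) (y1 / 2).
have e'0 : 0 < e' by rewrite /e' lt_max divr_gt0 // orbT.
have e'1 : e' < y1 by rewrite /e' gt_max gtrBl e0 ltr_pdivrMr // ltr_pMr // ltr1n.
have Fe := Fpos _ e'0 e'1.
near=> t.
have tT : t < T by near: t; apply: nbhs_ninfty_lt; exact: num_real.
have [h1 h2 h3] := ytP t tT.
rewrite gtr0_norm ?subr_gt0 // ltrBlDr -ltrBlDl.
apply: (@le_lt_trans _ _ e'); first by rewrite /e' le_max lexx.
rewrite ltNge; apply/negP => ey.
have : t < T - F e' by near: t; apply: nbhs_ninfty_lt; exact: num_real.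
apply/negP; rewrite -leNgt lerBlDr addrC -lerBlDr -h3.
move: ey; rewrite le_eqVlt => /orP[/eqP -> //|ey]; apply: ltW; apply: Finc => //.
exact: lt_trans (ltrN10 R) h1.
Unshelve. all: by end_near. Qed.

End ScalarODE.

(** * Uniqueness for the planar system *)

Section Uniqueness.
Variable R : realType.
Variables (A B C D T : R).

Definition solves_HRF (x1 x2 : R -> R) : Prop :=
  forall t, t < T -> [/\ 0 < x1 t, 0 < x2 t,
         is_derive t 1 x1 (- (C + A * (x1 t / x2 t) ^+ 2))
       & is_derive t 1 x2 (- (D - B * (x1 t / x2 t)))].

(** The squared distance E of two solutions satisfies |E'| <= K E on the segment between 0 and t, in
    either time direction, and E(0) = 0. The segment is compact and lies below T, so x2 and z2 stay
    away from 0 and the right-hand sides are Lipschitz there. *)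
Lemma HRF_unique x1 x2 z1 z2 : 0 < T -> solves_HRF x1 x2 -> solves_HRF z1 z2 ->
  z1 0 = x1 0 -> z2 0 = x2 0 -> forall t, t < T -> z1 t = x1 t /\ z2 t = x2 t.
Proof.
move=> T0 hx hz e1 e2 t tT.
pose a := Num.min t 0; pose b := Num.max t 0.
have ab : a <= b by rewrite /a /b ge_min le_max lexx.
have a0 : a <= 0 by rewrite /a ge_min lexx orbT.
have b0 : 0 <= b by rewrite /b le_max lexx orbT.
have bT : b < T by rewrite /b gt_max tT T0.
have sT s : a <= s <= b -> s < T by move=> /andP[_ sb]; exact: le_lt_trans bT.
have cx1 s : a <= s <= b -> {for s, continuous x1}.
  by move=> /sT /hx[_ _ h _]; exact: is_derive_continuous h.
have cx2 s : a <= s <= b -> {for s, continuous x2}.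
  by move=> /sT /hx[_ _ _ h]; exact: is_derive_continuous h.
have cz1 s : a <= s <= b -> {for s, continuous z1}.
  by move=> /sT /hz[_ _ h _]; exact: is_derive_continuous h.
have cz2 s : a <= s <= b -> {for s, continuous z2}.
  by move=> /sT /hz[_ _ _ h]; exact: is_derive_continuous h.
have nx s : a <= s <= b -> x2 s != 0 by move=> /sT /hx[_ h _ _]; rewrite gt_eqF.
have nz s : a <= s <= b -> z2 s != 0 by move=> /sT /hz[_ h _ _]; rewrite gt_eqF.
(* Bounds for the coefficients in two identities for the difference w of the ratios: w = u / z2 -
   (x1 / (x2 z2)) v, and the difference of the squared ratios is w times their sum. *)
have [m1 m10 hm1] := @bounded_on_segment R (fun s => (z2 s)^-1) a b ab
  (fun s h => cvgV (nz s h) (cz2 s h)).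
have [m2 m20 hm2] := @bounded_on_segment R (fun s => x1 s / x2 s / z2 s) a b ab
  (fun s h => cvgM (cvgM (cx1 s h) (cvgV (nx s h) (cx2 s h))) (cvgV (nz s h) (cz2 s h))).
have [m3 m30 hm3] := @bounded_on_segment R (fun s => z1 s / z2 s + x1 s / x2 s) a b ab
  (fun s h => cvgD (cvgM (cz1 s h) (cvgV (nz s h) (cz2 s h)))
                   (cvgM (cx1 s h) (cvgV (nx s h) (cx2 s h)))).
pose u s := z1 s - x1 s; pose v s := z2 s - x2 s.
pose w s := z1 s / z2 s - x1 s / x2 s.
pose E s := u s ^+ 2 + v s ^+ 2.
pose dE s := 2 * (u s * (- A * (w s * (z1 s / z2 s + x1 s / x2 s))) + v s * (B * w s)).
have hd s : a <= s <= b -> is_derive s 1 E (dE s).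
  move=> sab; have [_ _ d1 d2] := hx s (sT s sab); have [_ _ d3 d4] := hz s (sT s sab).
  have du := is_derive_sub d3 d1; have dv := is_derive_sub d4 d2.
  have -> : E = fun s => u s * u s + v s * v s by apply/funext => r; rewrite /E !expr2.
  have := is_derive_add (is_deriveM_eq du du erefl) (is_deriveM_eq dv dv erefl).
  congr is_derive; rewrite /dE /u /v /w; ring.
have wE s : a <= s <= b -> w s = u s / z2 s - (x1 s / x2 s / z2 s) * v s.
  by move=> sab; rewrite /w /u /v; field; rewrite nx ?nz.
pose m := m1 + m2.
have hw s : a <= s <= b -> `|w s| <= m * (`|u s| + `|v s|).
  move=> sab; rewrite wE //; apply: (le_trans (ler_normB _ _)).
  rewrite !normrM -!normrM [`|u s * _|]normrM [`|_ * v s|]normrM.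
  have h1 := hm1 s sab; have h2 := hm2 s sab.
  have u0 := normr_ge0 (u s); have v0 := normr_ge0 (v s).
  rewrite /m mulrDl mulrDr (mulrDr m2) [`|u s| * _]mulrC.
  rewrite -addrA lerD // ?ler_wpM2r // ler_wpDl ?mulr_ge0 ?(ltW m10) //.
  by rewrite ler_wpDl ?mulr_ge0 ?(ltW m20) // ler_wpM2r.
have hb s : a <= s <= b -> `|dE s| <= (4 * (`|A| * m * m3 + `|B| * m)) * E s.
  move=> sab; have h3 := hm3 s sab; have hws := hw s sab.
  have u0 := normr_ge0 (u s); have v0 := normr_ge0 (v s).
  have m0 : 0 <= m by rewrite addr_ge0 // ltW.
  set c := `|A| * m * m3 + `|B| * m.
  have c0 : 0 <= c by rewrite addr_ge0 // ?mulr_ge0 // ltW.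
  rewrite /dE normrM ger0_norm //.
  have h4 : `|u s * (- A * (w s * (z1 s / z2 s + x1 s / x2 s))) + v s * (B * w s)|
      <= (`|u s| + `|v s|) * (c * (`|u s| + `|v s|)).
    apply: (le_trans (ler_normD _ _)); rewrite !normrM normrN mulrDl; apply: lerD.
      rewrite ler_wpM2l // /c.
      have -> : (`|A| * m * m3 + `|B| * m) * (`|u s| + `|v s|) =
        `|A| * (m * (`|u s| + `|v s|) * m3) + `|B| * m * (`|u s| + `|v s|) by ring.
      apply: ler_wpDr; first by rewrite !mulr_ge0 // addr_ge0.
      by apply: ler_wpM2l => //; exact: ler_pM.
    rewrite ler_wpM2l // /c.
    have -> : (`|A| * m * m3 + `|B| * m) * (`|u s| + `|v s|) =
        `|A| * m * m3 * (`|u s| + `|v s|) + `|B| * (m * (`|u s| + `|v s|)) by ring.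
    apply: ler_wpDl; last by apply: ler_wpM2l.
    by rewrite !mulr_ge0 ?addr_ge0 // ltW.
  have h5 : (`|u s| + `|v s|) ^+ 2 <= 2 * E s.
    rewrite /E -[u s ^+ 2]real_normK ?num_real // -[v s ^+ 2]real_normK ?num_real //.
    rewrite -subr_ge0.
    have -> : 2 * (`|u s| ^+ 2 + `|v s| ^+ 2) - (`|u s| + `|v s|) ^+ 2 = (`|u s| - `|v s|) ^+ 2 by ring.
    exact: sqr_ge0.
  have -> : 4 * c * E s = 2 * (c * (2 * E s)) by ring.
  rewrite ler_wpM2l //; apply: (le_trans h4).
  have -> : (`|u s| + `|v s|) * (c * (`|u s| + `|v s|)) = c * (`|u s| + `|v s|) ^+ 2 by ring.
  exact: ler_wpM2l.
have E0 s : 0 <= E s by rewrite addr_ge0 // sqr_ge0.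
have E00 : E 0 = 0 by rewrite /E /u /v e1 e2 !subrr expr0n addr0.
have a0b : a <= 0 <= b by rewrite a0 b0.
have tab : a <= t <= b by rewrite /a /b ge_min le_max lexx.
have := gronwall_zero a0b hd hb E0 E00 tab; rewrite /E => /eqP.
rewrite paddr_eq0 ?sqr_ge0 // !sqrf_eq0 !subr_eq0 => /andP[/eqP -> /eqP ->].
by [].
Qed.

End Uniqueness.

(** * Short arcs in closed subgroups *)

Section MatrixExponential.
Variables (R : realType) (n : nat).
Local Notation M := 'M[R]_n.
Variable X : M.

(** X^k Y. The spare factor Y is carried so that the series below represents exp(sX) Y and its
    termwise derivative is the same series for XY. *)
Let pw (k : nat) (Y : M) : M := iter k (mulmx X) Y.

Let coef (Y : M) (i j : 'I_n) (k : nat) : R := pw k Y i j / k`!%:R.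

Local Lemma pw_mulr k (Y : M) : pw k Y = pw k 1%:M *m Y.
Proof. by elim: k => [|k IH] /=; rewrite ?mul1mx // /pw /= -/(pw k Y) IH mulmxA. Qed.

Local Lemma pw_norm k (Y : M) : `|pw k Y| <= (n%:R * `|X|) ^+ k * `|Y|.
Proof.
elim: k => [|k IH] /=; first by rewrite mul1r.
apply: (le_trans (mulmx_norm_le _ _)).
by rewrite exprS -[leRHS]mulrA ler_wpM2l // mulr_ge0.
Qed.

Local Lemma coef_cvg Y i j (s : R) : cvgn (pseries (coef Y i j) s).
Proof.
apply: normed_cvg.
apply: (@series_le_cvg _ _ (`|Y| *: exp_coeff (n%:R * `|X| * `|s|))).
- by move=> k; exact: normr_ge0.
- by move=> k; apply: mulr_ge0 => //; rewrite /exp_coeff /= divr_ge0 ?exprn_ge0 ?mulr_ge0.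
- move=> k; rewrite /coef /exp_coeff /= !normrM normrX normfV normr_nat.
  have -> : (`|Y| *: (fun k0 => (n%:R * `|X| * `|s|) ^+ k0 / k0`!%:R : R)) k =
    ((n%:R * `|X|) ^+ k * `|Y|) / k`!%:R * `|s| ^+ k :> R.
    by rewrite -[LHS]/(`|Y| * (_ / _)) exprMn; ring.
  rewrite ler_wpM2r ?exprn_ge0 // ler_wpM2r ?invr_ge0 //.
  exact: le_trans (mx_entry_le _ _ _) (pw_norm _ _).
- by apply: is_cvg_seriesZ; exact: is_cvg_series_exp_coeff.
Qed.

Let E (Y : M) (s : R) : M := \matrix_(i, j) limn (pseries (coef Y i j) s).

Local Lemma E_deriv Y (s : R) : mderiv (E Y) s (E (X *m Y) s).
Proof.
move=> i j; under eq_fun do rewrite mxE; rewrite mxE.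
have dE Z : pseries_diffs (coef Z i j) = coef (X *m Z) i j.
  apply/funext => k; rewrite /pseries_diffs /coef factS natrM invfM.
  rewrite /pw -iterSr mulrCA mulVKf //.
rewrite -dE; apply: (@pseries_snd_diffs _ _ (`|s| + 1)); rewrite ?dE; try exact: coef_cvg.
by rewrite [ltRHS]ger0_norm ?addr_ge0 // ltrDl.
Qed.

Local Lemma E_mulr (Y : M) s : E Y s = E 1%:M s *m Y.
Proof.
apply/matrixP => i j; rewrite !mxE.
have -> : pseries (coef Y i j) s = fun N =>
   \sum_(l <- index_enum 'I_n) pseries (coef 1%:M i l) s N * Y l j.
  apply/funext => N; rewrite /pseries /series /=.
  under [RHS]eq_bigr do rewrite mulr_suml.
  rewrite exchange_big /=; apply: eq_bigr => k _.
  rewrite /coef pw_mulr mxE mulr_suml mulr_suml; apply: eq_bigr => l _; ring.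
apply/cvg_lim => //.
have -> : \sum_l E 1%:M s i l * Y l j = \sum_(l <- index_enum 'I_n) limn (pseries (coef 1%:M i l) s) * Y l j.
  by apply: eq_bigr => l _; rewrite mxE.
apply: cvg_sum_seq => l; apply: cvgM; [exact: coef_cvg | exact: cvg_cst].
Qed.

Local Lemma E_mull s : E X s = X *m E 1%:M s.
Proof.
apply/matrixP => i j; rewrite !mxE.
have -> : pseries (coef X i j) s = fun N =>
   \sum_(l <- index_enum 'I_n) X i l * pseries (coef 1%:M l j) s N.
  apply/funext => N; rewrite /pseries /series /=.
  under [RHS]eq_bigr do rewrite mulr_sumr.
  rewrite exchange_big /=; apply: eq_bigr => k _.
  have -> : coef X i j k = (X *m pw k 1%:M) i j / k`!%:R.
    by rewrite /coef -{1}[X]mulmx1 /pw -iterSr.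
  rewrite mxE mulr_suml mulr_suml; apply: eq_bigr => l _; rewrite /coef; ring.
apply/cvg_lim => //.
have -> : \sum_l X i l * E 1%:M s l j = \sum_(l <- index_enum 'I_n) X i l * limn (pseries (coef 1%:M l j) s).
  by apply: eq_bigr => l _; rewrite mxE.
apply: cvg_sum_seq => l; apply: cvgM; [exact: cvg_cst | exact: coef_cvg].
Qed.

(** Since e commutes with X, e(u + t) e(-u) has zero derivative in u and is constantly e(t). The
    case t = 0 gives inverses, and together they give the homomorphism property. *)
Lemma matrix_exponential : exists e : R -> M,
  [/\ e 0 = 1%:M, forall s, mderiv e s (X *m e s)
    & forall s t, e (s + t) = e s *m e t].
Proof.
pose e := E 1%:M; exists e.
have e0 : e 0 = 1%:M.
  apply/matrixP => i j; rewrite mxE; apply/cvg_lim => //.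
  rewrite -(cvg_shiftS (pseries (coef 1%:M i j) 0)) /=.
  have -> : (fun N => pseries (coef 1%:M i j) 0 N.+1) = fun=> (1%:M : M) i j.
    apply/funext => N; rewrite /pseries /series /= big_nat_recl // big1_idem /= ?addr0 //.
      by rewrite /coef /= fact0 divr1 expr0 mulr1.
    by move=> k _; rewrite exprS mul0r mulr0.
  exact: cvg_cst.
have de (s : R) : mderiv e s (e s *m X).
  by have := @E_deriv 1%:M s; rewrite mulmx1 E_mulr.
have comm s : e s *m X = X *m e s by rewrite -E_mulr E_mull.
have key (s t : R) : e (s + t) *m e (- s) = e t.
  pose f u := e (u + t) *m e (- u).
  have df (u : R) : mderiv f u 0.
    have d1 := mderiv_comp (@is_derive_addc R t u) (de (u + t)).
    have d2 := mderiv_comp (is_deriveNid u 1) (de (- u)).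
    have := mderiv_mul d1 d2; rewrite scale1r scaleN1r mulmxN.
    by rewrite -mulmxA -(comm (- u)) subrr.
  suff -> : e (s + t) *m e (- s) = f 0 by rewrite /f add0r oppr0 e0 mulmx1.
  apply/matrixP => i j; apply: (@is_derive_0_is_cst R (fun u => f u i j)) => u.
  by have := df u i j; rewrite mxE.
have inv s : e s *m e (- s) = 1%:M by have := key s 0; rewrite addr0 e0.
split=> // [s|s t]; first by rewrite -comm.
rewrite addrC -[LHS]mulmx1.
have <- : e (- t) *m e t = 1%:M by have := inv (- t); rewrite opprK.
by rewrite mulmxA key.
Qed.

End MatrixExponential.

(** * Tangent directions of a closed subgroup *)

Section TangentEstimate.
Variables (R : realType) (n : nat).
Local Notation M := 'M[R]_n.
Implicit Types (G : set M) (gg : {vspace M}) (c : R -> M).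

Lemma mcvg_near (V : normedModType R) (x : V) (A : V -> M) (L : M) :
  mcvg (nbhs x) A L -> forall e : R, 0 < e ->
  exists2 d : R, 0 < d & forall u, `|x - u| < d -> `|L - A u| < e.
Proof.
move=> h e e0; have h' : A u @[u --> x] --> L by exact: (mcvgP _ _).1 h.
have hn : nbhs x (fun u => `|L - A u| < e) by exact: ((cvgrPdist_lt _ _).1 h' e e0).
have /nbhs_ballP[d /= d0 hd] := hn.
by exists d => // u xu; apply: hd; rewrite -ball_normE.
Qed.

(** Strict differentiability at 0, by the mean value theorem in each entry and the continuity of the
    velocity. Two free points s and t are needed for the contraction argument in [local_arcs]. *)
Lemma C1_curve_strict c : C1_curve c -> forall k : R, 0 < k ->
  exists2 d : R, 0 < d & forall s t, `|s| < d -> `|t| < d ->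
    `|c s - c t - (s - t) *: velocity c 0| <= k * `|s - t|.
Proof.
move=> hc k k0.
have hv : mcvg (nbhs (0 : R)) (velocity c) (velocity c 0).
  by move=> i j; exact: velocity_continuous.
have [d d0 hd] := mcvg_near hv k0; exists d => //.
have key s t : `|s| < d -> `|t| < d -> t < s ->
    `|c s - c t - (s - t) *: velocity c 0| <= k * `|s - t|.
  move=> sd td ts; apply/mx_norm_leP => [|i j]; first by rewrite mulr_ge0 // ltW.
  have [x /andP[tx xs] E] := @MVT_is_derive R (fun u => c u i j)
    (fun u => velocity c u i j) t s ts (fun x _ => C1_curve_mderiv x hc i j).
  rewrite !mxE E mulrC -mulrBr normrM mulrC ler_wpM2r //.
  have xd : `|0 - x| < d.
    rewrite sub0r normrN.
    by move: sd td; rewrite !ltr_norml => /andP[? ?] /andP[? ?]; apply/andP; split; lra.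
  have := le_trans (mx_entry_le _ i j) (ltW (hd _ xd)).
  by rewrite distrC !mxE.
move=> s t sd td; have [ts|st|->] := ltgtP t s; first exact: key.
- have := key t s td sd st.
  rewrite -normrN distrC; congr (`|_| <= _).
  by apply/matrixP => i j; rewrite !mxE; ring.
- by rewrite !subrr scale0r subrr !normr0 mulr0.
Qed.

Lemma group_norm_le1 G a : compact_lie_group G -> G a -> `|a| <= 1.
Proof.
move=> [_ _ _ _ orth] /orth ha; apply/mx_norm_leP => // i j.
have := congr1 (fun X : M => X i i) ha; rewrite !mxE eqxx (bigD1 j) //= mxE => h.
have S0 : 0 <= \sum_(k < n | k != j) a i k * a^T k i.
  by apply: sumr_ge0 => k _; rewrite mxE -expr2 sqr_ge0.
rewrite -(@ler_pXn2r _ 2) ?nnegrE // expr1n real_normK ?num_real // expr2.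
by rewrite -[leRHS]h lerDl.
Qed.

(* The powers g^m with m |g - 1| close to s approximate exp (s X). *)
Lemma lie_algebra_accumulation G gg (X : M) : compact_lie_group G -> lie_algebra_of G gg ->
  (forall d : R, 0 < d -> exists g, [/\ G g, 0 < `|g - 1%:M|, `|g - 1%:M| < d
      & `|g - 1%:M - `|g - 1%:M| *: X| <= d * `|g - 1%:M|]) ->
  X \in gg.
Proof.
move=> hG hg acc; have [Gc G1 GM GV orth] := hG.
have [e [e0 de eD]] := matrix_exponential X.
have ce (s : R) : mcvg (nbhs s) e (e s).
  by move=> i j; exact: (is_derive_continuous (de s i j)).
have cne (s : R) : {for s, continuous (fun u => `|e u|)}.
  exact: (cvg_norm ((mcvgP _ _).1 (ce s))).
have Ce : C1_curve e.
  apply: (C1_curveP de) => s; exact: (mcvg_mul (mcvg_cst (nbhs s) X) (ce s)).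
have ve : velocity e 0 = X by rewrite (velocity_unique (de 0)) e0 mulmx1.
suff Gpos s : 0 <= s -> G (e s).
  apply/hg; exists e; split=> // s; have [|s0] := leP 0 s; first exact: Gpos.
  have Gs : G (e (- s)) by apply: Gpos; rewrite oppr_ge0 ltW.
  suff -> : e s = (e (- s))^T by exact: group_trV Gs.
  have := group_trK hG Gs => h.
  by rewrite -[LHS]mul1mx -h -mulmxA -eD addNr e0 mulmx1.
(* G is closed, so it is enough to find a power of some g in every ball around e(s). *)
move=> s0; apply: Gc => B /nbhs_ballP[r /= r0 rB].
have [C C0 hC] := bounded_on_segment s0 (fun t _ => cne t).
(* The errors of the m factors add up to at most 2 k n^2 C m w, and m w <= s; the choice of k makes
   this less than 2 k K = r / 4. The additional 1 keeps K positive. *)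
pose K : R := n%:R * n%:R * C * s + 1.
have K0 : 0 < K by rewrite ltr_wpDl // !mulr_ge0 // ltW.
pose k := r / 8 / K.
have k0 : 0 < k by rewrite !divr_gt0.
have [d1 d10 hd1] := C1_curve_strict Ce k0.
have [d2 d20 hd2] : exists2 d : R, 0 < d & forall u, `|s - u| < d -> `|e s - e u| < r / 2.
  by apply: mcvg_near (ce s) _ _; rewrite divr_gt0.
pose d := Num.min k (Num.min d1 d2).
have d0 : 0 < d by rewrite !lt_min k0 d10.
have [g [Gg w0 wd hw]] := acc d d0.
set w := `|g - 1%:M| in w0 wd hw *.
have [wk [wd1 wd2]] : w < k /\ w < d1 /\ w < d2.
  by move: wd; rewrite !lt_min => /andP[? /andP[? ?]].
pose m := Num.truncn (s / w).
have /andP[m1 m2] : m%:R <= s / w < m.+1%:R by rewrite truncn_itv // divr_ge0 // ltW.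
have mw : m%:R * w <= s by rewrite -ler_pdivlMr.
have smw : `|s - m%:R * w| < d2.
  rewrite ger0_norm ?subr_ge0 //; apply: lt_trans wd2.
  by rewrite ltrBlDl; move: m2; rewrite ltr_pdivrMr // -natr1 mulrDl mul1r.
have ew : `|g - e w| <= 2 * k * w.
  have -> : g - e w = (g - 1%:M - w *: X) - (e w - e 0 - (w - 0) *: velocity e 0).
    by rewrite e0 ve subr0; apply/matrixP => i j; rewrite !mxE; ring.
  apply: (le_trans (ler_normB _ _)).
  have h1 : `|g - 1%:M - w *: X| <= k * w.
    by apply: (le_trans hw); rewrite ler_wpM2r ?(ltW w0) // ge_min lexx.
  have h2 := hd1 w 0; rewrite normr0 subr0 gtr0_norm // in h2.
  have {}h2 := h2 wd1 d10; rewrite subr0; lra.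
pose gp j := iter j (mulmx g) 1%:M.
have Ggp j : G (gp j) by elim: j => [//|j IH]; exact: GM.
have ejw j : (j <= m)%N -> 0 <= j%:R * w <= s.
  move=> jm; rewrite mulr_ge0 ?(ltW w0) //=; apply: le_trans mw.
  by rewrite ler_wpM2r ?ler_nat // ltW.
(* Telescoping of g^j - e(w)^j. The left factor a in G absorbs the powers of g without growth,
   because entries of group elements are bounded by 1. *)
have tel j : (j <= m)%N -> forall a, G a ->
    `|a *m (gp j - e (j%:R * w))| <= j%:R * (n%:R * n%:R * C * (2 * k * w)).
  elim: j => [_ a Ga|j IH jm a Ga].
    by rewrite !mul0r e0 subrr mulmx0 normr0.
  have -> : a *m (gp j.+1 - e (j.+1%:R * w)) =
     (a *m g) *m (gp j - e (j%:R * w)) + a *m ((g - e w) *m e (j%:R * w)).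
    rewrite -natr1 mulrDl mul1r [_ + w]addrC eD /= -/(gp j).
    by rewrite !(mulmxBl, mulmxBr) !mulmxA addrA subrK.
  apply: (le_trans (ler_normD _ _)); rewrite -natr1 mulrDl mul1r lerD //.
    by apply: IH; [exact: ltnW | exact: GM].
  have eC : `|e (j%:R * w)| <= C by have := hC _ (ejw j (ltnW jm)); rewrite normr_id.
  have h1 : `|(g - e w) *m e (j%:R * w)| <= n%:R * (2 * k * w) * C.
    apply: (le_trans (mulmx_norm_le _ _)).
    by apply: ler_pM => //; rewrite ler_wpM2l.
  apply: (le_trans (mulmx_norm_le _ _)).
  have -> : n%:R * n%:R * C * (2 * k * w) = n%:R * 1 * (n%:R * (2 * k * w) * C) by ring.
  apply: ler_pM => //.
  by rewrite ler_wpM2l // (group_norm_le1 hG Ga).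
exists (gp m); split; first exact: Ggp.
apply: rB; rewrite -ball_normE /ball_ /=.
have := tel m (leqnn m) 1%:M G1; rewrite mul1mx => h.
have h' := hd2 _ smw.
have -> : e s - gp m = (e s - e (m%:R * w)) - (gp m - e (m%:R * w)) by rewrite opprB addrA subrK.
apply: (le_lt_trans (ler_normB _ _)).
suff h2 : m%:R * (n%:R * n%:R * C * (2 * k * w)) < r / 2 by lra.
have -> : m%:R * (n%:R * n%:R * C * (2 * k * w)) = 2 * k * (n%:R * n%:R * C * (m%:R * w)) by ring.
apply: (@le_lt_trans _ _ (2 * k * (n%:R * n%:R * C * s))).
  apply: ler_wpM2l; first by rewrite mulr_ge0 // ltW.
  by apply: ler_wpM2l => //; rewrite !mulr_ge0 // ltW.
apply: (@lt_trans _ _ (2 * k * K)).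
  have k20 : 0 < 2 * k by rewrite mulr_gt0.
  by rewrite (ltr_pM2l k20) /K ltrDl.
by rewrite /k -mulrA mulfVK ?gt_eqF //; lra.
Qed.

(** Otherwise there are g_k tending to 1 whose unit directions stay away from the fixed space of
    [pi]. By compactness these directions accumulate at some Y, which lies in [gg] by the previous
    lemma, so [pi Y = Y]: a contradiction. *)
Lemma tangent_estimate G gg (pi : 'End(M)) : compact_lie_group G -> lie_algebra_of G gg ->
  (forall X, X \in gg -> pi X = X) -> forall eps : R, 0 < eps ->
  exists2 d : R, 0 < d & forall g, G g -> `|g - 1%:M| < d ->
    `|g - 1%:M - pi (g - 1%:M)| <= eps * `|g - 1%:M|.
Proof.
move=> hG hg pi1 eps eps0; apply: contrapT => no.
have ex (k : nat) : exists g, [/\ G g, `|g - 1%:M| < k.+1%:R^-1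
     & eps * `|g - 1%:M| < `|g - 1%:M - pi (g - 1%:M)|].
  apply: contrapT => h; apply: no; exists k.+1%:R^-1 => [|g Gg gk]; first by rewrite invr_gt0.
  by rewrite leNgt; apply/negP => gt; apply: h; exists g.
have [g hgk] := choice ex.
pose W k := g k - 1%:M.
have W0 k : 0 < `|W k|.
  rewrite normr_gt0; apply/negP => /eqP W0; have [_ _] := hgk k.
  by rewrite -/(W k) W0 linear0 subrr normr0 mulr0 ltxx.
pose X k := `|W k|^-1 *: W k.
have X1 k : `|X k| = 1 by rewrite normrZ normfV normr_id mulVf // gt_eqF.
have cpt : compact [set Y : M | `|Y| = 1].
  apply: (@mx_bounded_closed_compact _ _ _ _ 1) => [Y ->//|].
  rewrite (_ : mkset _ = (fun Y : M => `|Y|) @^-1` [set 1]) //.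
  apply: closed_comp => [Y _|]; first exact: norm_continuous.
  by apply: accessible_closed_set1; apply: hausdorff_accessible; exact: norm_hausdorff.
have [Y [/= Y1 cl]] := cpt (X @ \oo) _ (filterE _ X1).
have {cl} near_Y (d : R) : 0 < d -> exists2 k : nat, k.+1%:R^-1 < d & `|X k - Y| < d.
  move=> d0; have [N hN] : exists N : nat, forall k, (N <= k)%N -> k.+1%:R^-1 < d.
    exists (Num.truncn d^-1) => k Nk; rewrite invf_plt ?posrE //.
    have /andP[_] : (Num.truncn d^-1)%:R <= d^-1 < (Num.truncn d^-1).+1%:R by rewrite truncn_itv ?invr_ge0 ?ltW.
    by move/lt_le_trans; apply; rewrite ler_nat.
  have [Z [[k /= Nk <-] hZ]] := cl (X @` [set k | (N <= k)%N]) (ball Y d)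
     (filterS (fun k h => ex_intro2 _ _ k h erefl) (nbhs_infty_ge N)) (nbhsx_ballx Y d d0).
  exists k; first exact: hN.
  by rewrite distrC; move: hZ; rewrite -ball_normE.
have Ygg : Y \in gg.
  apply: (lie_algebra_accumulation hG hg) => d d0.
  have [k kd XY] := near_Y d d0; have [Gk gk _] := hgk k.
  exists (g k); split=> //; [exact: W0 | exact: lt_trans kd |].
  rewrite -/(W k).
  have -> : W k - `|W k| *: Y = `|W k| *: (X k - Y).
    by rewrite scalerBr scalerA mulfV ?gt_eqF // scale1r.
  by rewrite normrZ normr_id mulrC ler_wpM2r // ltW.
have hc : mcvg (nbhs Y) (fun t => t - pi t) (Y - pi Y).
  have h := cvg_mx_entry Y.
  by apply: mcvgD => //; apply: mcvgN; exact: (mcvg_lin pi h).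
have [d d0 hd] := @mcvg_near M Y _ _ hc eps eps0.
have [k _ XY] := near_Y d d0; rewrite distrC in XY.
have := hd _ XY; rewrite pi1 // subrr sub0r normrN.
have [_ _] := hgk k; rewrite -/(W k) /X linearZ /= -scalerBr normrZ normfV normr_id.
rewrite -ltr_pdivlMr ?W0 // mulrC => h1 h2.
by have := lt_trans h1 h2; rewrite ltxx.
Qed.

End TangentEstimate.

(** * Lengths of curves and their concatenations *)

Section CurveLength.
Variables (R : realType) (n : nat).
Local Notation M := 'M[R]_n.
Implicit Types (G : set M) (q : M -> M -> R) (c : R -> M).

(** Only semidefinite: the metrics are pulled back to the Lie algebra of G and vanish along the
    isotropy directions. *)
Definition psd_form q : Prop := symform q /\ forall X, 0 <= q X X.

Definition qnorm q (X : M) : R := Num.sqrt (q X X).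

Definition body_velocity c (s : R) : M := invmx (c s) *m velocity c s.

Local Notation I01 := (`[0%R, 1%R]%classic : set R).

Lemma qnormZ q a X : psd_form q -> qnorm q (a *: X) = `|a| * qnorm q X.
Proof.
move=> [hq q0]; rewrite /qnorm (symformZl hq) (symformZr hq) mulrA -expr2.
by rewrite sqrtrM ?sqr_ge0 // sqrtr_sqr.
Qed.

(** On [0, 1] the curve lies in G, so there its inverse is its transpose, and the speed written with
    the transpose is continuous on the whole line. *)
Lemma speed_integrable G q c : compact_lie_group G -> psd_form q -> C1_curve c ->
  (forall s, 0 <= s <= 1 -> G (c s)) ->
  lebesgue_measure.-integrable I01 (EFin \o (fun s => qnorm q (body_velocity c s))).
Proof.
move=> hG [hq q0] hc Gc.
pose f s := qnorm q ((c s)^T *m velocity c s).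
have fi : lebesgue_measure.-integrable I01 (EFin \o f).
  apply: continuous_compact_integrable; first exact: segment_compact.
  suff fc (s : R) : f t @[t --> s] --> f s by apply: continuous_subspaceT => s; exact: fc.
  have hcs : mcvg (nbhs (s : R)) c (c s) by move=> i j; exact: C1_curve_continuous.
  have hvs : mcvg (nbhs (s : R)) (velocity c) (velocity c s).
    by move=> i j; exact: velocity_continuous.
  have hct : mcvg (nbhs (s : R)) (fun u => (c u)^T) (c s)^T.
    by move=> i j; rewrite mxE; under eq_fun do rewrite mxE; exact: hcs.
  have h : mcvg (nbhs s) (fun t => (c t)^T *m velocity c t) ((c s)^T *m velocity c s).
    exact: mcvg_mul.
  have h' : q ((c t)^T *m velocity c t) ((c t)^T *m velocity c t) @[t --> s] -->
            q ((c s)^T *m velocity c s) ((c s)^T *m velocity c s).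
    exact: symform_cvg.
  by apply: (cvg_comp _ _ h'); exact: sqrt_continuous.
apply: eq_integrable fi => // s; rewrite inE /= in_itv /= => s01.
by rewrite /f /body_velocity (group_invmx hG (Gc s s01)).
Qed.

Lemma curve_length_ge0 q c : 0 <= curve_length q c.
Proof. by apply: Rintegral_ge0 => s _; exact: sqrtr_ge0. Qed.

Lemma integrable_scale (f : R -> R) (a : R) :
  lebesgue_measure.-integrable I01 (EFin \o f) ->
  lebesgue_measure.-integrable I01 (EFin \o (fun s => a * f s)).
Proof.
move=> h.
rewrite [X in integrable _ _ X](_ : _ = (fun s => a%:E * (EFin \o f) s)%E) //.
exact: integrableZl.
Qed.

Lemma curve_length_le G q q1 q2 c (a b : R) : compact_lie_group G ->
  psd_form q -> psd_form q1 -> psd_form q2 -> C1_curve c ->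
  (forall s, 0 <= s <= 1 -> G (c s)) ->
  (forall X, qnorm q X <= a * qnorm q1 X + b * qnorm q2 X) ->
  curve_length q c <= a * curve_length q1 c + b * curve_length q2 c.
Proof.
move=> hG hq hq1 hq2 hc Gc h.
have i1 := speed_integrable hG hq1 hc Gc; have i2 := speed_integrable hG hq2 hc Gc.
have j1 : lebesgue_measure.-integrable I01 (EFin \o (fun s => a * qnorm q1 (body_velocity c s))).
  exact: integrable_scale.
have j2 : lebesgue_measure.-integrable I01 (EFin \o (fun s => b * qnorm q2 (body_velocity c s))).
  exact: integrable_scale.
rewrite /curve_length -RintegralZl // -RintegralZl // -RintegralD //.
have i0 := speed_integrable hG hq hc Gc.
apply: le_Rintegral => //; last by move=> s _; exact: h.
exact: (integrableD _ j1 j2).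
Qed.

Lemma curve_length_le_cst G q c (k : R) : compact_lie_group G ->
  psd_form q -> C1_curve c -> (forall s, 0 <= s <= 1 -> G (c s)) ->
  (forall s, 0 <= s <= 1 -> qnorm q (body_velocity c s) <= k) ->
  curve_length q c <= k.
Proof.
move=> hG hq hc Gc h.
have -> : k = \int[lebesgue_measure]_(s in I01) k.
  have m1 : lebesgue_measure I01 = 1%E.
    by rewrite lebesgue_measure_itv /= lte_fin ltr01 oppr0 adde0.
  transitivity (k * fine (lebesgue_measure I01)); first by rewrite m1 /= mulr1.
  by symmetry; apply: Rintegral_cst.
have i0 := speed_integrable hG hq hc Gc.
apply: le_Rintegral => //.
  apply: (@continuous_compact_integrable R (fun=> k)); first exact: segment_compact.
  by apply: continuous_subspaceT => s; exact: cvg_cst.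
Qed.

Lemma velocity_mull (a : M) c : C1_curve c -> forall s,
  mderiv (fun s => a *m c s) s (a *m velocity c s).
Proof. by move=> hc s; apply: mderiv_mull; exact: C1_curve_mderiv. Qed.

Lemma C1_curve_mull (a : M) c : C1_curve c -> C1_curve (fun s => a *m c s).
Proof.
move=> hc; apply: (C1_curveP (velocity_mull a hc)) => s.
apply: mcvg_mul; first exact: mcvg_cst.
by move=> i j; exact: velocity_continuous.
Qed.

Lemma curve_length_mull G q a c : compact_lie_group G -> G a -> C1_curve c ->
  (forall s, 0 <= s <= 1 -> G (c s)) ->
  curve_length q (fun s => a *m c s) = curve_length q c.
Proof.
move=> hG Ga hc Gc; apply: eq_Rintegral => s; rewrite inE /= in_itv /= => s01.
have [_ _ GM _ _] := hG.
rewrite (velocity_unique (velocity_mull a hc s)).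
rewrite (group_invmx hG (Gc s s01)) (group_invmx hG (GM _ _ Ga (Gc s s01))).
by rewrite trmx_mul mulmxA -(mulmxA _ a^T) (group_trK hG Ga) mulmx1.
Qed.

Section Joined.
Variable G : set M.
Hypothesis hG : compact_lie_group G.

Lemma joined_ge0 q a b l : joined G q a b l -> 0 <= l.
Proof. by elim=> // c l' _ _ _ h; rewrite addr_ge0 // curve_length_ge0. Qed.

Lemma joined_trans q a b d l1 l2 : joined G q a b l1 -> joined G q b d l2 ->
  joined G q a d (l1 + l2).
Proof.
move=> h1; elim=> [Gb|c l hc Gc _ IH]; first by rewrite addr0.
by rewrite addrA; exact: joined_step.
Qed.

Lemma joined_mull q g a b l : G g -> joined G q a b l -> joined G q (g *m a) (g *m b) l.
Proof.
move=> Gg; have [_ _ GM _ _] := hG.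
elim=> [Ga|c l' hc Gc _ IH]; first by apply: joined_refl; exact: GM.
rewrite -(curve_length_mull q hG Gg hc Gc).
apply: (@joined_step _ _ _ _ _ (fun s => g *m c s)) => //; first exact: C1_curve_mull.
by move=> s s01; apply: GM => //; exact: Gc.
Qed.

Lemma joined_sub (G' : set M) q a b l : G `<=` G' -> joined G q a b l -> joined G' q a b l.
Proof.
move=> sub; elim=> [Ga|c l' hc Gc _ IH]; first by apply: joined_refl; exact: sub.
by apply: joined_step => // s s01; apply: sub; exact: Gc.
Qed.

(** L is the q1-length of the very curves that realise l. It is fixed before u, v and q, so one path
    serves all metrics x1, x2 at once. *)
Lemma joined_le q0 q1 a b l : psd_form q0 -> psd_form q1 -> joined G q0 a b l ->
  exists2 L : R, 0 <= L & forall (u v : R) q, psd_form q -> 0 <= v ->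
    (forall X, qnorm q X <= u * qnorm q0 X + v * qnorm q1 X) ->
    exists2 l', l' <= u * l + v * L & joined G q a b l'.
Proof.
move=> h0 h1; elim=> [Ga|c l' hc Gc _ [L L0 IH]].
  by exists 0 => // u v q _ _ _; exists 0; rewrite ?mulr0 ?addr0 //; exact: joined_refl.
exists (L + curve_length q1 c) => [|u v q hq v0 h]; first by rewrite addr_ge0 // curve_length_ge0.
have [l'' le j] := IH u v q hq v0 h.
exists (l'' + curve_length q c); last exact: joined_step.
have := curve_length_le hG hq h0 h1 hc Gc h; rewrite !mulrDr; lra.
Qed.

End Joined.

End CurveLength.

(** * Short arcs to all group elements near 1 *)

Section LocalArcs.
Variables (R : realType) (n : nat).
Local Notation M := 'M[R]_n.
Implicit Types (G : set M) (gg : {vspace M}) (q : M -> M -> R).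

Lemma body_velocity_mem G gg (c : R -> M) s : compact_lie_group G -> lie_algebra_of G gg ->
  C1_curve c -> (forall s, G (c s)) -> body_velocity c s \in gg.
Proof.
move=> hG hg hc Gc; have [_ G1 GM _ _] := hG; apply/hg.
exists (fun u => (c s)^T *m c (u + s)).
have hd (u : R) : mderiv (fun u => (c s)^T *m c (u + s)) u ((c s)^T *m velocity c (u + s)).
  apply: mderiv_mull; rewrite -[velocity _ _]scale1r.
  exact: mderiv_comp (@is_derive_addc R s u) (C1_curve_mderiv _ hc).
split.
- apply: (C1_curveP hd) => u; apply: mcvg_mul; first exact: mcvg_cst.
  move=> i j.
  have hv (v : R) : velocity c t i j @[t --> v] --> velocity c v i j.
    exact: velocity_continuous.
  apply: (@cvg_comp _ _ _ (fun v : R => v + s) (fun v => velocity c v i j)).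
    by apply: cvgD; [exact: cvg_id | exact: cvg_cst].
  exact: hv.
- by move=> u; apply: GM => //; exact: group_trV.
- by rewrite add0r (group_trK hG).
- by rewrite (velocity_unique (hd 0)) add0r /body_velocity (group_invmx hG).
Qed.

(* F is strictly differentiable at 0 with derivative L, and F 0 = 1. *)
Definition sdiff G (F L : M -> M) : Prop :=
  [/\ F 0 = 1%:M, forall X, G (F X), forall X, mcvg (nbhs X) F (F X),
      exists2 C : R, 0 <= C & forall X, `|L X| <= C * `|X|
    & forall k : R, 0 < k -> exists2 d : R, 0 < d & forall X Y, `|X| < d -> `|Y| < d ->
        `|F X - F Y - L (X - Y)| <= k * `|X - Y|].

Lemma sdiff_near1 G F L : sdiff G F L -> L 0 = 0 -> forall k : R, 0 < k ->
  exists2 d : R, 0 < d & forall X, `|X| < d -> `|F X - 1%:M| <= k.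
Proof.
move=> [F0 _ _ [C C0 hC] hd] L0 k k0; have [d d0 {}hd] := hd 1 ltr01.
have C1 : 0 < 1 + C by rewrite ltr_wpDr.
exists (Num.min d (k / (1 + C))) => [|X]; first by rewrite lt_min d0 divr_gt0.
rewrite lt_min => /andP[Xd Xk]; have := hd X 0 Xd; rewrite normr0 => /(_ d0).
rewrite subr0 F0 mul1r => h; have h2 := hC X.
have -> : F X - 1%:M = (F X - 1%:M - L X) + L X by rewrite subrK.
apply: (le_trans (ler_normD _ _)).
by move: Xk; rewrite ltr_pdivlMr // => Xk; lra.
Qed.

(** The product rule at 0, where both factors are 1, so that the derivatives simply add. *)
Lemma sdiff_mul G F1 L1 F2 L2 : compact_lie_group G -> L1 0 = 0 -> L2 0 = 0 ->
  sdiff G F1 L1 -> sdiff G F2 L2 ->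
  sdiff G (fun X => F1 X *m F2 X) (fun X => L1 X + L2 X).
Proof.
move=> hG L10 L20 h1 h2; have [_ _ GM _ _] := hG.
have [F10 F1G F1c [C1 C10 hC1] d1] := h1; have [F20 F2G F2c [C2 C20 hC2] d2] := h2.
split.
- by rewrite F10 F20 mulmx1.
- by move=> X; exact: GM.
- by move=> X; exact: mcvg_mul.
- exists (C1 + C2) => [|X]; first exact: addr_ge0.
  by apply: (le_trans (ler_normD _ _)); rewrite mulrDl lerD.
move=> k k0; set N : R := n%:R.
have F1n X := group_norm_le1 hG (F1G X); have F2n X := group_norm_le1 hG (F2G X).
have N0 : 0 <= N by [].
pose K := (N + 1) * (2 + C1 + C2).
have K0 : 0 < K by rewrite /K; apply: mulr_gt0; lra.
have kK0 : 0 < k / K by rewrite divr_gt0.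
have [e1 e10 he1] := d1 _ kK0; have [e2 e20 he2] := d2 _ kK0.
have [e3 e30 he3] := sdiff_near1 h1 L10 kK0; have [e4 e40 he4] := sdiff_near1 h2 L20 kK0.
exists (Num.min (Num.min e1 e2) (Num.min e3 e4)) => [|X Y].
  by rewrite !lt_min e10 e20 e30.
rewrite !lt_min => /andP[/andP[X1 X2] /andP[X3 X4]] /andP[/andP[Y1 Y2] /andP[Y3 Y4]].
set D := X - Y.
(* Each of the four products contains either a remainder or a difference from 1, which is at most k
   / K times its natural size, against a bounded factor. K is chosen to absorb the sum of the
   bounds. *)
have -> : F1 X *m F2 X - F1 Y *m F2 Y - (L1 D + L2 D) =
   (F1 X - F1 Y - L1 D) *m F2 X + L1 D *m (F2 X - 1%:M) +
   (F1 Y *m (F2 X - F2 Y - L2 D) + (F1 Y - 1%:M) *m L2 D).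
  rewrite !(mulmxBl, mulmxBr, mulmx1, mul1mx).
  set a := F1 X *m _; set b := F1 Y *m F2 X; set c := F1 Y *m F2 Y; set e := F1 Y *m _.
  by set f := L1 D *m _; apply/matrixP => i j; rewrite !mxE; ring.
have D0 := normr_ge0 D; have kK := ltW kK0.
have m1 : `|(F1 X - F1 Y - L1 D) *m F2 X| <= N * (k / K * `|D|) * 1.
  by apply: (le_trans (mulmx_norm_le _ _)); rewrite ler_pM ?mulr_ge0 // ler_wpM2l // he1.
have m2 : `|L1 D *m (F2 X - 1%:M)| <= N * (C1 * `|D|) * (k / K).
  by apply: (le_trans (mulmx_norm_le _ _)); rewrite ler_pM ?mulr_ge0 // ?ler_wpM2l // he4.
have m3 : `|F1 Y *m (F2 X - F2 Y - L2 D)| <= N * 1 * (k / K * `|D|).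
  by apply: (le_trans (mulmx_norm_le _ _)); rewrite ler_pM ?mulr_ge0 // ?ler_wpM2l // he2.
have m4 : `|(F1 Y - 1%:M) *m L2 D| <= N * (k / K) * (C2 * `|D|).
  by apply: (le_trans (mulmx_norm_le _ _)); rewrite ler_pM ?mulr_ge0 // ?ler_wpM2l // he3.
apply: (le_trans (ler_normD _ _)).
apply: (@le_trans _ _ (N * (2 + C1 + C2) * (k / K) * `|D|)).
  apply: (le_trans (lerD (ler_normD _ _) (ler_normD _ _))).
  apply: (le_trans (lerD (lerD m1 m2) (lerD m3 m4))).
  by rewrite le_eqVlt; apply/orP; left; apply/eqP; ring.
rewrite ler_wpM2r // mulrCA ler_piMr ?(ltW k0) //.
by rewrite ler_pdivrMr // mul1r /K ler_wpM2r ?addr_ge0 // lerDl.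
Qed.

Lemma scalar_bound (f : {scalar M}) : exists2 C : R, 0 <= C & forall X, `|f X| <= C * `|X|.
Proof.
exists (\sum_i \sum_j `|f (delta_mx i j)|) => [|X].
  by apply: sumr_ge0 => i _; apply: sumr_ge0.
rewrite {1}(matrix_sum_delta X) linear_sum mulr_suml.
apply: (le_trans (ler_norm_sum _ _ _)); apply: ler_sum => i _.
rewrite linear_sum mulr_suml; apply: (le_trans (ler_norm_sum _ _ _)); apply: ler_sum => j _.
by rewrite linearZ normrM mulrC ler_wpM2l // mx_entry_le.
Qed.

Lemma sdiff_curve G (c : R -> M) (f : {scalar M}) : compact_lie_group G -> C1_curve c ->
  (forall s, G (c s)) -> c 0 = 1%:M ->
  sdiff G (fun X => c (f X)) (fun X => f X *: velocity c 0).
Proof.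
move=> hG hc Gc c0; have [C C0 hC] := scalar_bound f.
split.
- by rewrite linear0.
- by move=> X; exact: Gc.
- move=> X i j; have hcs (v : R) : c t i j @[t --> v] --> c v i j.
    exact: C1_curve_continuous.
  apply: (@cvg_comp _ _ _ (fun Y : M => f Y) (fun v => c v i j)); last exact: hcs.
  apply/cvgrPdist_lt => e e0; apply/nbhs_ballP; exists (e / (C + 1)) => /=.
    by rewrite divr_gt0 // ltr_wpDl.
  move=> Y; rewrite -ball_normE /ball_ /= ltr_pdivlMr ?ltr_wpDl // => h.
  rewrite -linearB; apply: (le_lt_trans (hC _)); apply: le_lt_trans h.
  by rewrite mulrC ler_wpM2l // lerDl.
- exists (C * `|velocity c 0|) => [|X]; first by rewrite mulr_ge0.
  by rewrite normrZ mulrAC ler_wpM2r.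
move=> k k0; have kC0 : 0 < k / (C + 1) by rewrite divr_gt0 // ltr_wpDl.
have C10 : 0 < C + 1 by rewrite ltr_wpDl.
have [d d0 hd] := C1_curve_strict hc kC0.
have small (X : M) : `|X| < d / (C + 1) -> `|f X| < d.
  rewrite ltr_pdivlMr // => h; apply: (le_lt_trans (hC _)); apply: le_lt_trans h.
  by rewrite mulrC ler_wpM2l // lerDl.
exists (d / (C + 1)) => [|X Y Xd Yd]; first by rewrite divr_gt0.
rewrite linearB; apply: (le_trans (hd _ _ (small X Xd) (small Y Yd))).
rewrite -linearB -mulrA ler_wpM2l ?(ltW k0) // mulrC ler_pdivrMr // mulrC.
by rewrite mulrDl mul1r; apply: ler_wpDr => //; rewrite mulrC.
Qed.

Section Arcs.
Variables (G : set M) (gg : {vspace M}).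
Hypotheses (hG : compact_lie_group G) (hg : lie_algebra_of G gg).

(** The arc s -> c(xs) on [0, 1] has its speed multiplied by |x|. K depends on the curve alone; the
    form q enters only through its bound m on [gg]. *)
Lemma lie_algebra_arc (c : R -> M) : C1_curve c -> (forall s, G (c s)) -> c 0 = 1%:M ->
  exists2 K : R, 0 <= K & forall (x : R) q (m : R), `|x| <= 1 -> psd_form q -> 0 <= m ->
    (forall X, X \in gg -> qnorm q X <= m * `|X|) ->
    exists2 l, l <= m * K * `|x| & joined G q 1%:M (c x) l.
Proof.
move=> hc Gc c0.
have cv (t : R) : -1 <= t <= 1 -> {for t, continuous (fun s => `|velocity c s|)}.
  move=> _; apply: cvg_norm; apply: (mcvgP _ _).1.
  by move=> i j; exact: velocity_continuous.
have [K K0 hK] := bounded_on_segment (ltW (gtrN ltr01) : -1 <= 1 :> R) cv.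
exists (n%:R * K) => [|x q m x1 hq m0 hm]; first by rewrite mulr_ge0 // ltW.
pose b s := c (x * s).
have hb (s : R) : mderiv b s (x *: velocity c (x * s)).
  apply: mderiv_comp (C1_curve_mderiv _ hc).
  by have := is_derive_scale x (is_derive_ident s); rewrite mulr1.
have Cb : C1_curve b.
  apply: (C1_curveP hb) => s; apply: mcvgZ; first exact: cvg_cst.
  move=> i j; have hv (v : R) : velocity c t i j @[t --> v] --> velocity c v i j.
    exact: velocity_continuous.
  apply: (@cvg_comp _ _ _ (fun v : R => x * v) (fun v => velocity c v i j)); last exact: hv.
  by apply: cvgM; [exact: cvg_cst | exact: cvg_id].
have Gb s : 0 <= s <= 1 -> G (b s) by move=> _; exact: Gc.
exists (0 + curve_length q b); last first.
  rewrite -[x]mulr1; apply: (@joined_step _ _ G q _ b) => //.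
  by rewrite /b mulr0 c0; apply: joined_refl; case: hG.
rewrite add0r; apply: (curve_length_le_cst hG hq Cb Gb) => s /andP[s0 s1].
have -> : body_velocity b s = x *: body_velocity c (x * s).
  by rewrite /body_velocity (velocity_unique (hb s)) scalemxAr.
rewrite qnormZ // mulrC ler_wpM2r //.
apply: (le_trans (hm _ (body_velocity_mem _ hG hg hc Gc))); rewrite ler_wpM2l //.
rewrite /body_velocity (group_invmx hG (Gc _)).
apply: (le_trans (mulmx_norm_le _ _)); rewrite -mulrA ler_wpM2l //.
have h1 : `|(c (x * s))^T| <= 1 by rewrite mxtr_norm; exact: group_norm_le1 hG (Gc _).
have xs : -1 <= x * s <= 1.
  rewrite -ler_norml normrM; apply: mulr_ile1 => //.
  by rewrite ger0_norm.
have := hK _ xs; rewrite normr_id => h2.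
by rewrite -[K]mul1r; apply: ler_pM.
Qed.

(* Minimise |h - sig X| for X near 0 in the Lie algebra.  By the tangent estimate
   the residual is almost tangent to the group, so moving X by its projection
   would shrink it unless it vanishes. *)
Lemma local_arcs (eta : R) : 0 < eta ->
  exists2 d : R, 0 < d & forall h, G h -> `|h - 1%:M| < d ->
    forall q (m : R), psd_form q -> 0 <= m ->
      (forall X, X \in gg -> qnorm q X <= m * `|X|) ->
      exists2 l, l <= m * eta & joined G q 1%:M h l.
Proof.
move=> eta0; have [Gcl G1 GM _ _] := hG.
have [pi [pi_in pi_id _]] := orth_proj gg.
have ex (i : 'I_(\dim gg)) : exists c : R -> M,
    [/\ C1_curve c, forall s, G (c s), c 0 = 1%:M & velocity c 0 = (vbasis gg)`_i].
  by apply/hg; rewrite vbasis_mem // mem_nth // size_tuple.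
have [cc hcc] := choice ex.
(* Coordinates of the second kind: [sig] multiplies curves with the basis vectors as velocities, run
   for times equal to the coordinates of [pi X]. Its derivative [lin] at 0 is therefore [pi]. *)
pose phi i : {scalar M} := coord (vbasis gg) i \o pi.
pose sig r X : M := foldr (fun i a => cc i (phi i X) *m a) 1%:M r.
pose lin r X : M := foldr (fun i a => phi i X *: velocity (cc i) 0 + a) 0 r.
have phi0 i : phi i 0 = 0 by exact: linear0.
have lin0 r : lin r 0 = 0.
  elim: r => [//|i r IH].
  by rewrite -[LHS]/(phi i 0 *: velocity (cc i) 0 + lin r 0) IH phi0 scale0r addr0.
have hsig r : sdiff G (sig r) (lin r).
  elim: r => [|i r IH] /=.
    split=> //; first by move=> X; exact: mcvg_cst.
      by exists 0 => // X; rewrite normr0 mul0r.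
    by move=> k k0; exists 1 => // X Y _ _; rewrite subrr subr0 normr0 mulr_ge0 // ltW.
  have [h1 h2 h3 _] := hcc i.
  apply: (@sdiff_mul G (fun X => cc i (phi i X)) (fun X => phi i X *: velocity (cc i) 0)
     (sig r) (lin r)) => //; first by rewrite -[LHS]/(phi i 0 *: velocity (cc i) 0) phi0 scale0r.
  exact: sdiff_curve.
pose r := enum 'I_(\dim gg).
have linE X : lin r X = pi X.
  rewrite (coord_vbasis (pi_in X)).
  have -> : lin r X = \sum_(i <- r) phi i X *: velocity (cc i) 0.
    by elim: (r) => [|i r' IH]; rewrite ?big_nil // big_cons -IH.
  rewrite /r big_enum /=; apply: eq_bigr => i _.
  by have [_ _ _ ->] := hcc i.
have arcs s : exists2 K : R, 0 <= K & exists2 e : R, 0 < e & forall X, `|X| < e ->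
    forall q (m : R), psd_form q -> 0 <= m -> (forall X, X \in gg -> qnorm q X <= m * `|X|) ->
    exists2 l, l <= m * (K * `|X|) & joined G q 1%:M (sig s X) l.
  elim: s => [|i s [K K0 [e e0 IH]]].
    exists 0 => //; exists 1 => // X _ q m _ _ _.
    by exists 0; [rewrite mul0r mulr0 | exact: joined_refl].
  have [h1 h2 h3 _] := hcc i.
  have [K1 K10 hK1] := lie_algebra_arc h1 h2 h3.
  have [C C0 hC] := scalar_bound (phi i).
  have C10 : 0 < C + 1 by rewrite ltr_wpDl.
  exists (K1 * C + K); first by rewrite addr_ge0 // mulr_ge0.
  exists (Num.min e (C + 1)^-1) => [|X]; first by rewrite lt_min e0 invr_gt0.
  rewrite lt_min => /andP[Xe X1] q m hq m0 hm.
  have p1 : `|phi i X| <= 1.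
    apply: (le_trans (hC X)); rewrite mulrC.
    move: X1; rewrite -[ltRHS]mul1r ltr_pdivlMr // mulrDr mulr1 => X1.
    by have := normr_ge0 X; lra.
  have [l1 hl1 j1] := hK1 _ q m p1 hq m0 hm.
  have [l2 hl2 j2] := IH X Xe q m hq m0 hm.
  exists (l1 + l2); last first.
    apply: (joined_trans j1).
    by have := joined_mull hG (h2 (phi i X)) j2; rewrite mulmx1.
  rewrite mulrDl mulrDr lerD // (le_trans hl1) // -mulrA ler_wpM2l // -mulrA ler_wpM2l //.
have [K K0 [e1 e10 hK]] := arcs r.
pose N : R := n%:R; have N0 : 0 <= N by [].
pose k : R := (8 * (N + 1))^-1.
have N1 : 0 < N + 1 by rewrite ltr_wpDl.
have k0 : 0 < k by rewrite invr_gt0 mulr_gt0.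
have kN : k * (N + 1) = 8^-1 by rewrite /k invfM mulrVK // unitfE gt_eqF.
have [s10 sG sC _ sd] := hsig r.
have [r0 r00 hr0] := sd k k0.
have [d1 d10 hd1] := tangent_estimate hG hg pi_id k0.
pose rho := Num.min (Num.min (e1 / 2) (r0 / 2)) (eta / (K + 1)).
have K1 : 0 < K + 1 by rewrite ltr_wpDl.
have rho0 : 0 < rho by rewrite !lt_min !divr_gt0.
have [rho1 rho2 rho3] : [/\ rho <= e1 / 2, rho <= r0 / 2 & rho <= eta / (K + 1)].
  by split; rewrite /rho !ge_min lexx ?orbT.
(* The three bounds keep the residual in the range of the tangent estimate, keep the corrected point
   in the ball of radius rho, and leave at most 1/2 to the first contribution to the contraction
   factor. The others give at most 3/8 by the choice of k. *)
pose d := Num.min (d1 / (N + 1)) (Num.min (rho / (4 + 2 * N)) (4 * (N + 1) ^+ 2)^-1).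
have N42 : 0 < 4 + 2 * N by rewrite ltr_wpDr // mulr_ge0.
have d0 : 0 < d by rewrite !lt_min !divr_gt0 //= invr_gt0 mulr_gt0 // exprn_gt0.
have dd1 : N * d < d1.
  have : d <= d1 / (N + 1) by rewrite /d ge_min lexx.
  by rewrite ler_pdivlMr // mulrDr mulr1 [d * N]mulrC => h; lra.
have drho : 4 * d + 2 * (N * d) <= rho.
  have : d <= rho / (4 + 2 * N) by rewrite /d !ge_min lexx ?orbT.
  by rewrite ler_pdivlMr //; congr (_ <= _); ring.
have dN : 2 * N * d * N <= 2^-1.
  have : d <= (4 * (N + 1) ^+ 2)^-1 by rewrite /d !ge_min lexx ?orbT.
  rewrite -[X in _ <= X]mul1r ler_pdivlMr ?mulr_gt0 ?exprn_gt0 // => h.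
  have h2 : 0 <= d * (2 * N + 1) by rewrite mulr_ge0 ?(ltW d0) // addr_ge0 // mulr_ge0.
  have : d * (4 * (N + 1) ^+ 2) = 2 * (2 * N * d * N) + 4 * (d * (2 * N + 1)) by ring.
  lra.
have [kN1 k8] : k * N <= 8^-1 /\ k <= 8^-1.
  have : 0 <= k * N by rewrite mulr_ge0 // ltW.
  by move: kN; rewrite mulrDr mulr1; lra.
clear kN N42 arcs d10; clearbody d rho k.
exists d => // h Gh hd q m hq m0 hm.
pose A := [set X : M | `|X| <= rho /\ pi X - X = 0].
have Apt : compact A.
  apply: (@mx_bounded_closed_compact _ _ _ _ rho) => [X [] //|].
  have pc (X : M) : pi t - t @[t --> X] --> pi X - X.
    have hX := cvg_mx_entry X.
    have h1 : mcvg (nbhs X) (fun t => pi t - t) (pi X - X).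
      by apply: mcvgD; [exact: (mcvg_lin pi hX) | exact: (mcvgN hX)].
    exact: (mcvgP _ _).1 h1.
  have -> : A = (fun X : M => `|X|) @^-1` [set x | x <= rho] `&`
    (fun X : M => pi X - X) @^-1` [set 0] by [].
  apply: closedI; apply: closed_comp => [X _|].
  - exact: norm_continuous.
  - exact: closed_le.
  - exact: pc.
  - apply: accessible_closed_set1; apply: hausdorff_accessible; exact: norm_hausdorff.
have A0 : A 0 by rewrite /A /= normr0 linear0 subrr; split=> //; exact: ltW.
have fc (X : M) : `|h - sig r t| @[t --> X] --> `|h - sig r X|.
  have h1 : mcvg (nbhs X) (fun t => h - sig r t) (h - sig r X).
    by apply: mcvgD; [exact: mcvg_cst | exact: mcvgN (sC X)].
  have h2 : h - sig r t @[t --> X] --> h - sig r X by exact: (mcvgP _ _).1 h1.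
  exact: (cvg_norm h2).
have [X XA Xmin] : exists2 X, X \in A & forall Y, Y \in A -> `|h - sig r X| <= `|h - sig r Y|.
  apply: compact_EVT_min => //; first by exists 0.
  by apply: continuous_subspaceT => X; exact: fc.
move: XA; rewrite inE => -[Xrho /eqP]; rewrite subr_eq0 => /eqP piX.
set s := sig r X in Xmin *.
have Gs : G s by exact: sG.
(* X = 0 competes in the minimisation, with value |h - 1|. *)
have f0 : `|h - s| < d.
  by apply: le_lt_trans hd; rewrite -s10; apply: Xmin; rewrite inE.
have Xr0 : `|X| < r0 by clear -Xrho rho2 r00; lra.
have s1 : `|s - 1%:M| <= 2 * d.
  have -> : s - 1%:M = (h - 1%:M) - (h - s) by rewrite opprB [RHS]addrC addrA subrK.
  by apply: (le_trans (ler_normB _ _)); clear -f0 hd; lra.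
have X4 : `|X| <= 4 * d.
  have := hr0 X 0; rewrite normr0 => /(_ Xr0 r00); rewrite subr0 linE piX s10 -/s => h1.
  have h2 : `|X| <= `|s - 1%:M| + `|s - 1%:M - X|.
    have {1}-> : X = (s - 1%:M) - (s - 1%:M - X) by rewrite subKr.
    exact: ler_normB.
  have h3 : k * `|X| <= 8^-1 * `|X| by rewrite ler_wpM2r.
  by have := normr_ge0 X; clear -h1 h2 h3 s1; lra.
(* The residual is translated to the identity, where the tangent estimate applies to s^T h in G. Its
   tangential part w will correct X. *)
pose W := s^T *m h - 1%:M.
have sW : s *m W = h - s.
  rewrite /W mulmxBr mulmx1 mulmxA; case: hG => _ _ _ _ /(_ _ Gs) ->.
  by rewrite mul1mx.
have WE : W = s^T *m (h - s) by rewrite mulmxBr (group_trK hG Gs).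
have Wn : `|W| <= N * `|h - s|.
  rewrite WE; apply: (le_trans (mulmx_norm_le _ _)); rewrite ler_wpM2r // mxtr_norm.
  by rewrite -[X in _ <= X]mulr1 ler_wpM2l // (group_norm_le1 hG Gs).
have W0 := normr_ge0 W.
have Wd1 : `|W| < d1.
  apply: (le_lt_trans Wn); apply: le_lt_trans dd1; rewrite ler_wpM2l //; exact: ltW.
have hW : `|W - pi W| <= k * `|W|.
  by apply: hd1 => //; apply: GM => //; exact: group_trV hG Gs.
set w := pi W in hW.
have piw : pi w = w by apply: pi_id; exact: pi_in.
have w2 : `|w| <= 2 * `|W|.
  have {1}-> : w = W - (W - w) by rewrite subKr.
  have h3 : k * `|W| <= 8^-1 * `|W| by rewrite ler_wpM2r.
  by apply: (le_trans (ler_normB _ _)); clear -hW h3 W0; lra.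
have Nhs : N * `|h - s| <= N * d by rewrite ler_wpM2l // ltW.
have YA : A (X + w).
  split; last by rewrite linearD /= piX piw subrr.
  by apply: (le_trans (ler_normD _ _)); clear -X4 w2 Wn Nhs drho; lra.
have fY := Xmin (X + w) (mem_set YA).
have := hr0 (X + w) X; rewrite linE.
have -> : X + w - X = w by rewrite addrC addKr.
rewrite piw -/s => /(_ (le_lt_trans YA.1 _) Xr0) hY.
have {}hY : `|sig r (X + w) - s - w| <= k * `|w| by apply: hY; clear -rho2 r00; lra.
(* The new residual consists of the twist by s, the part of W off the Lie algebra, and the
   nonlinearity of [sig]. Together they are at most 7/8 of the old residual, which by minimality
   must be 0. *)
have E : h - sig r (X + w) = (s - 1%:M) *m W + (W - w) - (sig r (X + w) - s - w).
  by rewrite mulmxBl mul1mx sW; apply/matrixP => i j; rewrite !mxE; ring.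
have n1 : `|(s - 1%:M) *m W| <= N * (2 * d) * `|W|.
  by apply: (le_trans (mulmx_norm_le _ _)); rewrite ler_wpM2r // ler_wpM2l.
have kw : k * `|w| <= k * (2 * `|W|) by rewrite ler_wpM2l // ltW.
have tot : `|h - s| <= (N * (2 * d) + 3 * k) * `|W|.
  apply: (le_trans fY); rewrite E; apply: (le_trans (ler_normB _ _)).
  apply: (le_trans (lerD (ler_normD _ _) (lexx _))); rewrite !mulrDl; clear -n1 hW hY kw; lra.
have hs0 : `|h - s| = 0.
  have c0 : 0 <= N * (2 * d) + 3 * k.
    by rewrite addr_ge0 // mulr_ge0 // ?mulr_ge0 // ltW.
  have h1 := le_trans tot (ler_wpM2l c0 Wn).
  have h2 : (N * (2 * d) + 3 * k) * (N * `|h - s|) = (2 * N * d * N + 3 * (k * N)) * `|h - s| by ring.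
  have h3 : (2 * N * d * N + 3 * (k * N)) * `|h - s| <= (2^-1 + 3 * 8^-1) * `|h - s|.
    by rewrite ler_wpM2r //; clear -dN kN1; lra.
  by have := normr_ge0 (h - s); clear -h1 h2 h3; lra.
move/eqP: hs0; rewrite normr_eq0 subr_eq0 => /eqP ->.
have [|l hl jl] := hK X _ q m hq m0 hm; first by clear -Xrho rho1 e10; lra.
exists l => //; apply: (le_trans hl); rewrite ler_wpM2l //.
apply: (@le_trans _ _ (K * (eta / (K + 1)))).
  by rewrite ler_wpM2l // (le_trans Xrho).
rewrite mulrCA ler_piMr ?(ltW eta0) // ler_pdivrMr // mul1r lerDl //.
Qed.

End Arcs.

End LocalArcs.

(** * Collapse *)

Section Chains.
Variables (R : realType) (n : nat).
Local Notation M := 'M[R]_n.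
Implicit Types (G K : set M) (gg : {vspace M}) (q : M -> M -> R).

Lemma compact_net (A : set M) (r : R) : 0 < r -> compact A ->
  exists s : seq M, (forall x, x \in s -> A x) /\
    forall a, A a -> exists2 x, x \in s & `|a - x| < r.
Proof.
move=> r0; rewrite compact_cover => cA.
have [|a Aa|D DA Dc] := cA M A (fun x => ball x r).
- by move=> x _; exact: ball_open.
- by exists a => //; exact: ballxx.
exists (finmap.enum_fset D); split=> [x xD|a Aa]; first by apply/set_mem; exact: DA.
have [x /= xD] := Dc a Aa; rewrite -ball_normE /ball_ /= distrC => h.
by exists x.
Qed.

Lemma seq_uniform (T : eqType) (s : seq T) (Q : T -> nat -> Prop) :
  (forall x k k', (k <= k')%N -> Q x k -> Q x k') ->
  (forall x, x \in s -> exists k, Q x k) ->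
  exists k, forall x, x \in s -> Q x k.
Proof.
move=> mono; elim: s => [|x s IH] h; first by exists 0%N.
have [k hk] := h x (mem_head x s).
have [k' hk'] : exists k, forall x, x \in s -> Q x k.
  by apply: IH => y ys; apply: h; rewrite in_cons ys orbT.
exists (maxn k k') => y; rewrite in_cons => /orP[/eqP->|ys].
  by apply: mono hk; exact: leq_maxl.
by apply: mono (hk' y ys); exact: leq_maxr.
Qed.

Lemma frob_mull (a X : M) : a^T *m a = 1%:M -> frob (a *m X) (a *m X) = frob X X.
Proof.
by move=> h; rewrite /frob trmx_mul -mulmxA mxtrace_mulC -!mulmxA h mulmx1.
Qed.

Lemma frob_mulr (b X : M) : b *m b^T = 1%:M -> frob (X *m b) (X *m b) = frob X X.
Proof. by move=> h; rewrite /frob trmx_mul -mulmxA (mulmxA b) h mul1mx. Qed.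

Lemma norm_sqr_le_frob (X : M) : `|X| ^+ 2 <= frob X X.
Proof.
rewrite -[leRHS]sqr_sqrtr ?frob_ge0 // ler_pXn2r ?nnegrE ?sqrtr_ge0 //.
apply/mx_norm_leP => [|i j]; first exact: sqrtr_ge0.
rewrite -sqrtr_sqr ler_sqrt ?frob_ge0 // frobE (bigD1 i) //= (bigD1 j) //= -expr2 -addrA lerDl.
rewrite addr_ge0 //; apply: sumr_ge0 => k _; first by rewrite -expr2 sqr_ge0.
by apply: sumr_ge0 => l _; rewrite -expr2 sqr_ge0.
Qed.

Lemma frob_le_norm_sqr (X : M) : frob X X <= (n%:R * `|X|) ^+ 2.
Proof.
rewrite frobE; apply: (@le_trans _ _ (\sum_(i < n) \sum_(j < n) `|X| ^+ 2)).
  apply: ler_sum => i _; apply: ler_sum => j _.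
  rewrite -expr2 -real_normK ?num_real // ler_pXn2r ?nnegrE //; exact: mx_entry_le.
by rewrite !sumr_const !card_ord exprMn -mulrnA -natrX mulr_natl.
Qed.

Definition mprod (s : seq M) : M := foldr mulmx 1%:M s.

Lemma mprod_rcons s x : mprod (rcons s x) = mprod s *m x.
Proof.
by elim: s => [|y s IH] /=; rewrite ?mulmx1 ?mul1mx // /mprod /= -/(mprod _) IH mulmxA.
Qed.

Lemma mprod_tr s : (mprod s)^T = mprod (rev [seq x^T | x <- s]).
Proof.
elim: s => [|x s IH]; first by rewrite trmx1.
by rewrite /= rev_cons mprod_rcons -IH trmx_mul.
Qed.

Section ConnectedQuotient.
Variables (G K : set M).
Hypotheses (hG : compact_lie_group G) (hK : compact_lie_group K) (KG : K `<=` G).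
Hypothesis conn : connected_quotient G K.

Lemma group_compact : compact G.
Proof.
apply: (@mx_bounded_closed_compact _ _ _ _ 1) => [X /(group_norm_le1 hG)//|].
by case: hG.
Qed.

(** The elements reachable modulo K in finitely many short steps, and the remaining ones, both
    thicken to K-saturated open sets. Connectedness of G/K leaves only the former, and a finite net
    bounds the number of steps. The Frobenius distance is used because it is invariant under
    translations on both sides. *)
Lemma chain (d : R) : 0 < d -> exists N : nat, forall g, G g -> exists k s,
  [/\ K k, (size s <= N)%N, forall x, x \in s -> G x /\ `|x - 1%:M| < d & g *m k = mprod s].
Proof.
move=> d0; have [_ G1 GM _ orth] := hG; have [_ K1 KM _ orthK] := hK.
pose Q g (N : nat) := exists k s, [/\ K k, (size s <= N)%N,
  forall x, x \in s -> G x /\ frob (x - 1%:M) (x - 1%:M) < d ^+ 2 & g *m k = mprod s].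
(* From gk = [mprod s] one passes to hk = gk y. Hence the step g^T h is conjugated by k, which does
   not change its Frobenius distance from 1. *)
have step g h N : G g -> G h -> frob (h - g) (h - g) < d ^+ 2 -> Q g N -> Q h N.+1.
  move=> Gg Gh gh [k [s [Kk sN hs E]]].
  pose x := g^T *m h; pose y := k^T *m x *m k.
  have Gx : G x by apply: GM => //; exact: group_trV hG Gg.
  have Gy : G y.
    apply: (GM); last exact: KG.
    by apply: (GM) => //; apply: KG; exact: group_trV hK Kk.
  have kkT := orthK _ Kk; have kTk := group_trK hK Kk.
  exists k, (rcons s y); split=> //; first by rewrite size_rcons.
    move=> z; rewrite mem_rcons in_cons => /orP[/eqP->|]; last exact: hs.
    split=> //.
    have -> : y - 1%:M = k^T *m (x - 1%:M) *m k.
      by rewrite mulmxBr mulmxBl mulmx1 kTk.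
    rewrite frob_mulr // frob_mull ?trmxK //.
    have -> : x - 1%:M = g^T *m (h - g) by rewrite mulmxBr (group_trK hG Gg).
    by rewrite frob_mull ?trmxK //; exact: orth.
  by rewrite mprod_rcons -E /y /x !mulmxA -(mulmxA g) kkT mulmx1 (orth _ Gg) mul1mx.
pose P := [set g | G g /\ exists N, Q g N].
have P1 : P 1%:M.
  by split=> //; exists 0%N, 1%:M, [::]; split=> //; rewrite mulmx1.
have PK a k : P a -> K k -> P (a *m k).
  move=> [Ga [N [k' [s [Kk' sN hs E]]]]] Kk; split; first by apply: GM => //; exact: KG.
  exists N, (k^T *m k'), s; split=> //; first by apply: KM => //; exact: group_trV hK Kk.
  by rewrite mulmxA -(mulmxA a) (orthK _ Kk) mulmx1.
pose nb (p : M) := [set X : M | frob (X - p) (X - p) < d ^+ 2].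
have nb_open p : open (nb p).
  have fc (X : M) : frob (t - p) (t - p) @[t --> X] --> frob (X - p) (X - p).
    have h : mcvg (nbhs X) (fun t => t - p) (X - p).
      by apply: mcvgD; [exact: cvg_mx_entry | exact: mcvg_cst].
    exact: (symform_cvg (frob_symform R n) h h).
  have -> : nb p = (fun X : M => frob (X - p) (X - p)) @^-1` [set x | x < d ^+ 2] by [].
  by apply: open_comp => [X _|]; [exact: fc | exact: open_lt].
have nbK p a k : K k -> nb p a -> nb (p *m k) (a *m k).
  by move=> Kk; rewrite /nb /= -mulmxBl frob_mulr //; exact: orthK.
have nbC p a : nb p a -> nb a p.
  by rewrite /nb /= -[a - p]opprB frobNl frobC frobNl opprK.
have allP g : G g -> P g.
  move=> Gg; apply: contrapT => nPg.
  pose U := \bigcup_(p in P) nb p; pose V := \bigcup_(p in G `\` P) nb p.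
  have := conn (U := U) (V := V).
  have GPK a k : (G `\` P) a -> K k -> (G `\` P) (a *m k).
    move=> [Ga nPa] Kk; split; first by apply: GM => //; exact: KG.
    move=> h; apply: nPa; have := PK _ _ h (group_trV hK Kk).
    by rewrite -mulmxA (orthK _ Kk) mulmx1.
  have nb0 p : nb p p by rewrite /nb /= subrr frob0l exprn_gt0.
  case.
  - by apply: bigcup_open => p _; exact: nb_open.
  - by apply: bigcup_open => p _; exact: nb_open.
  - by move=> a k _ Kk [p Pp pa]; exists (p *m k); [exact: PK | exact: nbK].
  - by move=> a k _ Kk [p Pp pa]; exists (p *m k); [exact: GPK | exact: nbK].
  - move=> a Ga; have [Pa|nPa] := pselect (P a); [left; exists a | right; exists a] => //.
  - by exists 1%:M; split=> //; exists 1%:M.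
  - by exists g; split=> //; exists g.
  (* A point common to both thickenings links a reachable p to an unreachable v in two short
     steps. *)
  move=> a [[Ga [p [Gp [N Qp]] pa]] [v [Gv nPv] va]].
  by apply: nPv; split=> //; exists N.+2; apply: (step a v) => //;
     [exact: nbC | exact: (step p a)].
have r0 : 0 < d / (n%:R + 1) by rewrite divr_gt0 // ltr_wpDl.
have [net [netG hnet]] := compact_net r0 group_compact.
have [N hN] : exists N, forall x, x \in net -> Q x N.
  apply: seq_uniform => [x k k' kk' [k0 [s [h1 h2 h3 h4]]]|x xs].
    by exists k0, s; split=> //; exact: leq_trans kk'.
  by have [] := allP x (netG x xs).
exists N.+1 => g Gg; have [x xs gx] := hnet g Gg.
have [|k [s [Kk sN hs E]]] := step x g N (netG x xs) Gg _ (hN x xs).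
  apply: (le_lt_trans (frob_le_norm_sqr _)); rewrite ltr_pXn2r ?nnegrE ?mulr_ge0 ?(ltW d0) //.
  move: gx; rewrite ltr_pdivlMr ?ltr_wpDl // => gx; apply: le_lt_trans gx.
  by rewrite mulrC ler_wpM2l // lerDl.
exists k, s; split=> // y ys; have [Gy hy] := hs y ys; split=> //.
have := le_lt_trans (norm_sqr_le_frob _) hy.
by rewrite ltr_pXn2r ?nnegrE ?(ltW d0).
Qed.

Variable gg : {vspace M}.
Hypothesis hg : lie_algebra_of G gg.

(** L counts the links of a chain, each of length at most m. Inverting a chain moves the correction
    by K to the left, which is the form needed at the initial end of a fibre path. *)
Lemma chain_joined : exists2 L : R, 0 <= L & forall q (m : R), psd_form q -> 0 <= m ->
  (forall X, X \in gg -> qnorm q X <= m * `|X|) -> forall g, G g ->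
  (exists k, K k /\ exists2 l, l <= m * L & joined G q 1%:M (g *m k) l) /\
  (exists k, K k /\ exists2 l, l <= m * L & joined G q 1%:M (k *m g) l).
Proof.
have [d d0 hd] := local_arcs hG hg ltr01.
have [N hN] := chain d0; exists N%:R => // q m hq m0 hm.
have [_ G1 GM _ orth] := hG.
have jp s : (forall x, x \in s -> G x /\ `|x - 1%:M| < d) ->
    exists2 l, l <= m * (size s)%:R & joined G q 1%:M (mprod s) l.
  elim: s => [|x s IH] h; first by exists 0; [rewrite mulr0 | exact: joined_refl].
  have [Gx xd] := h x (mem_head x s).
  have [l1 hl1 j1] := hd x Gx xd q m hq m0 hm.
  have [|l2 hl2 j2] := IH; first by move=> y ys; apply: h; rewrite in_cons ys orbT.
  exists (l1 + l2); first by rewrite /= -natr1 mulrDr addrC lerD.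
  by apply: (joined_trans j1); have := joined_mull hG Gx j2; rewrite mulmx1.
have le_mN s : (size s <= N)%N -> m * (size s)%:R <= m * N%:R.
  by move=> sN; rewrite ler_wpM2l // ler_nat.
move=> g Gg; split.
  have [k [s [Kk sN hs E]]] := hN g Gg; have [l hl j] := jp s hs.
  exists k; split=> //; exists l; first by apply: (le_trans hl); exact: le_mN.
  by rewrite E.
have [k [s [Kk sN hs E]]] := hN _ (group_trV hG Gg).
have [|l hl j] := jp (rev [seq x^T | x <- s]).
  move=> x; rewrite mem_rev => /mapP[y ys ->]; have [Gy yd] := hs y ys.
  split; first exact: group_trV hG Gy.
  by rewrite -trmx1 -linearB /= mxtr_norm.
exists k^T; split; first exact: group_trV hK Kk.
exists l; last by rewrite -[g]trmxK -trmx_mul E mprod_tr.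
by apply: (le_trans hl); rewrite size_rev size_map; exact: le_mN.
Qed.

End ConnectedQuotient.

End Chains.

(** * Distances on coset spaces and collapse *)

Section CosetDistance.
Variables (R : realType) (n : nat).
Local Notation M := 'M[R]_n.
Implicit Types (G K : set M) (gg : {vspace M}) (q : M -> M -> R).

Definition coset (K : set M) (a : M) : set M := [set a *m k | k in K].

Section Bounds.
Variables (G K : set M) (q : M -> M -> R).
Hypothesis (hG : compact_lie_group G).

Let lengths a b := [set l | exists k k', [/\ K k, K k' & joined G q (a *m k) (b *m k') l]].

Local Lemma coset_distE a b : coset_dist G q (coset K a) (coset K b) = inf (lengths a b).
Proof.
congr inf; apply/seteqP; split=> l /=.
  by move=> [_ [_ [[k Kk <-] [k' Kk' <-] j]]]; exists k, k'.
by move=> [k [k' [Kk Kk' j]]]; exists (a *m k), (b *m k'); split=> //; [exists k | exists k'].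
Qed.

Local Lemma lengths_lb a b : lbound (lengths a b) 0.
Proof. by move=> l [k [k' [_ _ j]]]; exact: joined_ge0 j. Qed.

Lemma coset_dist_le a b k k' l : K k -> K k' -> joined G q (a *m k) (b *m k') l ->
  coset_dist G q (coset K a) (coset K b) <= l.
Proof.
move=> Kk Kk' j; rewrite coset_distE; apply: ge_inf; first by exists 0; exact: lengths_lb.
by exists k, k'.
Qed.

(** The given path serves to make the set of lengths nonempty, since the infimum of the empty set is
    0 by convention. *)
Lemma coset_dist_adherent a b k k' l e : K k -> K k' -> joined G q (a *m k) (b *m k') l ->
  0 < e -> exists k k' l, [/\ K k, K k', joined G q (a *m k) (b *m k') l
    & l < coset_dist G q (coset K a) (coset K b) + e].
Proof.
move=> Kk Kk' j e0; rewrite coset_distE.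
have [|l' [k1 [k2 [K1 K2 j']]] hl'] := @inf_adherent _ (lengths a b) e e0.
  by split; [exists l, k, k' | exists 0; exact: lengths_lb].
by exists k1, k2, l'.
Qed.

Lemma coset_dist_ge a b k k' l r : K k -> K k' -> joined G q (a *m k) (b *m k') l ->
  (forall k k' l, K k -> K k' -> joined G q (a *m k) (b *m k') l -> r <= l) ->
  r <= coset_dist G q (coset K a) (coset K b).
Proof.
move=> Kk Kk' j h; rewrite coset_distE; apply: lb_le_inf; first by exists l, k, k'.
by move=> l' [k1 [k2 [K1 K2 j']]]; exact: h j'.
Qed.

Lemma coset_dist_ge0 a b : 0 <= coset_dist G q (coset K a) (coset K b).
Proof.
rewrite coset_distE; have [->|ne] := eqVneq (lengths a b) set0; first by rewrite inf0.
by apply: lb_le_inf; [exact/set0P | exact: lengths_lb].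
Qed.

End Bounds.

(** A translated local arc. The same d serves for every right factor h, since coset representatives
    are not under control when base points are moved. *)
Lemma joined_near G gg (hG : compact_lie_group G) (hg : lie_algebra_of G gg) (eta : R) :
  0 < eta -> exists2 d : R, 0 < d & forall g g' h, G g -> G g' -> G h -> `|g - g'| < d ->
    forall q (m : R), psd_form q -> 0 <= m -> (forall X, X \in gg -> qnorm q X <= m * `|X|) ->
    exists2 l, l <= m * eta & joined G q (g *m h) (g' *m h) l.
Proof.
move=> eta0; have [d d0 hd] := local_arcs hG hg eta0; have [_ G1 GM _ orth] := hG.
pose N : R := n%:R * (n%:R * n%:R) + 1.
have N0 : 0 < N by rewrite ltr_wpDl // !mulr_ge0.
exists (d / N) => [|g g' h Gg Gg' Gh gg' q m hq m0 hm]; first by rewrite divr_gt0.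
pose a := g *m h; have Ga : G a by exact: GM.
pose y := a^T *m (g' *m h).
have Gy : G y by apply: (GM) => //; [exact: group_trV hG Ga | exact: GM].
have yE : y - 1%:M = h^T *m (g^T *m (g' - g) *m h).
  rewrite -(group_trK hG Ga) /y /a trmx_mul -mulmxBr -mulmxBl.
  by rewrite -!mulmxA.
have yd : `|y - 1%:M| < d.
  have t1 : `|g^T *m (g' - g)| <= n%:R * `|g - g'|.
    apply: (le_trans (mulmx_norm_le _ _)); rewrite distrC ler_wpM2r // mxtr_norm.
    by rewrite -[leRHS]mulr1 ler_wpM2l // (group_norm_le1 hG Gg).
  have t2 : `|g^T *m (g' - g) *m h| <= n%:R * (n%:R * `|g - g'|).
    apply: (le_trans (mulmx_norm_le _ _)); rewrite -[leRHS]mulr1.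
    by apply: ler_pM; rewrite ?mulr_ge0 ?ler_wpM2l // (group_norm_le1 hG Gh).
  have t3 : `|y - 1%:M| <= n%:R * (n%:R * (n%:R * `|g - g'|)).
    rewrite yE; apply: (le_trans (mulmx_norm_le _ _)); apply: ler_pM => //.
    by rewrite -[leRHS]mulr1 ler_wpM2l // mxtr_norm (group_norm_le1 hG Gh).
  move: gg'; rewrite ltr_pdivlMr // => gg'; apply: le_lt_trans gg'.
  apply: (le_trans t3); rewrite /N mulrDr mulr1 !mulrA mulrC !mulrA lerDl //.
have [l hl j] := hd y Gy yd q m hq m0 hm.
exists l => //; have := joined_mull hG Ga j; rewrite mulmx1 /y !mulmxA.
by rewrite (orth _ Ga) mul1mx.
Qed.

Section Collapse.
Variables (G H K : set M) (gg hh : {vspace M}) (q1 q2 : M -> M -> R) (l0 : R).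
Hypotheses (hG : compact_lie_group G) (hH : compact_lie_group H) (hK : compact_lie_group K).
Hypotheses (HG : H `<=` G) (KH : K `<=` H).
Hypotheses (cGK : connected_quotient G K) (cHK : connected_quotient H K).
Hypotheses (hgg : lie_algebra_of G gg) (hhh : lie_algebra_of H hh).
Hypotheses (hq1 : psd_form q1) (hq2 : psd_form q2).
Hypotheses (q2hh : forall X, X \in hh -> q2 X X = 0) (l00 : 0 < l0).

Let mt (x1 x2 : R) (X Y : M) : R := x1 * q1 X Y + x2 * q2 X Y.
Let qb (X Y : M) : R := l0 * q2 X Y.

Local Lemma mt_psd x1 x2 : 0 <= x1 -> 0 <= x2 -> psd_form (mt x1 x2).
Proof.
move=> x10 x20; have [s1 p1] := hq1; have [s2 p2] := hq2; split; last first.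
  by move=> X; rewrite addr_ge0 ?mulr_ge0.
split=> [a X Y Z|X Y]; rewrite /mt.
  by rewrite !(symformDl s1, symformDl s2, symformZl s1, symformZl s2); ring.
by rewrite (symformC s1) (symformC s2).
Qed.

Local Lemma qb_psd : psd_form qb.
Proof.
have [s2 p2] := hq2; split; last by move=> X; rewrite mulr_ge0 // ltW.
split=> [a X Y Z|X Y]; rewrite /qb; last by rewrite (symformC s2).
by rewrite (symformDl s2) (symformZl s2); ring.
Qed.

(** Subadditivity of the square root: length is at most the rescaled base length plus a contribution
    of order sqrt(x1). *)
Local Lemma qnorm_mt x1 x2 X : 0 <= x1 -> 0 <= x2 ->
  qnorm (mt x1 x2) X <= Num.sqrt (x2 / l0) * qnorm qb X + Num.sqrt x1 * qnorm q1 X.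
Proof.
move=> x10 x20; have [_ p1] := hq1; have [_ p2] := hq2.
rewrite /qnorm /qb -!sqrtrM ?divr_ge0 // ?(ltW l00) // mulrA divfK ?gt_eqF //.
have a0 : 0 <= x2 * q2 X X by rewrite mulr_ge0.
have b0 : 0 <= x1 * q1 X X by rewrite mulr_ge0.
rewrite /mt -ler_sqr ?nnegrE ?addr_ge0 ?sqrtr_ge0 // sqr_sqrtr ?addr_ge0 //.
rewrite sqrrD !sqr_sqrtr // mulr2n.
have : 0 <= Num.sqrt (x2 * q2 X X) * Num.sqrt (x1 * q1 X X) by rewrite mulr_ge0 ?sqrtr_ge0.
lra.
Qed.

Local Lemma qnorm_qb_le x1 x2 X : 0 <= x1 -> 0 < x2 ->
  qnorm qb X <= (Num.sqrt (x2 / l0))^-1 * qnorm (mt x1 x2) X.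
Proof.
move=> x10 x20; have [_ p1] := hq1; have [_ p2] := hq2.
have r0 : 0 < Num.sqrt (x2 / l0) by rewrite sqrtr_gt0 divr_gt0.
rewrite mulrC ler_pdivlMr // mulrC /qnorm -sqrtrM ?divr_ge0 ?(ltW l00) ?(ltW x20) //.
rewrite ler_sqrt /qb /mt ?mulrA ?divfK ?gt_eqF //; last first.
  by rewrite addr_ge0 ?mulr_ge0 // ltW.
by rewrite lerDr mulr_ge0.
Qed.

Local Lemma qnorm_le_const (q : M -> M -> R) : psd_form q ->
  exists2 m : R, 0 <= m & forall X, qnorm q X <= m * `|X|.
Proof.
move=> [s p]; have [c c0 hc] := symform_bound s.
exists (Num.sqrt c) => [|X]; first exact: sqrtr_ge0.
rewrite -[`|X|]ger0_norm // -sqrtr_sqr -sqrtrM // ler_sqrt ?mulr_ge0 ?sqr_ge0 //.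
Qed.

Lemma collapse_uniform (eps : R) : 0 < eps ->
  exists2 kap : R, 0 < kap & forall x1 x2, 0 < x1 -> 0 < x2 ->
    Num.sqrt x1 <= kap -> `|Num.sqrt (x2 / l0) - 1| <= kap ->
    forall a b, G a -> G b ->
    `|coset_dist G (mt x1 x2) (coset K a) (coset K b) -
      coset_dist G qb (coset H a) (coset H b)| <= eps.
Proof.
move=> eps0.
have [_ G1 GM _ orth] := hG; have [_ H1 _ _ _] := hH; have [_ K1 _ _ _] := hK.
have KG : K `<=` G by move=> x /KH/HG.
have [m1 m10 hm1] := qnorm_le_const hq1.
have [m2 m20 hm2] := qnorm_le_const qb_psd.
have [LG LG0 hLG] := chain_joined hG hK KG cGK hgg.
have [LH LH0 hLH] := chain_joined hH hK KH cHK hhh.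
(* E0 here and E1 below collect the coefficients of eta and kap in the final estimate, given
   sqrt(x1) <= 1 and sqrt(x2 / l0) <= 2. Each contribution is allotted eps / 2. *)
pose E0 := 2 * (m1 + 2 * m2) + 2 * (2 * m2 + 1).
have E00 : 0 < E0 by rewrite /E0; lra.
pose eta := eps / (2 * E0).
have eta0 : 0 < eta by rewrite divr_gt0 // mulr_gt0.
have [d d0 hd] := joined_near hG hgg eta0.
have [s [sG hs]] := compact_net d0 (group_compact hG).
have reach q m : psd_form q -> 0 <= m -> (forall X, qnorm q X <= m * `|X|) ->
    forall a b, G a -> G b -> exists2 k, K k & exists2 l, l <= m * LG & joined G q a (b *m k) l.
  move=> hq m0 hm a b Ga Gb.
  have Gab : G (a^T *m b) by apply: GM => //; exact: group_trV hG Ga.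
  have [[k [Kk [l hl j]]] _] := hLG q m hq m0 (fun X _ => hm X) _ Gab.
  exists k => //; exists l => //; have := joined_mull hG Ga j.
  by rewrite mulmx1 !mulmxA (orth _ Ga) mul1mx.
have reachq a b : G a -> G b -> exists2 h, H h & exists2 l, l <= m2 * LG &
    joined G qb (a *m 1%:M) (b *m h) l.
  move=> Ga Gb; have [k Kk [l hl j]] := reach _ _ qb_psd m20 hm2 a b Ga Gb.
  by exists k; [exact: KH | exists l; rewrite // mulmx1].
pose D a b := coset_dist G qb (coset H a) (coset H b).
have D0 a b : 0 <= D a b by exact: coset_dist_ge0.
have Dle a b : G a -> G b -> D a b <= m2 * LG.
  move=> Ga Gb; have [h Hh [l hl j]] := reachq a b Ga Gb.
  exact: le_trans (coset_dist_le H1 Hh j) hl.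
(* D does not control the fibre length of a near-optimal curve; restricting to
   the net leaves finitely many curves and hence a uniform bound N. *)
pose Pr (ab : M * M) (N : nat) := exists h1 h2, [/\ H h1, H h2 & forall x1 x2, 0 < x1 -> 0 < x2 ->
  exists2 l, l <= Num.sqrt (x2 / l0) * (D ab.1 ab.2 + eta) + Num.sqrt x1 * N%:R &
    joined G (mt x1 x2) (ab.1 *m h1) (ab.2 *m h2) l].
have [N hN] : exists N, forall ab, ab \in [seq (x, y) | x <- s, y <- s] -> Pr ab N.
  apply: seq_uniform => [[a b] k k' kk' [h1 [h2 [Hh1 Hh2 h]]]|ab /allpairsP[[a b] /= [sa sb ->]]].
    exists h1, h2; split=> // x1 x2 x10 x20; have [l hl j] := h x1 x2 x10 x20.
    by exists l => //; apply: (le_trans hl); rewrite lerD2l ler_wpM2l ?sqrtr_ge0 // ler_nat.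
  have [h Hh [l hl j]] := reachq a b (sG a sa) (sG b sb).
  have [h1 [h2 [l' [Hh1 Hh2 j' hl']]]] := coset_dist_adherent H1 Hh j eta0.
  have [L L0 hL] := joined_le hG qb_psd hq1 j'.
  exists (Num.truncn L).+1, h1, h2; split=> // x1 x2 x10 x20.
  have [l'' hl'' j''] := hL (Num.sqrt (x2 / l0)) (Num.sqrt x1) _
    (mt_psd (ltW x10) (ltW x20)) (sqrtr_ge0 _) (fun X => qnorm_mt X (ltW x10) (ltW x20)).
  exists l'' => //; apply: (le_trans hl''); apply: lerD.
    by rewrite ler_wpM2l ?sqrtr_ge0 // ltW.
  rewrite ler_wpM2l ?sqrtr_ge0 //.
  have /andP[_ /ltW//] : (Num.truncn L)%:R <= L < (Num.truncn L).+1%:R by rewrite truncn_itv.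
pose E1 := m2 * LG + 2 * (m1 * LH) + N%:R.
have E10 : 0 <= E1 by rewrite /E1 !addr_ge0 // mulr_ge0 // mulr_ge0.
pose kap := Num.min 1 (eps / (2 * (E1 + 1))).
have E11 : 0 < 2 * (E1 + 1) by rewrite mulr_gt0 // ltr_wpDl.
have kap0 : 0 < kap by rewrite lt_min ltr01 divr_gt0.
have [kap1 kapE] : kap <= 1 /\ kap * E1 <= eps / 2.
  split; first by rewrite /kap ge_min lexx.
  have : kap <= eps / (2 * (E1 + 1)) by rewrite /kap ge_min lexx orbT.
  by rewrite ler_pdivlMr // => h; lra.
have etaE : eta * E0 = eps / 2 by rewrite /eta; field; rewrite gt_eqF.
exists kap => // x1 x2 x10 x20.
set p := Num.sqrt x1; set r := Num.sqrt (x2 / l0) => pk.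
rewrite ler_norml => /andP[r1 r2] a b Ga Gb.
have p0 : 0 <= p by exact: sqrtr_ge0.
have r0 : 0 < r by rewrite sqrtr_gt0 divr_gt0.
have hmt := mt_psd (ltW x10) (ltW x20).
pose mM := r * m2 + p * m1.
have mM0 : 0 <= mM by rewrite addr_ge0 // mulr_ge0 // ltW.
have hmM X : qnorm (mt x1 x2) X <= mM * `|X|.
  apply: (le_trans (qnorm_mt X (ltW x10) (ltW x20))).
  by rewrite mulrDl -!mulrA lerD // ler_wpM2l // ltW.
rewrite -/(D a b); set Dt := coset_dist _ _ _ _.
(* A path between K-cosets also joins the H-cosets, and its base length is at most 1 / r times its
   length. *)
have lower : r * D a b <= Dt.
  have [k Kk [l hl j]] := reach _ _ hmt mM0 hmM a b Ga Gb.
  have j1 : joined G (mt x1 x2) (a *m 1%:M) (b *m k) l by rewrite mulmx1.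
  apply: (coset_dist_ge K1 Kk j1) => k1 k2 l' Kk1 Kk2 j'.
  have [L L0 hL] := joined_le hG hmt hq1 j'.
  have [|l'' hl'' j''] := hL r^-1 0 _ qb_psd (lexx 0).
    by move=> X; rewrite mul0r addr0; exact: qnorm_qb_le (ltW x10) x20.
  have := coset_dist_le (KH Kk1) (KH Kk2) j''; rewrite -/(D a b) => h.
  have := le_trans h hl''; rewrite mul0r addr0 mulrC ler_pdivlMr // mulrC.
  by [].
have [a' sa aa'] := hs a Ga; have [b' sb bb'] := hs b Gb.
have Ga' := sG a' sa; have Gb' := sG b' sb.
have Dnet : D a' b' <= D a b + 2 * (m2 * eta).
  have [h Hh [l hl j]] := reachq a b Ga Gb.
  rewrite -lerBlDr; apply: (coset_dist_ge H1 Hh j) => h1 h2 l' Hh1 Hh2 j'.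
  have a'a : `|a' - a| < d by rewrite distrC.
  have [l1 hl1 j1] := hd a' a h1 Ga' Ga (HG Hh1) a'a _ _ qb_psd m20 (fun X _ => hm2 X).
  have [l2 hl2 j2] := hd b b' h2 Gb Gb' (HG Hh2) bb' _ _ qb_psd m20 (fun X _ => hm2 X).
  have := coset_dist_le Hh1 Hh2 (joined_trans (joined_trans j1 j') j2).
  by rewrite -/(D a' b'); lra.
(* Five legs: from a to its net point a', along the fibre over a', along the chosen near-optimal
   curve, along the fibre over b', and from b' to b. Fibre legs cost only sqrt(x1), because q2
   vanishes on [hh]. *)
have upper : Dt <= 2 * (mM * eta) + 2 * (p * m1 * LH) + (r * (D a' b' + eta) + p * N%:R).
  have [|h1 [h2 [Hh1 Hh2 /(_ x1 x2 x10 x20)]]] := hN (a', b').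
    by apply/allpairsP; exists (a', b').
  move=> /= [l hl j].
  have pm0 : 0 <= p * m1 by exact: mulr_ge0.
  have hhb X : X \in hh -> qnorm (mt x1 x2) X <= p * m1 * `|X|.
    move=> Xh; apply: (le_trans (qnorm_mt X (ltW x10) (ltW x20))).
    by rewrite /qnorm /qb q2hh // mulr0 sqrtr0 mulr0 add0r -mulrA ler_wpM2l //; exact: hm1.
  have [_ [k [Kk [l1 hl1 j1]]]] := hLH _ _ hmt pm0 hhb _ Hh1.
  have [[k' [Kk' [l2 hl2 j2]]] _] := hLH _ _ hmt pm0 hhb _ (group_trV hH Hh2).
  have KkT := group_trV hK Kk.
  have Gak : G (a' *m k^T) by apply: GM => //; exact: KG.
  have Gbh : G (b' *m h2) by apply: GM => //; exact: HG.
  have {}j1 : joined G (mt x1 x2) (a' *m k^T) (a' *m h1) l1.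
    have := joined_mull hG Gak (joined_sub HG j1).
    by rewrite mulmx1 !mulmxA -(mulmxA a' k^T) (group_trK hK Kk) mulmx1.
  have {}j2 : joined G (mt x1 x2) (b' *m h2) (b' *m k') l2.
    have := joined_mull hG Gbh (joined_sub HG j2).
    by rewrite mulmx1 !mulmxA -(mulmxA b' h2) (orth _ (HG Hh2)) mulmx1.
  have [l3 hl3 j3] := hd a a' k^T Ga Ga' (KG _ KkT) aa' _ _ hmt mM0 (fun X _ => hmM X).
  have b'b : `|b' - b| < d by rewrite distrC.
  have [l4 hl4 j4] := hd b' b k' Gb' Gb (KG _ Kk') b'b _ _ hmt mM0 (fun X _ => hmM X).
  have jj := joined_trans (joined_trans (joined_trans (joined_trans j3 j1) j) j2) j4.
  apply: (le_trans (coset_dist_le KkT Kk' jj)).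
  rewrite -/p -/r in hl; clear -hl hl1 hl2 hl3 hl4; lra.
have DL := Dle a b Ga Gb; have Dab0 := D0 a b.
have mLG0 : 0 <= m2 * LG by exact: mulr_ge0.
have mLH0 : 0 <= m1 * LH by exact: mulr_ge0.
rewrite ler_norml; apply/andP; split.
  have h1 : (1 - r) * D a b <= kap * E1.
    apply: (@le_trans _ _ (kap * D a b)); first by apply: ler_wpM2r => //; lra.
    by rewrite ler_wpM2l ?(ltW kap0) // (le_trans DL) // /E1 -addrA lerDl addr_ge0 // mulr_ge0.
  clear -h1 kapE lower eps0; lra.
have h1 : (r - 1) * D a b <= kap * (m2 * LG).
  apply: (@le_trans _ _ (kap * D a b)); first by apply: ler_wpM2r.
  by rewrite ler_wpM2l ?(ltW kap0).
have h2 : p * (2 * (m1 * LH) + N%:R) <= kap * (2 * (m1 * LH) + N%:R).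
  by rewrite ler_wpM2r // addr_ge0 // mulr_ge0.
have r2' : r <= 2 by move: r2 kap1; lra.
have p1 : p <= 1 by exact: le_trans pk kap1.
have h3 : r * (D a' b' + eta) <= r * (D a b + 2 * (m2 * eta) + eta).
  by apply: ler_wpM2l; [exact: ltW | rewrite lerD2r].
have h4 : r * (2 * (m2 * eta) + eta) <= 2 * (2 * (m2 * eta) + eta).
  apply: ler_wpM2r => //; apply: addr_ge0; last exact: ltW.
  by apply: mulr_ge0 => //; apply: mulr_ge0 => //; exact: ltW.
have h5 : mM * eta <= (2 * m2 + m1) * eta.
  rewrite ler_wpM2r ?(ltW eta0) // /mM lerD ?ler_wpM2r //.
  by rewrite -[leRHS]mul1r ler_wpM2r.
have h6 : kap * E1 = kap * (m2 * LG) + kap * (2 * (m1 * LH) + N%:R) by rewrite /E1; ring.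
have h7 : eta * E0 = 2 * ((2 * m2 + m1) * eta) + 2 * (2 * (m2 * eta) + eta) by rewrite /E0; ring.
clear -upper h1 h2 h3 h4 h5 h6 h7 kapE etaE; lra.
Qed.

(** The correspondence pairs aK with aH. Nonnegativity holds because a correspondence between
    nonempty sets is nonempty, so each admissible eps exceeds some absolute value. *)
Local Lemma HG_dist_bounds (d1 d2 : set M -> set M -> R) (eps : R) : 0 < eps ->
  (forall a b, G a -> G b ->
    `|d1 (coset K a) (coset K b) - d2 (coset H a) (coset H b)| < eps) ->
  (0 <= HG_dist (cosets G K) (cosets G H) d1 d2 <= eps%:E)%E.
Proof.
move=> eps0 hd; have [_ G1 _ _ _] := hG; apply/andP; split.
  apply: le_ereal_inf_tmp => _ [e /= [C [_ C1 _ hC]] <-].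
  have : (fst @` C) (coset K 1%:M) by rewrite C1; exists 1%:M.
  move=> [p Cp _]; rewrite lee_fin.
  by apply: ltW; apply: le_lt_trans (hC p p Cp Cp).
apply: ereal_inf_lbound; exists eps => //=.
exists [set p | exists2 a, G a & p = (coset K a, coset H a)]; split.
- by move=> p [a Ga ->]; split; exists a.
- apply/seteqP; split=> [_ [p [a Ga ->] <-]|_ [a Ga <-]]; first by exists a.
  by exists (coset K a, coset H a) => //; exists a.
- apply/seteqP; split=> [_ [p [a Ga ->] <-]|_ [a Ga <-]]; first by exists a.
  by exists (coset K a, coset H a) => //; exists a.
by move=> p p' [a Ga ->] [b Gb ->]; exact: hd.
Qed.

Lemma collapse_cvg (F : set_system R) {FF : ProperFilter F} (x1 x2 : R -> R) :
  (\forall t \near F, 0 < x1 t /\ 0 < x2 t) ->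
  x1 t @[t --> F] --> 0 -> x2 t @[t --> F] --> l0 ->
  HG_dist (cosets G K) (cosets G H) (coset_dist G (mt (x1 t) (x2 t))) (coset_dist G qb)
    @[t --> F] --> 0%E.
Proof.
move=> pos c1 c2.
have s1 : Num.sqrt (x1 t) @[t --> F] --> (0 : R).
  rewrite -sqrtr0; apply: (cvg_comp _ _ c1); exact: sqrt_continuous.
have s2 : Num.sqrt (x2 t / l0) @[t --> F] --> (1 : R).
  rewrite -sqrtr1 -(@divff _ l0) ?gt_eqF //.
  apply: (@cvg_comp _ _ _ (fun t => x2 t / l0) Num.sqrt); last exact: sqrt_continuous.
  by apply: cvgM => //; exact: cvg_cst.
have key (eps : R) : 0 < eps -> \forall t \near F,
    (0 <= HG_dist (cosets G K) (cosets G H) (coset_dist G (mt (x1 t) (x2 t)))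
      (coset_dist G qb) <= eps%:E)%E.
  move=> eps0; have e2 : 0 < eps / 2 by rewrite divr_gt0.
  have [kap kap0 hkap] := collapse_uniform e2.
  have n1 : \forall t \near F, `|0 - Num.sqrt (x1 t)| <= kap.
    exact: ((cvgrPdist_le _ _).1 s1 kap kap0).
  have n2 : \forall t \near F, `|1 - Num.sqrt (x2 t / l0)| <= kap.
    exact: ((cvgrPdist_le _ _).1 s2 kap kap0).
  near=> t; apply: HG_dist_bounds => // a b Ga Gb.
  have [p1 p2] : 0 < x1 t /\ 0 < x2 t by near: t.
  apply: (@le_lt_trans _ _ (eps / 2)); last by rewrite ltr_pdivrMr // ltr_pMr // ltr1n.
  apply: hkap => //; last by rewrite distrC; near: t.
  have : `|0 - Num.sqrt (x1 t)| <= kap by near: t.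
  by rewrite sub0r normrN ger0_norm // sqrtr_ge0.
apply/fine_cvgP; split.
  apply: filterS (key 1 ltr01) => t /andP[h1 h2].
  by rewrite ge0_fin_numE // (le_lt_trans h2) // ltry.
apply/cvgrPdist_le => e e0; apply: filterS (key e e0) => t /=.
case: (HG_dist _ _ _ _) => [r| |] //=; rewrite ?lee_fin.
  by move=> /andP[h1 h2]; rewrite sub0r normrN ger0_norm.
by move=> _; rewrite subr0 normr0 ltW.
Unshelve. all: by end_near. Qed.

End Collapse.

End CosetDistance.

(** * Curvature norm *)

Section CurvatureNorm.
Variables (R : realType) (n : nat) (S : homog_data R n).
Local Notation M := 'M[R]_n.
Hypothesis hS : two_summands S.

(** An index list independent of the metric, the flag telling which of x1, x2 scales the vector.
    Sums over the frames of different metrics thus run over the same list. *)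
Let onb_index : seq (bool * M) := [seq (true, u) | u <- onb1 S] ++ [seq (false, u) | u <- onb2 S].

Let scaled (x1 x2 : R) (i : bool * M) : M := (Num.sqrt (if i.1 then x1 else x2))^-1 *: i.2.

Local Lemma metric_onb_map x1 x2 : metric_onb S x1 x2 = map (scaled x1 x2) onb_index.
Proof. by rewrite /metric_onb /onb_index map_cat -!map_comp. Qed.

Local Notation nab x1 x2 := (nabla (proj_p S) (metric S x1 x2) (metric_onb S x1 x2)).
Local Notation riem x1 x2 := (Riem (proj_k S) (proj_p S) (metric S x1 x2) (metric_onb S x1 x2)).

Local Lemma proj_pZ a (X : M) : proj_p S (a *: X) = a *: proj_p S X.
Proof. exact: linearZ. Qed.

Local Lemma proj_kZ a (X : M) : proj_k S (a *: X) = a *: proj_k S X.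
Proof. exact: linearZ. Qed.

Local Lemma nabla_scale x1 x2 c (X Y : M) : 0 < c ->
  nab (c * x1) (c * x2) X Y = nab x1 x2 X Y.
Proof.
move=> c0; rewrite /nabla !metric_onb_map !big_map; congr (_ + _ *: _).
apply: eq_bigr => i _.
have e : scaled (c * x1) (c * x2) i = (Num.sqrt c)^-1 *: scaled x1 x2 i.
  rewrite /scaled scalerA -invfM -sqrtrM ?(ltW c0) //.
  by case: i => -[] u.
have m U V : metric S (c * x1) (c * x2) U V = c * metric S x1 x2 U V.
  by rewrite !metricE; ring.
have hm := metric_symform hS x1 x2.
rewrite e; move: (scaled x1 x2 i) => v.
rewrite !m !lieZl !proj_pZ (symformZl hm) (symformZr hm) scalerA; congr (_ *: _).
have : (Num.sqrt c)^-1 * (Num.sqrt c)^-1 * c = 1.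
  by rewrite -invfM -expr2 sqr_sqrtr ?(ltW c0) // mulVf // gt_eqF.
move: (Num.sqrt c)^-1 => k E.
move: (metric S x1 x2 _ Y) (metric S x1 x2 X _) => a b.
transitivity ((k * k * c) * (a + b)); first by ring.
by rewrite E mul1r.
Qed.

Local Lemma nabla_lin x1 x2 a b (X Y : M) : nab x1 x2 (a *: X) (b *: Y) = (a * b) *: nab x1 x2 X Y.
Proof.
have hm := metric_symform hS x1 x2.
rewrite /nabla scalerDr !scalerA lieZl lieZr scalerA proj_pZ scalerA.
rewrite [in RHS]mulrC; congr (_ + _); rewrite ?scalerA //.
rewrite -scalerA; congr (_ *: _).
rewrite scaler_sumr; apply: eq_bigr => u _; rewrite scalerA; congr (_ *: _).
rewrite !lieZr !proj_pZ !(symformZl hm) !(symformZr hm); ring.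
Qed.

Local Lemma riem_scale x1 x2 c k (X Y Z : M) : 0 < c ->
  riem (c * x1) (c * x2) (k *: X) (k *: Y) (k *: Z) = (k * k * k) *: riem x1 x2 X Y Z.
Proof.
move=> c0; rewrite /Riem !nabla_scale //.
rewrite !nabla_lin !lieZl !lieZr !scalerA !proj_pZ !proj_kZ !nabla_lin !lieZl.
rewrite !scalerBr !scalerA.
by rewrite !mulrA.
Qed.

(** The connection does not change under homothety. The four frame vectors contribute c^(-2) and the
    metric contributes c, so each component is multiplied by 1 / c. *)
Lemma Rm_norm_scale x1 x2 c : 0 < c -> c * Rm_norm S (c * x1) (c * x2) = Rm_norm S x1 x2.
Proof.
move=> c0; have cs a : c * Num.sqrt a = Num.sqrt (c ^+ 2 * a).
  by rewrite sqrtrM ?sqr_ge0 // sqrtr_sqr ger0_norm // ltW.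
rewrite /Rm_norm /Riem_norm cs.
congr Num.sqrt; pose k := (Num.sqrt c)^-1.
have k2 : k * k * c = 1.
  by rewrite /k -invfM -expr2 sqr_sqrtr ?(ltW c0) // mulVf // gt_eqF.
have sumE (F : M -> R) : \sum_(u <- metric_onb S (c * x1) (c * x2)) F u =
    \sum_(u <- metric_onb S x1 x2) F (k *: u).
  rewrite !metric_onb_map !big_map; apply: eq_bigr => i _; congr F.
  rewrite /scaled scalerA -invfM -sqrtrM ?(ltW c0) //.
  by case: i => -[] u.
have hm := metric_symform hS x1 x2.
rewrite sumE mulr_sumr; apply: eq_bigr => u _; rewrite sumE mulr_sumr; apply: eq_bigr => v _.
rewrite sumE mulr_sumr; apply: eq_bigr => w _; rewrite sumE mulr_sumr; apply: eq_bigr => z _.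
have m U V : metric S (c * x1) (c * x2) U V = c * metric S x1 x2 U V.
  by rewrite !metricE; ring.
rewrite riem_scale // m (symformZl hm) (symformZr hm).
move: (metric S x1 x2 _ _) => a; rewrite -exprMn; congr (_ ^+ 2).
transitivity ((k * k * c) * (k * k * c) * a); first by ring.
by rewrite k2 !mul1r.
Qed.

Section Limit.
Variables (T : Type) (F : set_system T).
Context {FF : Filter F}.
Variables (x1 x2 : T -> R) (a1 a2 : R).
Hypotheses (c1 : x1 t @[t --> F] --> a1) (c2 : x2 t @[t --> F] --> a2).
Hypotheses (a10 : 0 < a1) (a20 : 0 < a2).

Local Lemma mcvg_lie A B (LA LB : M) : mcvg F A LA -> mcvg F B LB ->
  mcvg F (fun t => lie (A t) (B t)) (lie LA LB).
Proof. by move=> hA hB; apply: mcvgD; [|apply: mcvgN]; exact: mcvg_mul. Qed.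

Local Lemma metric_cvg A B (LA LB : M) : mcvg F A LA -> mcvg F B LB ->
  metric S (x1 t) (x2 t) (A t) (B t) @[t --> F] --> metric S a1 a2 LA LB.
Proof.
move=> hA hB; rewrite metricE; under eq_fun do rewrite metricE.
apply: cvgD; apply: cvgM => //; apply: symform_cvg => //; [exact: Q1_symform | exact: Q2_symform].
Qed.

Local Lemma scaled_cvg i : mcvg F (fun t => scaled (x1 t) (x2 t) i) (scaled a1 a2 i).
Proof.
case: i => b u; apply: mcvgZ; last exact: mcvg_cst.
have key (x : T -> R) (a : R) : 0 < a -> x t @[t --> F] --> a ->
    (Num.sqrt (x t))^-1 @[t --> F] --> (Num.sqrt a)^-1.
  move=> a0 c; apply: cvgV; first by rewrite gt_eqF // sqrtr_gt0.
  by apply: (cvg_comp _ _ c); exact: sqrt_continuous.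
by case: b; exact: key.
Qed.

Local Lemma nabla_cvg A B (LA LB : M) : mcvg F A LA -> mcvg F B LB ->
  mcvg F (fun t => nab (x1 t) (x2 t) (A t) (B t)) (nab a1 a2 LA LB).
Proof.
move=> hA hB; rewrite /nabla metric_onb_map big_map.
under eq_fun do rewrite metric_onb_map big_map.
apply: mcvgD; apply: mcvgZ; try exact: cvg_cst.
  by apply: mcvg_lin; exact: mcvg_lie.
apply: mcvg_sum => i; have hi : mcvg F (fun t => scaled (x1 t) (x2 t) i) (scaled a1 a2 i) by exact: scaled_cvg.
apply: mcvgZ => //.
by apply: cvgD; apply: metric_cvg => //; apply: mcvg_lin; exact: mcvg_lie.
Qed.

Local Lemma riem_cvg A B C (LA LB LC : M) : mcvg F A LA -> mcvg F B LB -> mcvg F C LC ->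
  mcvg F (fun t => riem (x1 t) (x2 t) (A t) (B t) (C t)) (riem a1 a2 LA LB LC).
Proof.
move=> hA hB hC; have hAB := mcvg_lie hA hB.
apply: mcvgD; [apply: mcvgD; [apply: mcvgD|]|].
- by apply: nabla_cvg => //; exact: nabla_cvg.
- by apply: mcvgN; apply: nabla_cvg => //; exact: nabla_cvg.
- by apply: mcvgN; apply: nabla_cvg => //; exact: mcvg_lin.
- by apply: mcvgN; apply: mcvg_lie => //; exact: mcvg_lin.
Qed.

Lemma Rm_norm_cvg : Rm_norm S (x1 t) (x2 t) @[t --> F] --> Rm_norm S a1 a2.
Proof.
rewrite /Rm_norm /Riem_norm; apply: (@cvg_comp _ _ _ _ Num.sqrt); last exact: sqrt_continuous.
have sumE (G : M -> R) y1 y2 : \sum_(u <- metric_onb S y1 y2) G u =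
    \sum_(i <- onb_index) G (scaled y1 y2 i) by rewrite metric_onb_map big_map.
rewrite sumE; under eq_fun do rewrite sumE; apply: cvg_sum_seq => i.
rewrite sumE; under eq_fun do rewrite sumE; apply: cvg_sum_seq => j.
rewrite sumE; under eq_fun do rewrite sumE; apply: cvg_sum_seq => k.
rewrite sumE; under eq_fun do rewrite sumE; apply: cvg_sum_seq => l.
have hr : mcvg F (fun t => riem (x1 t) (x2 t) (scaled (x1 t) (x2 t) i) (scaled (x1 t) (x2 t) j)
    (scaled (x1 t) (x2 t) k)) (riem a1 a2 (scaled a1 a2 i) (scaled a1 a2 j) (scaled a1 a2 k)).
  by apply: riem_cvg; exact: scaled_cvg.
rewrite expr2; under eq_fun do rewrite expr2.
by apply: cvgM; apply: metric_cvg => //; exact: scaled_cvg.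
Qed.

End Limit.

End CurvatureNorm.

(** * The flow on the homogeneous space *)

Section Assembly.
Variables (R : realType) (n : nat) (S : homog_data R n).
Local Notation M := 'M[R]_n.
Hypothesis hS : two_summands S.

Lemma formQ00 : formQ S 0 0 = 0.
Proof. by have := symform0l (Q2_symform hS) 0; rewrite /Q2 !linear0. Qed.

Lemma Q2_hh X : X \in (algk S + pp1 S)%VS -> Q2 S X X = 0.
Proof. by move=> Xh; rewrite /Q2 (proj_p2_hh hS Xh) formQ00. Qed.

Lemma Q1_onb1 u : u \in onb1 S -> Q1 S u u = 1 /\ Q2 S u u = 0.
Proof.
move=> ue; have up := onb1_mem hS ue; have [_ ho] := ts_onb1 hS; split.
  rewrite /Q1 (proj_p1E hS up).
  have ui : (index u (onb1 S) < size (onb1 S))%N by rewrite index_mem.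
  by have := ho _ _ ui ui; rewrite nth_index // eqxx.
by rewrite Q2_hh // p1_hh.
Qed.

Lemma Q2_onb2 u : u \in onb2 S -> Q2 S u u = 1 /\ Q1 S u u = 0.
Proof.
move=> ue; have up := onb2_mem hS ue; have [_ ho] := ts_onb2 hS; split.
  rewrite /Q2 (proj_p2E hS up).
  have ui : (index u (onb2 S) < size (onb2 S))%N by rewrite index_mem.
  by have := ho _ _ ui ui; rewrite nth_index // eqxx.
by rewrite /Q1 (proj_p1_p2 hS up) formQ00.
Qed.

Lemma onb_head1 : exists u, u \in onb1 S.
Proof.
have := dim1_gt0 hS; rewrite -(onb1_trace hS).
case: (onb1 S) => [|u s _]; first by rewrite big_nil ltxx.
by exists u; exact: mem_head.
Qed.

Lemma onb_head2 : exists u, u \in onb2 S.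
Proof.
have := dim2_gt0 hS; rewrite -(onb2_trace hS).
case: (onb2 S) => [|u s _]; first by rewrite big_nil ltxx.
by exists u; exact: mem_head.
Qed.

Lemma invariant_metric_Q2 (l : R) : 0 < l ->
  invariant_metric (grpH S) (algg S) (algk S + pp1 S)%VS (fun X Y => l * Q2 S X Y).
Proof.
move=> l0; have s2 := Q2_symform hS; split.
- move=> r X Y Z _ _ _; rewrite !(symformDl s2, symformDr s2, symformZl s2, symformZr s2).
  by split; ring.
- by move=> X Y _ _; rewrite (symformC s2).
- by move=> a X Y Ha Xg Yg; rewrite Q2_Ad_invariant.
move=> X Xg; split; first by rewrite mulr_ge0 ?(ltW l0) // Q2_ge0.
split=> [/eqP|Xh]; last by rewrite Q2_hh ?mulr0.
rewrite mulf_eq0 gt_eqF //= => /eqP h.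
have p0 : proj_p2 S X = 0.
  apply: contrapT => np; have [_ _ pos] := ts_Q hS.
  by have := pos _ (p2_pp (proj_p2_mem S X)) np; rewrite -/(Q2 S X X) h ltxx.
by have := proj_hh_sub hS Xg; rewrite p0 subr0.
Qed.

End Assembly.

Theorem theorem4p9 (R : realType) (n : nat) (S : homog_data R n)
    (hS : two_summands S)
    (h122 : 0 < t122 S)
    (hC : 0 < hrfC S)
    (y1 y2 : R)
    (hy1 : 0 < y1) (hy12 : y1 < y2)
    (hroots : forall y : R,
       hrfC S - hrfD S * y + (hrfA S + hrfB S) * y ^+ 2 = 0 <->
       y = y1 \/ y = y2)
    (heinstein : forall x1 x2 : R, 0 < x1 -> 0 < x2 ->
       (einstein S x1 x2 <-> x1 / x2 = y1 \/ x1 / x2 = y2))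
    (x1_0 x2_0 : R) (hx1 : 0 < x1_0) (hx2 : 0 < x2_0)
    (hinit : x1_0 / x2_0 < y1) :
  exists2 T : R, 0 < T &
    exists x1 x2 : R -> R,
      [/\ typeI_ancient_from S x1_0 x2_0 T x1 x2,
          forall z1 z2 : R -> R, typeI_ancient_from S x1_0 x2_0 T z1 z2 ->
            forall t, t < T -> z1 t = x1 t /\ z2 t = x2 t,
          fibre_shrinks T x1 x2,
          collapses_to_base S T x1 x2
        & x1 t / x2 t @[t --> -oo] --> y1].
Proof.
pose A := hrfA S; pose B := hrfB S; pose C := hrfC S; pose D := hrfD S.
have A0 : 0 < A by rewrite divr_gt0 // mulr_gt0 // (dim1_gt0 hS).
have B0 : 0 < B by rewrite divr_gt0 // (dim2_gt0 hS).
have e1 : C - D * y1 + (A + B) * y1 ^+ 2 = 0 by apply/hroots; left.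
have e2 : C - D * y2 + (A + B) * y2 ^+ 2 = 0 by apply/hroots; right.
(* Viete's relations for the two roots, obtained by subtracting the two equations and dividing by y2
   - y1. *)
have DE : D = (A + B) * (y1 + y2).
  have ne : y2 - y1 != 0 by rewrite subr_eq0 gt_eqF.
  apply: (mulIf ne).
  have : D * (y2 - y1) - (A + B) * (y1 + y2) * (y2 - y1) =
    (C - D * y1 + (A + B) * y1 ^+ 2) - (C - D * y2 + (A + B) * y2 ^+ 2) by ring.
  by rewrite e1 e2 subrr => /eqP; rewrite subr_eq0 => /eqP.
have CE : C = (A + B) * y1 * y2.
  have : C = (C - D * y1 + (A + B) * y1 ^+ 2) + D * y1 - (A + B) * y1 ^+ 2 by ring.
  by rewrite e1 DE => ->; ring.
have [T T0 [x1 [x2 [sol [x10 x20] c1 [l l0 c2] cy]]]] :=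
  HRF_existence A0 B0 hy1 hy12 CE DE hx1 hx2 hinit.
have ric (a b : R) X Y : 0 < a -> 0 < b -> X \in pp S -> Y \in pp S ->
    - 2 * Ric S a b X Y = - (C + A * (a / b) ^+ 2) * Q1 S X Y + - (D - B * (a / b)) * Q2 S X Y.
  by move=> a0 b0 Xp Yp; rewrite mulNr (Ric_diag hS hy1 hy12 hroots heinstein) // opprD !mulNr.
exists T => //; exists x1, x2; split=> //.
- split=> //.
  + move=> t tT; have [p1 p2 d1 d2] := sol t tT; split=> // X Y Xp Yp.
    rewrite ric //.
    have -> : (fun s => metric S (x1 s) (x2 s) X Y) =
       fun s => x1 s * Q1 S X Y + x2 s * Q2 S X Y by [].
    apply: is_derive_add; rewrite mulrC.
      under eq_fun do rewrite mulrC.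
      exact: is_derive_scale.
    under eq_fun do rewrite mulrC.
    exact: is_derive_scale.
  (* The derivative of x2 tends to -(D - B y1), so x2 / |t| tends to D - B y1, and x1 / |t|, which
     is y times this quotient, tends to y1 (D - B y1). *)
  + exists (Rm_norm S (y1 * (D - B * y1)) (D - B * y1)).
    have nT : \forall t \near (-oo : set_system R), t < Num.min T 0.
      by apply: nbhs_ninfty_lt; exact: num_real.
    have a20 : 0 < D - B * y1.
      have -> : D - B * y1 = A * y1 + (A + B) * y2 by rewrite DE; ring.
      by rewrite addr_gt0 // mulr_gt0 ?addr_gt0 // (lt_trans hy1).
    have l2 : x2 t / t @[t --> -oo] --> - (D - B * y1).
      apply: (@slope_limit _ x2 (fun t => - (D - B * (x1 t / x2 t))) T).
        by move=> t /sol[].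
      apply: cvgN; apply: cvgB; first exact: cvg_cst.
      by apply: cvgM => //; exact: cvg_cst.
    have l2' : `|t|^-1 * x2 t @[t --> -oo] --> D - B * y1.
      have h : - (x2 t / t) @[t --> -oo] --> D - B * y1.
        by rewrite -[D - B * y1]opprK; exact: cvgN.
      apply: cvg_trans h; apply: near_eq_cvg; near=> t.
      have : t < Num.min T 0 by near: t.
      by rewrite lt_min => /andP[_ t0]; rewrite ltr0_norm // invrN mulNr mulrC.
    have l1' : `|t|^-1 * x1 t @[t --> -oo] --> y1 * (D - B * y1).
      have h : x1 t / x2 t * (`|t|^-1 * x2 t) @[t --> -oo] --> y1 * (D - B * y1).
        exact: cvgM.
      apply: cvg_trans h; apply: near_eq_cvg; near=> t.
      have : t < Num.min T 0 by near: t.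
      rewrite lt_min => /andP[/sol[_ p2 _ _] _].
      by rewrite mulrCA mulfVK // gt_eqF.
    have h : Rm_norm S (`|t|^-1 * x1 t) (`|t|^-1 * x2 t) @[t --> -oo] -->
        Rm_norm S (y1 * (D - B * y1)) (D - B * y1).
      by apply: Rm_norm_cvg => //; exact: mulr_gt0.
    apply: cvg_trans h; apply: near_eq_cvg; near=> t.
    have : t < Num.min T 0 by near: t.
    rewrite lt_min => /andP[_ t0].
    have nt0 : 0 < `|t| by rewrite normr_gt0 lt_eqF.
    rewrite -(Rm_norm_scale hS (x1 t) (x2 t) (c := `|t|^-1)) ?invr_gt0 //.
    by rewrite mulVKf // gt_eqF.
- move=> z1 z2 [hz _ z10 z20] t tT.
  apply: (HRF_unique (A := A) (B := B) (C := C) (D := D) T0 sol) tT; rewrite ?z10 ?z20 ?x10 ?x20 //.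
  move=> s sT; have [p1 p2 hd] := hz s sT; split=> //.
    (* On a unit vector of p1 the metric takes the value x1, so the tensor equation evaluated there
       is the scalar equation. A unit vector of p2 does the same for x2. *)
    have [u ue] := onb_head1 hS; have [q1 q2] := Q1_onb1 hS ue.
    have up := p1_pp (onb1_mem hS ue).
    have := hd u u up up; rewrite ric // q1 q2 mulr1 mulr0 addr0.
    congr is_derive; apply/funext => r; by rewrite metricE q1 q2 mulr1 mulr0 addr0.
  have [u ue] := onb_head2 hS; have [q2 q1] := Q2_onb2 hS ue.
  have up := p2_pp (onb2_mem hS ue).
  have := hd u u up up; rewrite ric // q1 q2 mulr1 mulr0 add0r.
  congr is_derive; apply/funext => r; by rewrite metricE q1 q2 mulr1 mulr0 add0r.
- by split=> //; exists l.
- exists (fun X Y => l * Q2 S X Y); first exact: invariant_metric_Q2.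
  have nearT : \forall t \near T^'-, 0 < x1 t /\ 0 < x2 t.
    near=> t; have tT : t < T by near: t; exact: nbhs_left_lt.
    by have [p1 p2 _ _] := sol t tT.
  apply: (collapse_cvg (ts_G hS) (ts_H hS) (ts_K hS) _ _ (ts_connected hS) (ts_fibre hS)
    (ts_algg hS) (ts_algh hS) _ _ _ l0 nearT c1 c2).
  + by move=> a; exact: grpH_sub_G.
  + by move=> a; exact: grpK_sub_H.
  + by split; [exact: Q1_symform | exact: Q1_ge0].
  + by split; [exact: Q2_symform | exact: Q2_ge0].
  + by move=> X Xh; exact: Q2_hh.
Unshelve. all: by end_near.
Qed.
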